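(* Let $E$ be an infinite dimensional Banach space over $\mathbb{K}$, let $F$ be a Banach space over $\mathbb{K}$, and let $n\in\mathbb{N}$ with $n>1$. If $\mathcal{P}_{w}(^{n}E;F)$ contains an isomorphic copy of $c_{0}$, then $\mathcal{P}_{w}(^{n}E;F)$ is not complemented in $\mathcal{P}(^{n}E;F)$.
   Context: $\mathbb{K}$ is $\mathbb{R}$ or $\mathbb{C}$. For Banach spaces $E,F$ over $\mathbb{K}$ and $n\in\mathbb{N}=\{1,2,\dots\}$, $\mathcal{P}(^{n}E;F)$ is the Banach space of all continuous $n$-homogeneous polynomials from $E$ into $F$, with norm $\|P\|=\sup_{\|x\|\le 1}\|P(x)\|$. $\mathcal{P}_{w}(^{n}E;F)$ is the subspace of all $P\in\mathcal{P}(^{n}E;F)$ which are weakly continuous on bounded sets, that is, for each bounded set $B\subset E$ the restriction $P|_{B}:B\to F$ is continuous when $B$ carries the (relative) weak topology and $F$ the norm topology. A Banach space $X$ contains a (isomorphic) copy of $Y$ if some closed subspace of $X$ is linearly homeomorphic to $Y$. A subspace is complemented if it is the range of a bounded linear projection of the whole space. *)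

(* Defs.v *)
From HB Require Import structures.
From mathcomp Require Import all_boot all_order all_algebra.
From mathcomp Require Import complex.
From mathcomp Require Import all_classical all_reals all_analysis.

Set Implicit Arguments.
Unset Strict Implicit.
Unset Printing Implicit Defensive.

Import Order.TTheory GRing.Theory Num.Theory.
Import numFieldNormedType.Exports.

Local Open Scope classical_set_scope.
Local Open Scope ring_scope.

Variant scalar_kind := RealScalars | ComplexScalars.

Definition scalars (R : realType) (k : scalar_kind) : numFieldType :=
  match k with
  | RealScalars => R
  | ComplexScalars => R[i]
  end.

(* Norms take their values in the scalar field, hence so does this supremum;
   over R[i] it is taken for the partial order of R[i], for which any two
   nonnegative elements are comparable. *)
Definition supnorm (T : Type) (K : numFieldType) (V : normedModType K)
    (A : set T) (f : T -> V) : K :=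
  supremum 0 [set `|f x| | x in A].

Section supnorm_theory.
Variables (R : realType) (k : scalar_kind).
Local Notation K := (scalars R k).

Lemma scalars_supremums (A : set K) (M : K) : A !=set0 ->
  (forall a, A a -> 0 <= a <= M) -> supremums A !=set0.
Proof.
move: A M; case: k => /= A M [a0 Aa0] AM.
  have hsA : has_sup A.
    by split; [exists a0 | exists M => a /AM/andP[]].
  exists (sup A); split.
    exact: sup_upper_bound.
  by move=> b Ab; apply: ge_sup => //; exists a0.
pose B := [set complex.Re a | a in A].
have AE a : A a -> a = (complex.Re a)%:C%C.
  by move=> /AM /andP[]; case: a => x y; rewrite lecE /= => /andP[/eqP-> _].
have AMr a : A a -> complex.Re a <= complex.Re M.
  by move=> /AM /andP[_]; rewrite lecE => /andP[].
have hsB : has_sup B.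
  split; first by exists (complex.Re a0), a0.
  by exists (complex.Re M) => _ [a Aa <-]; exact: AMr.
exists (sup B)%:C%C; split.
  move=> a Aa; rewrite [a]AE// lecR.
  by apply: sup_upper_bound => //; exists a.
move=> b Ab; have := Ab _ Aa0; rewrite {1}(AE _ Aa0) !lecE /= => /andP[-> _] /=.
apply: ge_sup => [|_ [a Aa <-]]; first by exists (complex.Re a0), a0.
by have := Ab _ Aa; rewrite lecE => /andP[].
Qed.

Variables (T : Type) (V : normedModType K) (A : set T).
Implicit Types f g : T -> V.

Definition bounded_on f := exists M : K, forall x, A x -> `|f x| <= M.

Hypothesis A0 : A !=set0.

Lemma supnorm_lub f : bounded_on f ->
  supremums [set `|f x| | x in A] (supnorm A f).
Proof.
move=> [M fM]; rewrite /supnorm /supremum ifF; last first.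
  by apply/negP => /eqP; apply/eqP/set0P; case: A0 => x Ax; exists `|f x|, x.
have [y Sy] : supremums [set `|f x| | x in A] !=set0.
  apply: (@scalars_supremums _ M).
    by case: A0 => x Ax; exists `|f x|, x.
  by move=> _ [x Ax <-]; rewrite normr_ge0 fM.
by case: xgetP => [z -> //|/(_ y)].
Qed.

Lemma supnorm_ge f x : bounded_on f -> A x -> `|f x| <= supnorm A f.
Proof. by move=> /supnorm_lub[ub _] Ax; apply: ub; exists x. Qed.

Lemma supnorm_le f M : bounded_on f -> (forall x, A x -> `|f x| <= M) ->
  supnorm A f <= M.
Proof. by move=> /supnorm_lub[_ lb] fM; apply: lb => _ [x /fM + <-]. Qed.

Lemma supnormD f g : bounded_on f -> bounded_on g ->
  supnorm A (f \+ g) <= supnorm A f + supnorm A g.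
Proof.
move=> bf bg; have fgM x : A x -> `|(f \+ g) x| <= supnorm A f + supnorm A g.
  by move=> Ax; rewrite (le_trans (ler_normD _ _))// lerD// supnorm_ge.
by apply: supnorm_le => //; exists (supnorm A f + supnorm A g).
Qed.

Lemma supnormZ (l : K) f : bounded_on f ->
  supnorm A (fun x => l *: f x) = `|l| * supnorm A f.
Proof.
move=> bf; have lfM x : A x -> `|l *: f x| <= `|l| * supnorm A f.
  by move=> Ax; rewrite normrZ ler_wpM2l// supnorm_ge.
have blf : bounded_on (fun x => l *: f x) by exists (`|l| * supnorm A f).
apply/eqP; rewrite eq_le supnorm_le//=.
have [->|l0] := eqVneq l 0.
  rewrite normr0 mul0r; case: A0 => x Ax.
  rewrite (le_trans _ (supnorm_ge _ Ax))//.
  by exists 0 => y _; rewrite scale0r normr0.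
rewrite mulrC -ler_pdivlMr ?normr_gt0//; apply: supnorm_le => // x Ax.
rewrite ler_pdivlMr ?normr_gt0// mulrC -normrZ.
exact: (@supnorm_ge (fun x => l *: f x)).
Qed.

Lemma supnorm_eq0 f x : bounded_on f -> supnorm A f = 0 -> A x -> f x = 0.
Proof.
move=> bf f0 Ax; apply/eqP; rewrite -normr_eq0 eq_le normr_ge0 andbT -f0.
exact: supnorm_ge.
Qed.

End supnorm_theory.

Definition multilinear_map (K : numFieldType) (n : nat) (E F : lmodType K)
    (A : ('I_n -> E) -> F) : Prop :=
  forall (v : 'I_n -> E) (i : 'I_n),
    linear (fun x : E => A (fun j => if j == i then x else v j)).

Definition homogeneous_polynomial (K : numFieldType) (n : nat)
    (E F : lmodType K) (P : E -> F) : Prop :=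
  exists A : ('I_n -> E) -> F,
    multilinear_map A /\ forall x, P x = A (fun=> x).

Section homogeneous_polynomial_theory.
Variables (K : numFieldType) (n : nat).

Lemma homogeneous_polynomialZ (E F : lmodType K) (P : E -> F) (c : K) (x : E) :
  homogeneous_polynomial n P -> P (c *: x) = c ^+ n *: P x.
Proof.
move=> [A [lA PA]].
suff H m : (m <= n)%N ->
    A (fun i : 'I_n => if (i < m)%N then c *: x else x) = c ^+ m *: P x.
  rewrite -(H n)// PA; congr A; apply/funext => i.
  by rewrite ltn_ord.
elim: m => [|m IH] mn.
  by rewrite expr0 scale1r PA; congr A; apply/funext => i; rewrite ltn0.
pose i0 := Ordinal mn.
pose v (i : 'I_n) := if (i < m)%N then c *: x else x.
pose L y := A (fun j => if j == i0 then y else v j).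
have LE : linear L by exact: lA.
have L0 : L 0 = 0.
  by have := LE (-1) 0 0; rewrite scaler0 addr0 scaleN1r addNr.
have -> : (fun i : 'I_n => if (i < m.+1)%N then c *: x else x) =
          (fun j => if j == i0 then c *: x else v j).
  apply/funext => i; rewrite /v ltnS leq_eqVlt -val_eqE /=.
  by case: eqVneq.
rewrite -/(L (c *: x)) -[c *: x]addr0 LE L0 addr0 exprS -scalerA -IH;
  last exact: ltnW.
congr (_ *: A _); apply/funext => i; rewrite /v -val_eqE /=.
by case: eqVneq => // ->; rewrite ltnn.
Qed.

Variables E F : normedModType K.

Definition cont_hompoly : {pred E -> F} :=
  [pred P | `[< homogeneous_polynomial n P /\ continuous P >]].

Lemma cont_hompoly_submod : submod_closed cont_hompoly.
Proof.
split.
  apply/asboolP; split; last by move=> x; exact: cvg_cst.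
  exists (fun=> 0); split => // v i a x y.
  by rewrite scaler0 addr0.
move=> a P Q /asboolP[[A [lA PA]] cP] /asboolP[[B [lB QB]] cQ].
apply/asboolP; split.
  exists (fun v => a *: A v + B v); split; last first.
    by move=> x; rewrite -PA -QB.
  move=> v i b x y /=.
  by rewrite lA lB !scalerDr !scalerA [b * a]mulrC -!addrA; congr (_ + _);
    rewrite addrCA.
by move=> x; apply: (@cvgD _ F); [apply: cvgZr; exact: cP | exact: cQ].
Qed.

HB.instance Definition _ := GRing.isSubmodClosed.Build K (E -> F) cont_hompoly
  cont_hompoly_submod.

Record contPoly := ContPoly {
  contPoly_val :> E -> F;
  contPolyP : contPoly_val \in cont_hompoly }.

HB.instance Definition _ := [isSub for contPoly_val].
HB.instance Definition _ := [Choice of contPoly by <:].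
HB.instance Definition _ := [SubChoice_isSubLmodule of contPoly by <:].

Lemma contPoly_hom (P : contPoly) : homogeneous_polynomial n P.
Proof. by have /asboolP[] := contPolyP P. Qed.

Lemma contPoly_continuous (P : contPoly) : continuous P.
Proof. by have /asboolP[] := contPolyP P. Qed.

Lemma contPoly_bounded (P : contPoly) :
  exists M : K, forall x : E, `|x| <= 1 -> `|P x| <= M.
Proof.
have /cvg_bounded/ex_bound[M /nbhs_norm0P[e /= e0 eM]] :=
  @contPoly_continuous P 0.
pose d := e / 2; have d0 : 0 < d by rewrite divr_gt0.
exists ((d ^+ n)^-1 * M) => x x1.
rewrite ler_pdivlMl ?exprn_gt0// -[d in d ^+ n]gtr0_norm// -normrX -normrZ.
rewrite -homogeneous_polynomialZ; last exact: contPoly_hom.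
apply: eM => /=; rewrite normrZ gtr0_norm//.
rewrite (le_lt_trans (ler_piMr _ x1)) ?ltW//.
by rewrite /d ltr_pdivrMr// ltr_pMr// ltr1n.
Qed.

End homogeneous_polynomial_theory.

Section contPoly_norm.
Variables (R : realType) (k : scalar_kind) (n : nat).
Local Notation K := (scalars R k).
Variables E F : normedModType K.
Local Notation poly := (contPoly n E F).
Implicit Types P Q : poly.

Local Notation unit_ball := [set x : E | `|x| <= 1].

Definition contPoly_norm P : K := supnorm unit_ball P.

Let unit_ball0 : unit_ball !=set0.
Proof. by exists 0; rewrite /= normr0. Qed.

Let contPoly_normD P Q :
  contPoly_norm (P + Q) <= contPoly_norm P + contPoly_norm Q.
Proof. by apply: supnormD => //; exact: contPoly_bounded. Qed.

Let contPoly_normZ (l : K) P : contPoly_norm (l *: P) = `|l| * contPoly_norm P.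
Proof. by apply: supnormZ => //; exact: contPoly_bounded. Qed.

Let contPoly_norm_eq0 P : contPoly_norm P = 0 -> P = 0.
Proof.
move=> P0; apply/val_inj/funext => x /=.
have P1 y : `|y| <= 1 -> P y = 0.
  by apply: (supnorm_eq0 _ _ P0) => //; exact: contPoly_bounded.
have [->|x0] := eqVneq x 0; first by rewrite P1 ?normr0.
have -> : x = `|x| *: (`|x|^-1 *: x).
  by rewrite scalerA divff ?normr_eq0// scale1r.
rewrite (homogeneous_polynomialZ _ _ (contPoly_hom P)) P1 ?scaler0//.
by rewrite normfZV.
Qed.

HB.instance Definition _ := Lmodule_isNormed.Build K poly
  contPoly_normD contPoly_normZ contPoly_norm_eq0.

End contPoly_norm.

Section c0_def.
Variable K : numFieldType.

Definition null_seq : {pred nat -> K^o} := [pred u | `[< u @ \oo --> 0 >]].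

Lemma null_seq_submod : submod_closed null_seq.
Proof.
split; first by apply/asboolP; exact: cvg_cst.
move=> a u v /asboolP u0 /asboolP v0; apply/asboolP.
have -> : (0 : K^o) = a *: 0 + 0 by rewrite scaler0 addr0.
by apply: cvgD => //; exact: cvgZr.
Qed.

HB.instance Definition _ := GRing.isSubmodClosed.Build K (nat -> K^o) null_seq
  null_seq_submod.

Record c0 := C0 { c0_val :> nat -> K^o; c0P : c0_val \in null_seq }.

HB.instance Definition _ := [isSub for c0_val].
HB.instance Definition _ := [Choice of c0 by <:].
HB.instance Definition _ := [SubChoice_isSubLmodule of c0 by <:].

Lemma c0_bounded (u : c0) : exists M : K, forall i, `|u i| <= M.
Proof.
have /asboolP u0 := c0P u.
have uM : bounded_fun (c0_val u).
  by apply: cvg_seq_bounded; apply/cvg_ex; exists 0.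
have [M [_ /(_ (M + 1)) uM1]] := uM; exists (M + 1) => i.
by apply: uM1 => //; rewrite ltrDl.
Qed.

End c0_def.

Section c0_norm.
Variables (R : realType) (k : scalar_kind).
Local Notation K := (scalars R k).
Implicit Types u v : c0 K.

Definition c0_norm u : K := supnorm [set: nat] u.

Let nat0 : [set: nat] !=set0. Proof. by exists 0%N. Qed.

Let c0_bnd u : bounded_on [set: nat] u.
Proof. by have [M uM] := c0_bounded u; exists M. Qed.

Let c0_normD u v : c0_norm (u + v) <= c0_norm u + c0_norm v.
Proof. exact (supnormD nat0 (c0_bnd u) (c0_bnd v)). Qed.

Let c0_normZ (l : K) u : c0_norm (l *: u) = `|l| * c0_norm u.
Proof. exact (supnormZ nat0 l (c0_bnd u)). Qed.

Let c0_norm_eq0 u : c0_norm u = 0 -> u = 0.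
Proof.
move=> u0; apply/val_inj/funext => i.
exact (supnorm_eq0 nat0 (c0_bnd u) u0 I).
Qed.

HB.instance Definition _ := Lmodule_isNormed.Build K (c0 K)
  c0_normD c0_normZ c0_norm_eq0.

End c0_norm.

Section weak_topology.
Variables (K : numFieldType) (E : normedModType K).

Definition dual := {phi : {linear E -> K^o} | continuous phi}.

Let functional_topology (phi : dual) : Topological E :=
  Topological.class (initial_topology (sval phi : E -> K^o)).

Definition weak : Type := E.

HB.instance Definition _ :=
  Topological.copy weak (sup_topology functional_topology).

End weak_topology.

Definition weakly_continuous_on_bounded (K : numFieldType)
    (E F : normedModType K) (f : E -> F) : Prop :=
  forall B : set E, bounded_set B ->
    {within (B : set (weak E)), continuous (f : weak E -> F)}.

Definition weak_contPoly (K : numFieldType) (n : nat) (E F : normedModType K) :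
    set (contPoly n E F) :=
  [set P | weakly_continuous_on_bounded P].
Arguments weak_contPoly {K} n E F.

Definition finite_dimensional (K : numFieldType) (E : lmodType K) : Prop :=
  exists (m : nat) (e : 'I_m -> E),
    forall x, exists c : 'I_m -> K, x = \sum_(i < m) c i *: e i.

(* A is meant to be a linear subspace of X, with the norm of X. The copy of Y
   is range T: closed in A, with T a linear homeomorphism of Y onto it. *)
Definition contains_copy (K : numFieldType) (X : normedModType K) (A : set X)
    (Y : normedModType K) : Prop :=
  exists (T : {linear Y -> X}) (S : X -> Y),
    [/\ range T `<=` A,
        closed (range T : set (subspace A)),
        continuous T,
        cancel T S &
        {within range T, continuous S}].

Definition complemented (K : numFieldType) (X : normedModType K) (A : set X) :
    Prop :=
  exists p : {linear X -> X},
    [/\ exists M : K, forall x, `|p x| <= M * `|x|,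
        forall x, p (p x) = p x &
        range p = A].

(* Main.v *)
Require Import Defs.
From HB Require Import structures.
From mathcomp Require Import all_boot all_order all_algebra.
From mathcomp Require Import complex.
From mathcomp Require Import all_classical all_reals all_analysis.
From mathcomp Require Import ring lra zify.

Set Implicit Arguments.
Unset Strict Implicit.
Unset Printing Implicit Defensive.

Import Order.TTheory GRing.Theory Num.Theory.
Import numFieldNormedType.Exports.

Local Open Scope classical_set_scope.
Local Open Scope ring_scope.

(* Suppose that there is a projection. For polynomials P_i in P_w all of whose
   bounded multiples sum pointwise, with uniformly bounded partial sums, the
   projection and the pointwise sum agree on finite subsums, so by Phillips'
   lemma the projection G of some infinite subsum agrees with this subsum when
   tested against countably many points and functionals. As G is weakly
   continuous on bounded sets, it suffices to find such P_i for which the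
   subsums are far from being so.
   If E contains l_1, averaging functionals against Rademacher signs gives
   phi_i, square-summable at each point of E and almost biorthogonal to a
   sequence equivalent to the basis of l_1; then P_i = phi_i^n w does it.
   Otherwise bounded sequences of E have weakly Cauchy subsequences (Rosenthal),
   polynomials in P_w map them to Cauchy sequences, and it is enough that the
   P_i be bounded below on the unit ball. If the bounded multiples of the copy
   of the basis of c_0 converge pointwise, it can be taken for the P_i. If they
   do not at x, blocks of such a series at x are vectors y_i of F, bounded below
   and with weakly unconditionally Cauchy series, and P_i = phi_i^n y_i works for
   pointwise null functionals phi_i which are not null in norm
   (Josefson-Nissenzweig). Functionals are replaced by their real parts. *)

(** * Scalars, real parts and realification *)

(** The projected subsum G agrees with the subsum only on a countable family of tests, and the
    infinite set M is found after that family. Test vectors and functionals are therefore fixed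
    beforehand for all indices at once (all triples of indices, or two vectors and a norming
    functional for each index), and indices in M are picked only afterwards. The split into two
    cases comes from the ways of refuting weak continuity. Without l_1, weakly Cauchy sequences
    abound and sequences suffice. In l_1 itself, weakly convergent sequences converge in norm and
    detect nothing, so the contradiction must come from a weak neighbourhood of 0: finitely many
    functionals that nearly agree at three vectors y_i, y_j, y_l. The degree enters twice in the l_1
    case: n >= 2 makes the n-th powers of a square-summable sequence summable, and 2 + (-2)^n, which
    is 0 for n = 1, has modulus at least 2. *)

Section real_part.
Variables (R : realType) (k : scalar_kind).
Local Notation K := (scalars R k).

Definition reK : K -> R :=
  match k return scalars R k -> R with
  | RealScalars => id
  | ComplexScalars => @complex.Re R
  end.

Definition ofR : R -> K :=
  match k return R -> scalars R k with
  | RealScalars => id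
  | ComplexScalars => real_complex R
  end.

(** Set to 0 over the reals, so that identities such as [reK_split] have the same form for both
    kinds of scalars. *)
Definition iK : K :=
  match k return scalars R k with
  | RealScalars => 0
  | ComplexScalars => 'i%C
  end.

Lemma reKD : {morph reK : x y / x + y}.
Proof. by rewrite /reK; case: k => //= -[a b] [c d]. Qed.

Lemma reKN : {morph reK : x / - x}.
Proof. by rewrite /reK; case: k => //= -[a b]. Qed.

Lemma reK0 : reK 0 = 0.
Proof. by rewrite /reK; case: k. Qed.

Lemma ofRD : {morph ofR : x y / x + y}.
Proof. by rewrite /ofR; case: k => //= x y; rewrite rmorphD. Qed.

Lemma ofRN : {morph ofR : x / - x}.
Proof. by rewrite /ofR; case: k => //= x; rewrite rmorphN. Qed.

Lemma ofRM : {morph ofR : x y / x * y}.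
Proof. by rewrite /ofR; case: k => //= x y; rewrite rmorphM. Qed.

Lemma ofR0 : ofR 0 = 0. Proof. by rewrite /ofR; case: k. Qed.
Lemma ofR1 : ofR 1 = 1. Proof. by rewrite /ofR; case: k. Qed.

Lemma ofRK : cancel ofR reK.
Proof. by rewrite /ofR /reK; case: k. Qed.

Lemma reKM a z : reK (ofR a * z) = a * reK z.
Proof.
by rewrite /ofR /reK; case: k z => //= -[b c] /=; rewrite mul0r subr0.
Qed.

Lemma ge0_ofR z : 0 <= z -> z = ofR (reK z).
Proof.
rewrite /ofR /reK; case: k z => //= -[b c].
by rewrite lecE /= => /andP[/eqP -> _].
Qed.

Lemma ofR_le a b : (ofR a <= ofR b) = (a <= b).
Proof. by rewrite /ofR; case: k => //=; rewrite lecR. Qed.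

Lemma ofR_lt a b : (ofR a < ofR b) = (a < b).
Proof. by rewrite /ofR; case: k => //=; rewrite ltcR. Qed.

Lemma norm_ofR a : `|ofR a| = ofR `|a|.
Proof. by rewrite /ofR; case: k => //=; rewrite normc_def /= expr0n addr0 sqrtr_sqr. Qed.

Lemma reK_norm z : `|reK z| <= reK `|z|.
Proof.
rewrite /reK; case: k z => //= -[a b] /=.
by rewrite -sqrtr_sqr ler_sqrt ?addr_ge0 ?sqr_ge0// lerDl sqr_ge0.
Qed.

Lemma reK_split z : z = ofR (reK z) - iK * ofR (reK (iK * z)).
Proof.
rewrite /ofR /reK /iK; case: k z => /= [z|[a b]]; first by rewrite mul0r subr0.
by apply/eqP; rewrite eq_complex /=; apply/andP; split; apply/eqP; ring.
Qed.

Lemma iK_sq : (k = RealScalars /\ iK = 0) \/ iK * iK = -1.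
Proof.
rewrite /iK; case: k => /=; [by left|right].
by rewrite -expr2 sqr_i.
Qed.

(** Norms are [K]-valued; estimates are made with this real number, in a totally ordered field. *)
Definition nrm (V : normedModType K) (x : V) : R := reK `|x|.

Section nrm.
Variable V : normedModType K.
Implicit Types x y : V.

Lemma nrmE x : `|x| = ofR (nrm x).
Proof. by rewrite -ge0_ofR. Qed.

Lemma nrm_ge0 x : 0 <= nrm x.
Proof. by rewrite -ofR_le -nrmE ofR0. Qed.

Lemma nrm_le x a : (nrm x <= a) = (`|x| <= ofR a).
Proof. by rewrite nrmE ofR_le. Qed.

Lemma nrmD x y : nrm (x + y) <= nrm x + nrm y.
Proof. by rewrite nrm_le ofRD -!nrmE ler_normD. Qed.

Lemma nrmN x : nrm (- x) = nrm x.
Proof. by rewrite /nrm normrN. Qed.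

Lemma nrm0 : nrm (0 : V) = 0.
Proof. by rewrite /nrm normr0 reK0. Qed.

Lemma nrmB x y : nrm (x - y) <= nrm x + nrm y.
Proof. by rewrite (le_trans (nrmD _ _))// nrmN. Qed.

Lemma nrm_distC x y : nrm (x - y) = nrm (y - x).
Proof. by rewrite -nrmN opprB. Qed.

Lemma nrmZ a x : nrm (a *: x) = nrm (a : K^o) * nrm x.
Proof. by rewrite {1}/nrm normrZ [X in X * _](ge0_ofR (normr_ge0 a)) reKM. Qed.

Lemma nrmZR a x : nrm (ofR a *: x) = `|a| * nrm x.
Proof. by rewrite {1}/nrm normrZ norm_ofR reKM. Qed.

Lemma nrm_eq0 x : nrm x = 0 -> x = 0.
Proof. by move=> x0; apply/eqP; rewrite -normr_eq0 nrmE x0 ofR0. Qed.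

Lemma nrm_sum (I : Type) (s : seq I) (P : pred I) (F : I -> V) :
  nrm (\sum_(i <- s | P i) F i) <= \sum_(i <- s | P i) nrm (F i).
Proof.
elim/big_rec2: _ => [|i b x _ H]; first by rewrite nrm0.
by rewrite (le_trans (nrmD _ _))// lerD2l.
Qed.
End nrm.

Lemma ofR_nat n : ofR n%:R = n%:R.
Proof. by elim: n => [|n IH]; rewrite ?ofR0// -!natr1 ofRD IH ofR1. Qed.

Lemma nrmX (z : K^o) n : nrm (z ^+ n : K^o) = nrm z ^+ n.
Proof.
elim: n => [|n IH]; first by rewrite !expr0 /nrm normr1 -ofR1 ofRK.
by rewrite !exprS -IH; exact: nrmZ.
Qed.

Lemma nrm_ofR a : nrm (ofR a : K^o) = `|a|.
Proof. by rewrite /nrm norm_ofR ofRK. Qed.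

Lemma nrm_iK : nrm (iK : K^o) <= 1.
Proof.
case: iK_sq => [[_ ->]|i2]; first by rewrite nrm0.
have : nrm (iK ^+ 2 : K^o) = 1 by rewrite expr2 i2 nrmN /nrm normr1 -ofR1 ofRK.
rewrite nrmX => h; have := nrm_ge0 (iK : K^o); nra.
Qed.

Lemma cvg_nrm (V : normedModType K) (u : nat -> V) (l : V) :
  (forall e : R, 0 < e -> \forall n \near \oo, nrm (u n - l) < e) <-> u @ \oo --> l.
Proof.
split=> [H|].
  apply/cvgrPdist_lt => e e0; near=> n.
  rewrite distrC nrmE [e]ge0_ofR ?ltW// ofR_lt.
  near: n; apply: H; by rewrite -ofR_lt ofR0 -ge0_ofR// ltW.
move=> /cvgrPdist_lt H e e0; near=> n.
rewrite -ofR_lt -nrmE distrC; near: n; apply: H; by rewrite -ofR0 ofR_lt.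
Unshelve. all: by end_near. Qed.

Lemma cvg_nrm_nat (V : normedModType K) (u : nat -> V) (l : V) :
  (forall e : R, 0 < e -> exists J, forall n, (J <= n)%N -> nrm (u n - l) < e) <-> u @ \oo --> l.
Proof.
rewrite -cvg_nrm; split=> H e e0; have := H e e0.
  by move=> [J HJ]; exists J.
by move=> [J _ HJ]; exists J.
Qed.

End real_part.

Lemma complete_nrm (R : realType) (k : scalar_kind)
    (F : completeNormedModType (scalars R k)) (u : nat -> F) :
  (forall e : R, 0 < e -> exists J, forall m n, (J <= m)%N -> (J <= n)%N ->
     nrm (u m - u n) < e) ->
  exists l : F, u @ \oo --> l.
Proof.
move=> H; suff : cauchy (u @ \oo) by move=> /cauchy_cvg/cvg_ex.
apply: cauchy_exP => e e0.
have e1 : 0 < reK e by rewrite -(@ofR_lt _ k) ofR0 -ge0_ofR// ltW.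
have [J HJ] := H _ e1.
exists (u J); exists J => // n /= Jn.
by rewrite -ball_normE /= nrmE [e]ge0_ofR ?ltW// ofR_lt HJ.
Qed.

(** An alias, so that the same vectors can carry a module structure over [R] besides the one over
    the scalars. *)
Definition realified (R : realType) (k : scalar_kind)
  (E : lmodType (scalars R k)) : Type := E.

Section realified.
Variables (R : realType) (k : scalar_kind) (E : lmodType (scalars R k)).
HB.instance Definition _ := GRing.Zmodule.on (realified E).

Let scaleR (a : R) (x : realified E) : realified E := @ofR R k a *: (x : E).

Let scaleRA a b x : scaleR a (scaleR b x) = scaleR (a * b) x.
Proof. by rewrite /scaleR scalerA ofRM. Qed.
Let scaleR1 : left_id 1 scaleR.
Proof. by move=> x; rewrite /scaleR ofR1 scale1r. Qed.
Let scaleRDr : right_distributive scaleR +%R.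
Proof. by move=> a x y; rewrite /scaleR scalerDr. Qed.
Let scaleRDl x : {morph scaleR^~ x : a b / a + b}.
Proof. by move=> a b; rewrite /scaleR ofRD scalerDl. Qed.
HB.instance Definition _ := GRing.Zmodule_isLmodule.Build R (realified E)
  scaleRA scaleR1 scaleRDr scaleRDl.

End realified.

(** * Norming real functionals *)

Section hahn_banach.
Variables (R : realType) (V : lmodType R).
Implicit Types (p q g : V -> R) (x y : V) (a t : R).

Definition seminorm p :=
  (forall x y, p (x + y) <= p x + p y) /\
  (forall a x, p (a *: x) = `|a| * p x).

(** The unit ball of the real dual: for linear g and a seminorm p, g <= p amounts to |g| <= p. *)
Definition bfun p g :=
  (forall a x y, g (a *: x + y) = a * g x + g y) /\ (forall x, g x <= p x).

Let sublinear q :=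
  (forall x y, q (x + y) <= q x + q y) /\
  (forall a x, 0 < a -> q (a *: x) <= a * q x).

Let sublinear0 q : sublinear q -> q 0 = 0.
Proof.
move=> [_ qZ]; have := qZ 2 0 ltac:(lra); have := qZ 2^-1 0 ltac:(lra).
by rewrite !scaler0; lra.
Qed.

Let sublinearZ q t x : sublinear q -> 0 <= t -> q (t *: x) = t * q x.
Proof.
move=> ql; rewrite le_eqVlt => /orP[/eqP <-|t0].
  by rewrite scale0r mul0r sublinear0.
apply/eqP; rewrite eq_le ql.2//=.
have := ql.2 t^-1 (t *: x); rewrite invr_gt0 => /(_ t0).
by rewrite scalerA mulVf ?gt_eqF// scale1r ler_pdivlMl.
Qed.

(** The infimum [qinf q y] of this set is a sublinear functional below q, and t = 1 shows that its
    value at - y is at most - q y. *)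
Let qset q y x := [set q (x + t *: y) - t * q y | t in [set t | 0 <= t]].
Let qinf q y x := inf (qset q y x).

Let qset0 q y x : qset q y x !=set0.
Proof. by exists (q (x + 0 *: y) - 0 * q y); exists 0 => //=. Qed.

Let qset_lb q y x : sublinear q -> lbound (qset q y x) (- q (- x)).
Proof.
move=> ql _ [t /= t0 <-]; rewrite -(sublinearZ _ ql t0).
have := ql.1 (x + t *: y) (- x); rewrite addrAC subrr add0r; lra.
Qed.

Let qinf_le q y x t : sublinear q -> 0 <= t ->
  qinf q y x <= q (x + t *: y) - t * q y.
Proof.
by move=> ql t0; apply: ge_inf; [exists (- q (- x)); exact: qset_lb|exists t].
Qed.

Let qinf_sublinear q y : sublinear q -> sublinear (qinf q y).
Proof.
move=> ql; have lb x : has_lbound (qset q y x).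
  by exists (- q (- x)); exact: qset_lb.
split=> [x x'|a x a0].
  apply/ler_addgt0Pr => e e0; have e2 : 0 < e / 2 by rewrite divr_gt0.
  have [_ [t /= t0 <-] H] := inf_adherent e2 (conj (qset0 q y x) (lb x)).
  have [_ [t' /= t'0 <-] H'] := inf_adherent e2 (conj (qset0 q y x') (lb x')).
  have := @qinf_le q y (x + x') (t + t') ql (addr_ge0 t0 t'0).
  rewrite scalerDl addrACA.
  have := ql.1 (x + t *: y) (x' + t' *: y); rewrite -!/(qinf _ _ _) in H H' *; lra.
rewrite mulrC -ler_pdivrMr//; apply: lb_le_inf => // _ [t /= t0 <-].
rewrite ler_pdivrMr//.
have at0 : 0 <= a * t by rewrite mulr_ge0// ltW.
apply: (le_trans (qinf_le y (a *: x) ql at0)).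
by rewrite -scalerA -scalerDr (sublinearZ _ ql (ltW a0)); lra.
Qed.

(** Minimality against [qinf q y] gives q x <= q (x + y) - q y, the missing half of additivity. *)
Let minimal_linear q : sublinear q ->
  (forall q', sublinear q' -> (forall x, q' x <= q x) -> forall x, q x <= q' x) ->
  forall a x y, q (a *: x + y) = a * q x + q y.
Proof.
move=> ql qmin.
have qD x y : q (x + y) = q x + q y.
  apply/eqP; rewrite eq_le ql.1 /=.
  have := qmin _ (qinf_sublinear y ql) _ x.
  have := qinf_le y x ql ler01; rewrite scale1r mul1r => h1 h2.
  suff : q x <= qinf q y x by lra.
  apply: h2 => z; have := qinf_le y z ql (lexx 0).
  by rewrite scale0r addr0 mul0r subr0.
have qN x : q (- x) = - q x.
  by apply/eqP; rewrite -addr_eq0 addrC -qD subrr sublinear0.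
move=> a x y; rewrite qD; congr (_ + _).
have [a0|a0] := leP 0 a; first exact: sublinearZ.
rewrite -[a]opprK scaleNr qN sublinearZ ?oppr_ge0 ?ltW//; lra.
Qed.

Let exists_linear p : sublinear p -> exists2 g,
  (forall a x y, g (a *: x + y) = a * g x + g y) & forall x, g x <= p x.
Proof.
move=> pl.
pose T := {q : V -> R | sublinear q /\ forall x, q x <= p x}.
pose r (s t : T) := `[< forall x, sval t x <= sval s x >].
pose t0 : T := exist _ p (conj pl (fun=> lexx _)).
have [||A Atot|[q [ql qp]] qmax] := @ZL_preorder T t0 r.
- by move=> t; apply/asboolP.
- move=> a b c /asboolP ab /asboolP bc; apply/asboolP => x.
  exact: le_trans (bc x) (ab x).
- have [[s0 As0]|A0] := pselect (exists s, A s); last first.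
    by exists t0 => s As; case: A0; exists s.
  (* The pointwise infimum of a chain bounds it. Of two members that nearly attain the infimum at x
     and at y, the smaller one serves at both points, hence subadditivity. *)
  pose m x := inf [set sval s x | s in A].
  have m0 x : [set sval s x | s in A] !=set0 by exists (sval s0 x), s0.
  have mlb x : has_lbound [set sval s x | s in A].
    exists (- p (- x)) => _ [[s [sl sp]] As <-] /=.
    have := sl.1 x (- x); rewrite subrr sublinear0// => h.
    have := sp (- x); lra.
  have mle s x : A s -> m x <= sval s x by move=> As; apply: ge_inf => //; exists s.
  have ml : sublinear m.
    split=> [x y|a x a0].
      apply/ler_addgt0Pr => e e0; have e2 : 0 < e / 2 by rewrite divr_gt0.
      have [_ [s As <-] H] := inf_adherent e2 (conj (m0 x) (mlb x)).
      have [_ [t At <-] H'] := inf_adherent e2 (conj (m0 y) (mlb y)).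
      have [/asboolP st|/asboolP ts] := Atot _ _ As At.
        have := mle _ (x + y) At; have := (svalP t).1.1 x y.
        have := st x; rewrite -!/(m _) in H H' *; lra.
      have := mle _ (x + y) As; have := (svalP s).1.1 x y.
      have := ts y; rewrite -!/(m _) in H H' *; lra.
    rewrite mulrC -ler_pdivrMr//; apply: lb_le_inf => // _ [s As <-].
    rewrite ler_pdivrMr// mulrC.
    exact: le_trans (mle _ _ As) ((svalP s).1.2 _ _ a0).
  have mp x : m x <= p x by apply: le_trans (mle _ _ As0) ((svalP s0).2 x).
  by exists (exist _ m (conj ml mp)) => s As; apply/asboolP => x; exact: mle.
exists q => //; apply: minimal_linear => // q' q'l q'q.
have q'p x : q' x <= p x by apply: le_trans (q'q x) (qp x).
by have := qmax (exist _ q' (conj q'l q'p)); move=> h; apply/asboolP; apply: h; apply/asboolP.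
Qed.

(** A linear g below [qinf p x0] satisfies g (- x0) <= - p x0, so it attains p at x0. *)
Lemma hahn_banach p x0 : seminorm p -> exists2 g, bfun p g & g x0 = p x0.
Proof.
move=> [pD pZ]; have pl : sublinear p.
  by split=> // a x a0; rewrite pZ gtr0_norm.
have [g gl gp] := exists_linear (qinf_sublinear x0 pl).
have gp' x : g x <= p x.
  have := gp x; have := qinf_le x0 x pl (lexx 0).
  by rewrite scale0r addr0 mul0r subr0; lra.
exists g => //; apply/eqP; rewrite eq_le gp'/=.
have := gp (- x0); have := qinf_le x0 (- x0) pl ler01.
rewrite scale1r addNr mul1r (sublinear0 pl).
have := gl (-1) x0 (- x0 + x0 - x0 + x0); rewrite !addNr sub0r addNr addr0 scaleN1r.
have := gl 1 0 0; rewrite scale1r addr0; lra.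
Qed.

Section bfun_theory.
Variables (p : V -> R) (g : V -> R).
Hypotheses (sp : seminorm p) (gb : bfun p g).

Lemma bfun0 : g 0 = 0.
Proof. by have := gb.1 1 0 0; rewrite scale1r addr0; lra. Qed.

Lemma bfunD x y : g (x + y) = g x + g y.
Proof. by have := gb.1 1 x y; rewrite scale1r mul1r. Qed.

Lemma bfunZ a x : g (a *: x) = a * g x.
Proof. by have := gb.1 a x 0; rewrite !addr0 bfun0 addr0. Qed.

Lemma bfunN x : g (- x) = - g x.
Proof. by rewrite -scaleN1r bfunZ mulN1r. Qed.

Lemma bfunB x y : g (x - y) = g x - g y.
Proof. by rewrite bfunD bfunN. Qed.

Lemma seminormN x : p (- x) = p x.
Proof. by rewrite -scaleN1r sp.2 normrN1 mul1r. Qed.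

Lemma seminormB x y : p (x - y) <= p x + p y.
Proof. by rewrite (le_trans (sp.1 _ _))// seminormN. Qed.

Lemma seminorm0 : p 0 = 0.
Proof. by have := sp.2 0 0; rewrite scale0r normr0 mul0r. Qed.

Lemma seminorm_ge0 x : 0 <= p x.
Proof. by have := seminormB x x; rewrite subrr seminorm0; lra. Qed.

Lemma bfun_norm x : `|g x| <= p x.
Proof.
by rewrite ler_norml gb.2 andbT; have := gb.2 (- x); rewrite bfunN seminormN; lra.
Qed.
End bfun_theory.

Lemma bfun_comb p g h a b : seminorm p -> `|a| + `|b| <= 1 -> bfun p g -> bfun p h ->
  bfun p (fun x => a * g x + b * h x).
Proof.
move=> sp ab gb hb; split=> [c x y|x]; first by rewrite gb.1 hb.1; ring.
have := bfun_norm sp gb x; have := bfun_norm sp hb x => H1 H2.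
apply: (le_trans (ler_norm _)); apply: (le_trans (ler_normD _ _)).
rewrite !normrM; have := seminorm_ge0 sp x.
have := normr_ge0 a; have := normr_ge0 b; nra.
Qed.

Lemma bfun_cst0 p : seminorm p -> bfun p (fun=> 0).
Proof. by move=> sp; split=> [a x y|x]; [rewrite mulr0 addr0|exact: seminorm_ge0]. Qed.

End hahn_banach.

(** * Galvin's lemma and Rosenthal's dichotomy *)

Section subsequences.
Implicit Types f g h e : nat -> nat.

Definition increasing f := forall n, (f n < f n.+1)%N.

Definition subsequence f g := exists2 h, increasing h & g = f \o h.

Definition tail T (f : nat -> T) : nat -> T := fun n => f n.+1.

Lemma increasing_lt f m n : increasing f -> (m < n)%N -> (f m < f n)%N.
Proof.
move=> fi; elim: n => // n IH; rewrite ltnS leq_eqVlt => /orP[/eqP ->//|/IH h].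
exact: ltn_trans h (fi n).
Qed.

Lemma increasing_le f m n : increasing f -> (m <= n)%N -> (f m <= f n)%N.
Proof.
by move=> fi; rewrite leq_eqVlt => /orP[/eqP ->//|/(increasing_lt fi)/ltnW].
Qed.

Lemma increasing_ge f n : increasing f -> (n <= f n)%N.
Proof. by move=> fi; elim: n => // n IH; rewrite (leq_ltn_trans IH). Qed.

Lemma increasing_comp f g : increasing f -> increasing g -> increasing (f \o g).
Proof. by move=> fi gi n /=; exact: increasing_lt. Qed.

Lemma increasing_addl k : increasing (addn k).
Proof. by move=> n; rewrite ltn_add2l. Qed.

Lemma increasing_tail f : increasing f -> increasing (tail f).
Proof. by move=> fi n; exact: fi. Qed.

Lemma subsequence_refl f : subsequence f f.
Proof. by exists id. Qed.

Lemma subsequence_trans g f h :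
  subsequence f g -> subsequence g h -> subsequence f h.
Proof.
move=> [u ui ->] [v vi ->]; exists (u \o v) => //; exact: increasing_comp.
Qed.

Lemma subsequence_addl f k : subsequence f (fun n => f (k + n)%N).
Proof. by exists (addn k) => //; exact: increasing_addl. Qed.

Lemma subsequence_tail f : subsequence f (tail f).
Proof. by exists S. Qed.

Lemma subsequence_increasing f g : increasing f -> subsequence f g -> increasing g.
Proof. by move=> fi [h hi ->]; exact: increasing_comp. Qed.

Lemma choose_increasing (P : nat -> nat -> Prop) :
  (forall i J, exists2 n, (J <= n)%N & P i n) ->
  exists2 h, increasing h & forall i, P i (h i).
Proof.
move=> H; have /choice[F HF] (iJ : nat * nat) : exists n, (iJ.2 <= n)%N /\ P iJ.1 n.
  by have [n ? ?] := H iJ.1 iJ.2; exists n.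
pose fix h n := if n is m.+1 then F (n, (h m).+1) else F (0, 0)%N.
exists h => [n|[|n]]; first by have [] := HF (n.+1, (h n).+1).
  by have [] := HF (0, 0)%N.
by have [] := HF (n.+1, (h n).+1).
Qed.

Lemma dependent_choice_inv T (Q : T -> Prop) (r : nat -> T -> T -> Prop) t0 : Q t0 ->
  (forall n t, Q t -> exists2 t', Q t' & r n t t') ->
  exists u : nat -> T, [/\ u 0%N = t0, forall n, Q (u n) & forall n, r n (u n) (u n.+1)].
Proof.
move=> Q0 H.
have /choice[F HF] (nt : nat * {t | Q t}) : exists t' : {t | Q t}, r nt.1 (sval nt.2) (sval t').
  by have [t' Qt' rt'] := H nt.1 _ (svalP nt.2); exists (exist _ t' Qt').
pose fix u n := if n is m.+1 then F (m, u m) else exist _ t0 Q0.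
exists (fun n => sval (u n)); split => // n; first exact: svalP.
exact: HF (n, u n).
Qed.

(** Each sequence refines the tail of the preceding one, so the diagonal moves strictly forward and
    is a subsequence of every [f k] from its k-th term on. *)
Lemma diagonal_subsequence (f : nat -> nat -> nat) :
  (forall k, subsequence (tail (f k)) (f k.+1)) ->
  forall k, subsequence (f k) (fun i => f (k + i)%N 0%N).
Proof.
move=> fS; have /choice[h hP] k : exists h, [/\ increasing h, (0 < h 0)%N & f k.+1 = f k \o h].
  have [h hi fE] := fS k; by exists (S \o h).
move=> k; pose fix H i := if i is j.+1 then H j \o h (k + j)%N else id.
have Hi i : increasing (H i).
  by elim: i => //= i IH; apply: increasing_comp => //; have [] := hP (k + i)%N.
have HE i : f (k + i)%N = f k \o H i.
  elim: i => [|i IH]; first by rewrite addn0.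
  by rewrite addnS; have [_ _ ->] := hP (k + i)%N; rewrite IH.
exists (fun i => H i 0%N); last by apply/funext => i; rewrite HE.
by move=> i /=; apply: increasing_lt => //; have [] := hP (k + i)%N.
Qed.

End subsequences.

(* Galvin's lemma: [rejecting f s] says that no subsequence of [f] accepts [s],
   in the terminology of the combinatorial forcing of Nash-Williams. *)
Section galvin.
Variable good : seq nat -> Prop.
Implicit Types (f g h e : nat -> nat) (s t : seq nat).

Definition rejecting f s := forall g, subsequence f g ->
  exists2 h, subsequence g h & forall k, good (s ++ mkseq h k).

Definition accepting f s := forall h, subsequence f h ->
  exists k, ~ good (s ++ mkseq h k).

Let rejecting_sub f g s : subsequence f g -> rejecting f s -> rejecting g s.
Proof. by move=> fg H h gh; apply: H; exact: subsequence_trans gh. Qed.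

Let rejecting_good f s : rejecting f s -> good s.
Proof.
move=> /(_ f (subsequence_refl f))[h _ /(_ 0%N)].
by rewrite cats0.
Qed.

Let rejecting_addl f k s : rejecting (fun n => f (k + n)%N) s -> rejecting f s.
Proof.
move=> H g [h hi ->].
have [|g' gg' gP] := H (fun n => f (h (k + n)%N)).
  exists (fun n => (h (k + n) - k)%N).
    move=> n; rewrite addnS; have := hi (k + n)%N.
    have := increasing_ge (k + n) hi; lia.
  apply/funext => n /=; congr f; have := increasing_ge (k + n) hi; lia.
exists g' => //; apply: subsequence_trans gg'.
by exists (addn k) => //; exact: increasing_addl.
Qed.

Let mkseqSl h k : mkseq h k.+1 = h 0%N :: mkseq (tail h) k.
Proof. by rewrite /mkseq /= -[1%N]/(1 + 0)%N iotaDl -map_comp. Qed.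

(** Successive refinements decide, for each term e k of a diagonal sequence, whether s followed by e
    k is rejected or accepted by what comes next. If infinitely many were accepted, these terms
    would form a sequence none of whose subsequences keeps all extensions of s good, against the
    rejection of s. *)
Let rejecting_rcons f s : rejecting f s ->
  exists2 g, subsequence f g & forall n, rejecting g (rcons s (g n)).
Proof.
move=> fs.
have [//|_ g _|u [u0 _ uS]] := @dependent_choice_inv _ (fun=> True)
    (fun _ f g => subsequence (tail f) g /\
       (rejecting g (rcons s (f 0%N)) \/ accepting g (rcons s (f 0%N))))
    f.
  have [H|] := pselect (rejecting (tail g) (rcons s (g 0%N))).
    by exists (tail g) => //; split; [exact: subsequence_refl|left].
  move=> /existsNP[h /not_implyP[gh hP]]; exists h => //; split => //; right.
  move=> h' hh'; apply/existsNP => H; apply: hP.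
  by exists h'.
have ue := @diagonal_subsequence u (fun k => (uS k).1).
pose e k := u k 0%N.
have [[K HK]|nK] := pselect (exists K, forall k, (K <= k)%N ->
    rejecting (u k.+1) (rcons s (e k))).
  exists (fun i => e (K + i)%N).
    have := ue 0%N; rewrite u0 => h; apply: subsequence_trans h _.
    exact: subsequence_addl.
  move=> n; apply: (@rejecting_addl _ n.+1).
  apply: rejecting_sub (HK (K + n)%N (leq_addr _ _)).
  have := ue (K + n).+1; congr subsequence; apply/funext => i.
  by rewrite /e !addSn -addnA addnS.
have [h hi hP] : exists2 h, increasing h &
    forall i, accepting (u (h i).+1) (rcons s (e (h i))).
  apply: (@choose_increasing (fun _ k => accepting (u k.+1) (rcons s (e k)))).
  move=> _ J; apply/exists2P; apply: contrapT => H; apply: nK; exists J => k Jk.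
  have [_ [//|a]] := uS k; exfalso; apply: H; by exists k.
have [|g eg gP] := fs (e \o h).
  have := ue 0%N; rewrite u0 => /subsequence_trans; apply; by exists h.
case: eg => v vi gE.
have [|k Hk] := hP (v 0%N) (tail g).
  apply: subsequence_trans (ue (h (v 0%N)).+1) _.
  exists (fun n => (h (v n.+1) - (h (v 0%N)).+1)%N).
    move=> n; have := increasing_lt hi (vi n.+1).
    have := increasing_lt hi (@increasing_lt v 0 n.+1 vi isT); lia.
  rewrite gE; apply/funext => n; rewrite /tail /= /e; congr (u _ _).
  have := increasing_lt hi (@increasing_lt v 0 n.+1 vi isT); lia.
exfalso; apply: Hk; have := gP k.+1.
by rewrite mkseqSl cat_rcons gE.
Qed.

Let rejecting_rcons_all f (L : seq (seq nat)) : (forall t, t \in L -> rejecting f t) ->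
  exists2 g, subsequence f g &
    forall n t, t \in L -> rejecting g (rcons t (g n)).
Proof.
elim: L => [|t L IH] H; first by exists f => //; exact: subsequence_refl.
have [|g fg gP] := IH; first by move=> t' t'L; apply: H; rewrite inE t'L orbT.
have [h gh hP] : exists2 h, subsequence g h & forall n, rejecting h (rcons t (h n)).
  by apply: rejecting_rcons; apply: rejecting_sub fg _; apply: H; rewrite inE eqxx.
exists h; first exact: subsequence_trans gh.
move=> n t'; rewrite inE => /orP[/eqP ->//|t'L].
case: gh => v vi hE; rewrite hE /=; apply: rejecting_sub (gP (v n) _ t'L).
by exists v.
Qed.

Lemma galvin :
  (forall f, increasing f -> exists2 g, subsequence f g & forall k, good (mkseq g k)) ->
  exists2 e, increasing e & forall t, sorted ltn t -> good (map e t).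
Proof.
move=> H.
(* A state holds all the finite sequences formed from the terms chosen so far, the sequence that
   remains and still rejects each of them, and the last term chosen. *)
pose T := (seq (seq nat) * (nat -> nat) * nat)%type.
pose Q (x : T) := increasing x.1.2 /\ forall t, t \in x.1.1 -> rejecting x.1.2 t.
pose r (_ : nat) (x y : T) := y.1.1 = x.1.1 ++ map (rcons^~ y.2) x.1.1 /\
  exists h, [/\ increasing h, y.2 = x.1.2 (h 0%N) & y.1.2 = x.1.2 \o h \o S].
have [||u [u0 uQ ur]] := @dependent_choice_inv T Q r ([:: [::]], id, 0%N).
- split => // t; rewrite inE => /eqP -> g gi.
  by have [//|g' gg' g'P] := H g; [exact: subsequence_increasing gi|exists g'].
- move=> i [[L f] n] [/= fi fL].
  have [g [h hi gE] gP] := rejecting_rcons_all fL.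
  have gi : increasing g by rewrite gE; exact: increasing_comp.
  exists (L ++ map (rcons^~ (g 0%N)) L, g \o S, g 0%N).
    split => [|t]; first exact: increasing_tail.
    rewrite mem_cat /= => /orP[tL|/mapP[t' t'L ->]].
      apply: rejecting_sub (fL _ tL); rewrite gE.
      by exists (h \o S) => //; apply: increasing_comp.
    by apply: rejecting_sub (gP 0%N _ t'L); exact: subsequence_tail.
  split => //; exists h; split => //; by rewrite gE.
pose e k := (u k.+1).2.
have eE k : (u k.+1).1.1 = (u k).1.1 ++ map (rcons^~ (e k)) (u k).1.1.
  by have [] := ur k.
exists e.
  move=> k; rewrite /e; have [_ [h [hi -> hE]]] := ur k.
  have [_ [h' [h'i -> _]]] := ur k.+1; rewrite hE /=.
  by apply: increasing_lt; [case: (uQ k)|apply: increasing_lt].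
have main m t : sorted ltn t -> all (fun i => (i < m)%N) t -> map e t \in (u m).1.1.
  elim: m t => [|m IH] t; first by case: t => //= _ _; rewrite u0 inE.
  case/lastP: t => [_ _|t a].
    by rewrite eE mem_cat (IH [::]).
  rewrite all_rcons map_rcons ltnS leq_eqVlt => ts /andP[am tm].
  have tsort : sorted ltn t by move: ts; rewrite -cats1 => /cat_sorted2[].
  have ta : all (fun i => (i < a)%N) t.
    apply/allP => i it; move: ts; rewrite -cats1 sorted_pairwise; last exact: ltn_trans.
    by rewrite pairwise_cat => /andP[/allrelP h _]; apply: h; rewrite ?inE.
  rewrite eE mem_cat; case/orP: am => [/eqP aE|am].
    apply/orP; right; apply/mapP; exists (map e t); last by rewrite aE.
    by apply: IH => //; rewrite -aE.
  rewrite -map_rcons IH//; rewrite all_rcons am; apply/allP => i /(allP ta).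
  by move=> h; exact: ltn_trans am.
move=> t ts; have [_ uR] := uQ (\max_(i <- t) i.+1)%N.
apply: (rejecting_good (uR _ (main _ _ ts _))).
by apply/allP => i it; apply: (@leq_bigmax_seq _ _ _ S).
Qed.

End galvin.

Section rosenthal.
Variable R : realType.

Definition cauchy_seqR (v : nat -> R) :=
  forall e, 0 < e -> exists J, forall m n, (J <= m)%N -> (J <= n)%N -> `|v m - v n| < e.

Definition oscillates (v : nat -> R) (r s : R) :=
  (forall J, exists2 n, (J <= n)%N & v n < r) /\
  (forall J, exists2 n, (J <= n)%N & s < v n).

Lemma oscillates_sub (v : nat -> R) h r s : increasing h ->
  oscillates (v \o h) r s -> oscillates v r s.
Proof.
move=> hi [H1 H2]; split=> J.
  have [n Jn vn] := H1 J; exists (h n) => //.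
  exact: leq_trans Jn (increasing_ge n hi).
have [n Jn vn] := H2 J; exists (h n) => //.
exact: leq_trans Jn (increasing_ge n hi).
Qed.

Lemma seq_bound_nat (T : Type) (P : nat -> T -> Prop) (D : nat) (a : nat -> T) :
  (forall J i m, (J <= m)%N -> P J (a i) -> P m (a i)) ->
  (forall i, (i < D)%N -> exists J, P J (a i)) ->
  exists J, forall i, (i < D)%N -> P J (a i).
Proof.
move=> Pm; elim: D => [|D IH] H; first by exists 0%N.
have [J JP] := IH (fun i iD => H i (ltnW iD)).
have [J' J'P] := H D (ltnSn D).
exists (maxn J J') => i; rewrite ltnS leq_eqVlt => /orP[/eqP ->|iD].
  by apply: Pm J'P; exact: leq_maxr.
by apply: Pm (JP _ iD); exact: leq_maxl.
Qed.

(** Points of mesh 1 / (p.1 + 1), starting at - B. The cells between neighbours are countably many,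
    so a diagonal argument can treat them all. *)
Definition grid (B : R) (p : nat * nat) := - B + p.2%:R / p.1.+1%:R.

Lemma not_cauchy_oscillates (B : R) (v : nat -> R) : (forall n, `|v n| <= B) ->
  ~ cauchy_seqR v ->
  exists p, oscillates v (grid B p) (grid B (p.1, p.2.+1)).
Proof.
move=> vB /existsNP[e /not_implyP[e0 /forallNP He]].
(* With a mesh below e / 3, a jump of size e crosses a whole cell; D cells cover the range of v. *)
have [N HN] : exists N : nat, 3 / e < N.+1%:R.
  by exists (Num.truncn (3 / e)); exact: truncnS_gt.
have [q qE] : exists q : R, q = N.+1%:R by exists N.+1%:R.
have q0 : 0 < q by rewrite qE ltr0n.
rewrite -qE in HN.
have qe : 3 / q < e by rewrite ltr_pdivrMr// mulrC -ltr_pdivrMr.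
have [D HD] : exists D : nat, 2 * B * q + 1 < D%:R.
  by exists (Num.truncn (2 * B * q + 1)).+1; exact: truncnS_gt.
apply: contrapT => /forallNP Hosc.
pose P J j := (forall n, (J <= n)%N -> grid B (N, j) <= v n) \/
  (forall n, (J <= n)%N -> v n <= grid B (N, j.+1)).
have [J HJ] : exists J, forall j, (j < D)%N -> P J j.
  apply: (@seq_bound_nat _ P D id).
    move=> J i m Jm [] h; [left|right] => n mn; apply: h; exact: leq_trans mn.
  move=> i _; apply: contrapT => /forallNP h; apply: (Hosc (N, i)); split=> J.
    apply: contrapT => h'; apply: (h J); left => n Jn; rewrite leNgt.
    by apply/negP => ?; apply: h'; exists n.
  apply: contrapT => h'; apply: (h J); right => n Jn; rewrite leNgt.
  by apply/negP => ?; apply: h'; exists n.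
have /existsNP[m /existsNP[n /not_implyP[Jm /not_implyP[Jn /negP]]]] := He J.
rewrite -leNgt.
wlog : m n Jm Jn / v n <= v m.
  move=> W; have [|/ltW] := leP (v n) (v m); first exact: W.
  by rewrite distrC => h; exact: W.
move=> nm; rewrite ger0_norm ?subr_ge0// => emn.
(* The first grid point above v n; the next one is still below v m, so v passes across this cell
   beyond J. *)
have [j jE] : exists j, j = (Num.truncn ((v n + B) * q)).+1 by eexists.
have vnB : 0 <= v n + B by have := vB n; rewrite ler_norml => /andP[]; lra.
have jl : j%:R <= (v n + B) * q + 1.
  by rewrite jE -natr1 lerD2r truncn_le// mulr_ge0// ltW.
have jg : (v n + B) * q < j%:R by rewrite jE; exact: truncnS_gt.
have jD : (j < D)%N.
  rewrite -(ltr_nat R); apply: le_lt_trans jl _; apply: le_lt_trans HD.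
  by rewrite lerD2r ler_pM2r//; have := vB n; rewrite ler_norml => /andP[]; lra.
have g1 : v n < grid B (N, j).
  rewrite /grid /= -qE; suff : v n + B < j%:R / q by lra.
  by rewrite ltr_pdivlMr.
have g2 : grid B (N, j.+1) < v m.
  rewrite /grid /= -qE -[j.+1%:R]natr1; suff : (j%:R + 1) / q < v m + B by lra.
  rewrite ltr_pdivrMr//; have : 3 < e * q by rewrite -ltr_pdivrMr.
  have : (v n + e) * q <= v m * q by rewrite ler_pM2r//; lra.
  rewrite !mulrDl in jl *; lra.
have [h|h] := HJ _ jD.
  by have := h n Jn; lra.
by have := h m Jm; lra.
Qed.

(** Galvin's lemma yields only the alternating pattern P, Q, P, Q, and so on. Odd numbers carry the
    prescribed pattern, and an even number is inserted as a filler whenever the next position has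
    the wrong parity. *)
Lemma alternating_pattern (sigma : nat -> bool) (m : nat) :
  exists t : seq nat, [/\ sorted ltn t, all (fun i => (i < m.*2)%N) t &
   forall P Q : nat -> Prop,
     (forall i, (i < size t)%N -> if odd i then Q (nth 0%N t i) else P (nth 0%N t i)) ->
     forall i, (i < m)%N -> if sigma i then P i.*2.+1 else Q i.*2.+1].
Proof.
elim: m => [|m [t [ts ta tP]]]; first by exists [::].
have sortb s : all (fun i => (m.*2 <= i)%N) s -> sorted ltn s -> sorted ltn (t ++ s).
  move=> sa ss; rewrite sorted_pairwise; last exact: ltn_trans.
  rewrite pairwise_cat -!sorted_pairwise ?ts ?ss ?andbT; try exact: ltn_trans.
  by apply/allrelP => i j /(allP ta) im /(allP sa); exact: leq_trans.
have allb s : all (fun i => (i < m.+1.*2)%N) s -> all (fun i => (i < m.+1.*2)%N) (t ++ s).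
  move=> sa; rewrite all_cat sa andbT; apply/allP => i /(allP ta) im; rewrite doubleS; lia.
pose s := if sigma m == ~~ odd (size t) then [:: m.*2.+1] else [:: m.*2; m.*2.+1].
exists (t ++ s); split.
- apply: sortb; rewrite /s; case: ifP => _ /=; rewrite ?leqnn ?leqnSn ?ltnSn //.
- apply: allb; rewrite /s; case: ifP => _ /=; rewrite doubleS; lia.
move=> P Q H i; rewrite ltnS leq_eqVlt => /orP[/eqP ->|]; last first.
  apply: tP => j jt; have := H j; rewrite size_cat nth_cat jt; apply.
  exact: ltn_addr.
move: H; rewrite /s; case: ifP => [/eqP sm|sm] H.
  have := H (size t); rewrite size_cat nth_cat /= addn1 ltnSn ltnn subnn => /(_ isT) /=.
  by rewrite sm; case: odd.
have := H (size t).+1; rewrite size_cat nth_cat /= addn2 ltnSn ltnNge leqnSn /= subSnn /= => /(_ isT).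
by move: sm; case: (sigma m); case: odd.
Qed.

(** If, for some f and some cell, every subsequence of f oscillates across that cell at some point,
    then Galvin's lemma gives points realizing finite alternations, hence all patterns. Otherwise
    every cell can be disposed of by refining; after diagonalizing over all cells nothing
    oscillates, and every point gives a Cauchy sequence. *)
Lemma rosenthal (T : Type) (u : nat -> T -> R) (B : R) :
  (forall n x, `|u n x| <= B) ->
  (exists2 g, increasing g & forall x, cauchy_seqR (fun n => u (g n) x)) \/
  (exists g r s, [/\ increasing g, r < s &
    forall (sigma : nat -> bool) m, exists x, forall i, (i < m)%N ->
      if sigma i then s < u (g i) x else u (g i) x < r]).
Proof.
move=> uB.
pose lo p := grid B p; pose hi (p : nat * nat) := grid B (p.1, p.2.+1).
pose osc f p x := oscillates (fun n => u (f n) x) (lo p) (hi p).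
have osc_sub f g p x : subsequence f g -> osc g p x -> osc f p x.
  by move=> [h hi_ ->]; exact: oscillates_sub.
have [[f [p [fi Hf]]]|H] := pselect (exists f p, increasing f /\
    forall g, subsequence f g -> exists x, osc g p x).
  right.
  pose good t := exists x, forall i, (i < size t)%N ->
    if odd i then u (f (nth 0%N t i)) x < lo p else hi p < u (f (nth 0%N t i)) x.
  have [h hi_|e ei eP] := @galvin good.
    have [|x [x1 x2]] := Hf (f \o h); first by exists h.
    have [h' h'i h'P] : exists2 h', increasing h' &
        forall i, if odd i then u (f (h (h' i))) x < lo p else hi p < u (f (h (h' i))) x.
      apply: (@choose_increasing (fun i n => if odd i then u (f (h n)) x < lo p else hi p < u (f (h n)) x)).
      by move=> i J; case: (odd i); [exact: x1|exact: x2].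
    exists (h \o h'); first by exists h'.
    move=> k; exists x => i; rewrite size_mkseq => ik.
    by rewrite nth_mkseq//; exact: h'P.
  exists (fun i => f (e i.*2.+1)), (lo p), (hi p); split.
  - move=> i; have h : (i.*2.+1 < i.+1.*2.+1)%N by rewrite doubleS.
    exact: increasing_lt fi (increasing_lt ei h).
  - by rewrite /lo /hi /grid /= ltrD2l ltr_pM2r ?invr_gt0// ltr_nat.
  move=> sigma m.
  have [t [ts _ tP]] := alternating_pattern sigma m.
  have [x xP] := eP _ ts; exists x.
  have {}tP := tP (fun j => hi p < u (f (e j)) x) (fun j => u (f (e j)) x < lo p).
  move=> i im; have {tP} := tP _ i im; case: (sigma i); apply => j jt;
    by have := xP j; rewrite size_map (nth_map 0%N)// => /(_ jt); case: (odd j).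
left.
have H' f p : increasing f -> exists2 g, subsequence f g & forall x, ~ osc g p x.
  move=> fi; apply: contrapT => h; apply: H; exists f, p; split => // g fg.
  by apply: contrapT => /forallNP h'; apply: h; exists g.
pose pair k : nat * nat := odflt (0, 0)%N (unpickle k).
have [//|k f fi|F [F0 Fi FS]] := @dependent_choice_inv _ increasing
    (fun k f g => subsequence (tail f) g /\ forall x, ~ osc g (pair k) x) id.
  have [g fg gP] := H' (tail f) (pair k) (increasing_tail fi).
  exists g => //; apply: subsequence_increasing fg; exact: increasing_tail.
have ue := @diagonal_subsequence F (fun k => (FS k).1).
exists (fun k => F k 0%N).
  by apply: subsequence_increasing (ue 0%N); rewrite F0.
move=> x; apply: contrapT => /(@not_cauchy_oscillates B _ (fun n => uB _ _))[p px].
have [_ /(_ x)] := FS (pickle p); apply; rewrite /pair pickleK /=.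
apply: osc_sub (ue (pickle p).+1) _.
have addP (v : nat -> R) k r s : oscillates v r s -> oscillates (fun n => v (k + n)%N) r s.
  move=> [H1 H2]; split => J.
    have [n Jn vn] := H1 (k + J)%N; exists (n - k)%N; first lia.
    by rewrite subnKC//; lia.
  have [n Jn vn] := H2 (k + J)%N; exists (n - k)%N; first lia.
  by rewrite subnKC//; lia.
exact: (addP (fun n => u (F n 0%N) x)).
Qed.

End rosenthal.

(** * Independent sequences in the dual ball and blocks of functionals *)

Section blocks.
Variables (R : realType) (V : lmodType R) (p : V -> R).
Hypothesis sp : seminorm p.
Implicit Types (x : V) (g : V -> R) (c r s : R).

(* A copy of l_1 in V, witnessed by functionals. *)
Definition rademacher_system (x : nat -> V) c := [/\ 0 < c,
  (forall i, p (x i) <= 1) &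
  forall (sigma : nat -> bool) m, exists2 g, bfun p g & forall i, (i < m)%N ->
    if sigma i then c <= g (x i) else g (x i) <= - c].

Lemma weakly_cauchy_subsequence (x : nat -> V) :
  (forall (y : nat -> V) c, ~ rademacher_system y c) -> (forall i, p (x i) <= 1) ->
  exists2 h, increasing h & forall g, bfun p g -> cauchy_seqR (fun n => g (x (h n))).
Proof.
move=> norad x1.
have [|[h hi hP]|[h [r [s [hi rs hP]]]]] :=
    @rosenthal R {g | bfun p g} (fun n f => sval f (x n)) 1.
- by move=> n [g gb] /=; apply: le_trans (bfun_norm sp gb _) (x1 n).
- by exists h => // g gb; exact: (hP (exist _ g gb)).
exfalso; apply: (norad (x \o h) ((s - r) / 2)); split => //.
- by rewrite divr_gt0// subr_gt0.
- by move=> i; exact: x1.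
move=> sigma m.
have [[g gb] /= gP] := hP sigma m.
have [[g' g'b] /= g'P] := hP (fun i => ~~ sigma i) m.
(* Half the difference of functionals for sigma and for its complement centres the gap between r and
   s at 0. *)
exists (fun x => 2^-1 * g x + - 2^-1 * g' x).
  by apply: bfun_comb => //; rewrite normrN gtr0_norm//; lra.
move=> i im; have := gP i im; have := g'P i im; case: (sigma i) => /=; lra.
Qed.

(* l_1-normalized combinations of [y m, ..., y n.-1]. *)
Inductive block (y : nat -> V -> R) : nat -> nat -> (V -> R) -> Prop :=
| block_unit i : block y i i.+1 (y i)
| block_widen m m' n n' z : (m' <= m)%N -> (n <= n')%N ->
    block y m n z -> block y m' n' z
| block_comb l m n (a b : R) z w : block y l m z -> block y m n w -> `|a| + `|b| = 1 ->
    block y l n (fun x => a * z x + b * w x).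

Definition block_sequence (y z : nat -> V -> R) :=
  exists2 q, increasing q & forall j, block y (q j) (q j.+1) (z j).

Lemma block_lt (y : nat -> V -> R) m n (z : V -> R) : block y m n z -> (m < n)%N.
Proof.
elim=> // [i i' j j' u i'i jj' _ ij|l i j a b u v _ li _ ij _].
  exact: leq_ltn_trans i'i (leq_trans ij jj').
exact: ltn_trans ij.
Qed.

Lemma block_bfun (y : nat -> V -> R) m n (z : V -> R) : (forall i, bfun p (y i)) -> block y m n z -> bfun p z.
Proof.
move=> yb; elim=> // l i j a b u v _ ub _ vb ab.
by apply: bfun_comb => //; rewrite ab.
Qed.

Lemma block_sequence_bfun (y z : nat -> V -> R) : (forall i, bfun p (y i)) -> block_sequence y z ->
  forall i, bfun p (z i).
Proof. by move=> yb [q qi zP] i; exact: block_bfun (zP i). Qed.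

Lemma block_comp (y : nat -> V -> R) z q m n w : increasing q ->
  (forall j, block y (q j) (q j.+1) (z j)) -> block z m n w ->
  block y (q m) (q n) w.
Proof.
move=> qi zP; elim=> //.
- move=> i i' j j' u i'i jj' _; apply: block_widen; exact: increasing_le.
- by move=> l i j a b u v _ ub _ vb ab; exact: block_comb ub vb ab.
Qed.

Lemma block_sequence_refl (y : nat -> V -> R) : block_sequence y y.
Proof. by exists id => // j; exact: block_unit. Qed.

Lemma block_sequence_trans (y : nat -> V -> R) z w :
  block_sequence y z -> block_sequence z w -> block_sequence y w.
Proof.
move=> [q qi zP] [q' q'i wP]; exists (q \o q'); first exact: increasing_comp.
by move=> j; apply: block_comp (wP j).
Qed.

Lemma block_sequence_addl (y : nat -> V -> R) k : block_sequence y (fun n => y (k + n)%N).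
Proof.
exists (addn k) => [|j]; first exact: increasing_addl.
by rewrite addnS; exact: block_unit.
Qed.

Lemma diagonal_block (y : nat -> nat -> V -> R) :
  (forall k, block_sequence (tail (y k)) (y k.+1)) ->
  forall k, block_sequence (y k) (fun i => y (k + i)%N 0%N).
Proof.
move=> yS.
have /choice[q qP] k : exists q, [/\ increasing q, (0 < q 0)%N &
    forall j, block (y k) (q j) (q j.+1) (y k.+1 j)].
  have [q qi zP] := yS k; exists (S \o q); split => // j.
  apply: (@block_comp (y k) (tail (y k)) S) => // i; exact: block_unit.
move=> k; pose fix Q i := if i is j.+1 then Q j \o q (k + j)%N else id.
have Qi i : increasing (Q i).
  by elim: i => //= i IH; apply: increasing_comp => //; have [] := qP (k + i)%N.
have QP i j : block (y k) (Q i j) (Q i j.+1) (y (k + i)%N j).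
  elim: i j => [|i IH] j; first by rewrite addn0; exact: block_unit.
  rewrite addnS /=; have [qi _ qb] := qP (k + i)%N.
  exact: (@block_comp _ (y (k + i)%N)).
exists (fun i => Q i 0%N).
  by move=> i /=; apply: increasing_lt => //; have [] := qP (k + i)%N.
move=> i; apply: block_widen (QP i 0%N) => //=.
by apply: increasing_le => //; have [] := qP (k + i)%N.
Qed.

(** The index depends on x. For linear functionals, c = 0 means pointwise convergence to 0 on the
    unit ball. *)
Definition limsup_le (y : nat -> V -> R) (c : R) := forall x, p x <= 1 ->
  forall e, 0 < e -> exists J, forall j, (J <= j)%N -> y j x <= c + e.

Lemma limsup_le_mono (y : nat -> V -> R) c c' : c <= c' -> limsup_le y c -> limsup_le y c'.
Proof.
move=> cc' yc x x1 e e0; have [J JP] := yc x x1 e e0; exists J => j Jj.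
by apply: le_trans (JP j Jj) _; rewrite lerD2r.
Qed.

Lemma limsup_le_norm (y : nat -> V -> R) c x e : (forall i, bfun p (y i)) -> limsup_le y c ->
  p x <= 1 -> 0 < e -> exists J, forall j, (J <= j)%N -> `|y j x| <= c + e.
Proof.
move=> yb yc x1 e0; have [J JP] := yc x x1 e e0.
have [|J' J'P] := yc (- x) _ e e0; first by rewrite seminormN.
exists (maxn J J') => j; rewrite geq_max => /andP[Jj J'j].
have := JP j Jj; have := J'P j J'j; rewrite (bfunN (yb j)) ler_norml; lra.
Qed.

Lemma limsup_le_block (y : nat -> V -> R) z c : (forall i, bfun p (y i)) ->
  block_sequence y z -> limsup_le y c -> limsup_le z c.
Proof.
move=> yb [q qi zP] yc x x1 e e0.
have [J JP] := limsup_le_norm yb yc x1 e0; exists J => j Jj.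
have {}Jj : (J <= q j)%N := leq_trans Jj (increasing_ge j qi).
suff : `|z j x| <= c + e by apply: le_trans; exact: ler_norm.
elim: (zP j) Jj => //.
- by move=> m m' n n' w m'm _ _ IH Jm'; apply: IH; exact: leq_trans m'm.
- move=> l m n a b u v lm IHu mn IHv ab Jl.
  have lm' := ltnW (block_lt lm).
  have := IHu Jl; have := IHv (leq_trans Jl lm') => Hv Hu.
  apply: (le_trans (ler_normD _ _)); rewrite !normrM.
  have := normr_ge0 a; have := normr_ge0 b; nra.
Qed.

Lemma limsup_le_addl (y : nat -> V -> R) k c : limsup_le (fun n => y (k + n)%N) c -> limsup_le y c.
Proof.
move=> yc x x1 e e0; have [J JP] := yc x x1 e e0; exists (k + J)%N => j kJj.
by have := JP (j - k)%N; rewrite subnKC; [apply; lia|lia].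
Qed.

Lemma limsup_le_ge0 (y : nat -> V -> R) c : (forall i, bfun p (y i)) -> limsup_le y c -> 0 <= c.
Proof.
move=> yb yc; apply/ler_addgt0Pr => e e0.
have [|J JP] := yc 0 _ e e0; first by rewrite (seminorm0 sp).
by have := JP J (leqnn J); rewrite (bfun0 (yb J)).
Qed.

(** Passing to blocks can only improve a limsup bound. Each rational is made a bound by passing to
    blocks whenever that is possible; for the diagonal block sequence, the infimum of the rational
    bounds can no longer be lowered. *)
Lemma stable_block (y : nat -> V -> R) : (forall i, bfun p (y i)) ->
  exists z c, [/\ block_sequence y z, 0 <= c, limsup_le z c &
    forall w d, block_sequence z w -> d < c -> ~ limsup_le w d].
Proof.
move=> yb; pose rk k : rat := odflt 0 (unpickle k).
pose D (z : nat -> V -> R) (c : R) := limsup_le z c \/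
  forall w, block_sequence z w -> ~ limsup_le w c.
have [//|k z zb|Y [Y0 Yb YS]] := @dependent_choice_inv _
    (fun z => forall i, bfun p (z i))
    (fun k z z' => block_sequence (tail z) z' /\ D z' (ratr (rk k))) y.
  have tb : block_sequence z (tail z) := block_sequence_addl z 1.
  have tzb := block_sequence_bfun zb tb.
  have [[w [zw wc]]|H] := pselect (exists w, block_sequence (tail z) w /\ limsup_le w (ratr (rk k))).
    exists w; first exact: block_sequence_bfun zw.
    by split => //; left.
  exists (tail z) => //; split; first exact: block_sequence_refl.
  by right => w zw wc; apply: H; exists w.
have Yd := diagonal_block (fun k => (YS k).1).
pose z k := Y k 0%N.
have zb i : bfun p (z i) by exact: Yb.
have zD q : D z (ratr q).
  have [_] := YS (pickle q); rewrite /rk pickleK /=; set k := (pickle q).+1.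
  have kz : block_sequence (Y k) (fun i => z (k + i)%N) := Yd k.
  case=> [h|h]; [left|right => w zw wc].
    by apply: (@limsup_le_addl _ k); apply: limsup_le_block h.
  (* Only the terms of z from index k on are blocks of [Y k], so the first k terms of w are dropped
     and the blocks are reindexed. *)
  apply: (h (fun i => w (k + i)%N)); last first.
    apply: limsup_le_block wc; last exact: block_sequence_addl.
    exact: block_sequence_bfun zw.
  apply: block_sequence_trans kz _; case: zw => q' q'i wP.
  have q'k i : (k <= q' (k + i))%N.
    by apply: leq_trans (increasing_ge (k + i) q'i); exact: leq_addr.
  exists (fun i => (q' (k + i) - k)%N).
    by move=> i; rewrite addnS; have := q'i (k + i)%N; have := q'k i; lia.
  move=> j; have := wP (k + j)%N; have := q'k j; have := q'k j.+1.
  rewrite addnS; move: (w (k + j)%N) => v kn km.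
  have shift m n : block z m n v -> (k <= m)%N -> block (fun i => z (k + i)%N) (m - k) (n - k) v.
    elim.
    - move=> i ki; have := @block_unit (fun i => z (k + i)%N) (i - k)%N.
      by rewrite subnKC// subSn.
    - move=> m0 m' n0 n' u m'm nn' _ IH km'.
      apply: block_widen (IH (leq_trans km' m'm)); exact: leq_sub2r.
    - move=> l m0 n0 a b u u' ub IH u'b IH' ab kl.
      apply: block_comb (IH kl) (IH' _) ab; apply: leq_trans kl _.
      exact: ltnW (block_lt ub).
  by move=> h'; exact: shift.
pose S := [set c : R | exists2 q : rat, limsup_le z (ratr q) & c = ratr q].
have S1 : S 1.
  exists 1; last by rewrite rmorph1.
  rewrite rmorph1 => x x1 e e0; exists 0%N => j _.
  by have := (zb j).2 x; lra.
have Slb : lbound S 0 by move=> _ [q zq ->]; exact: limsup_le_ge0 zq.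
have Sinf : has_inf S by split; [exists 1|exists 0].
have gtS d : inf S < d -> limsup_le z d.
  move=> /inf_lt -/(_ (ex_intro _ 1 S1))[_ [q zq ->] /ltW qd].
  exact: limsup_le_mono zq.
exists z, (inf S); split.
- by have := Yd 0%N; rewrite Y0.
- by apply: lb_le_inf => //; exists 1.
- move=> x x1 e e0; have e2 : 0 < e / 2 by rewrite divr_gt0.
  have [|J JP] := gtS (inf S + e / 2) _ x x1 _ e2; first by rewrite ltrDl.
  by exists J => j /JP; lra.
- move=> w d zw dS wd.
  have [q] := rat_in_itvoo dS; rewrite in_itv /= => /andP[dq qS].
  have [h|h] := zD q; last by apply: (h _ zw); exact: limsup_le_mono (ltW dq) wd.
  have : inf S <= ratr q by apply: ge_inf; [exists 0|exists q].
  by rewrite leNgt qS.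
Qed.

End blocks.

(** * The Josefson-Nissenzweig theorem in the absence of l_1 *)

Section josefson_nissenzweig.
Variables (R : realType) (V : lmodType R) (p : V -> R).
Hypothesis sp : seminorm p.

Definition signed (b : bool) (a : R) := if b then a else - a.

Let signed_block (y : nat -> V -> R) (b : nat -> bool) (N : nat -> nat -> Prop) K :
  (forall i J, (i <= K)%N -> exists2 n, (J <= n)%N & N i n) ->
  forall J, exists J' (n : nat -> nat),
    (forall i, (i <= K)%N -> (J <= n i)%N /\ N i (n i)) /\
    block y J J'
      (fun x => K.+1%:R^-1 * \sum_(i < K.+1) signed (b i) (y (n i) x)).
Proof.
(* A combination needs two consecutive blocks, so a mere change of sign borrows the next term with
   coefficient 0. *)
have unit1 m c : c = 1 \/ c = -1 -> block y m m.+2 (fun x => c * y m x).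
  move=> c1; have -> : (fun x => c * y m x) = (fun x => c * y m x + 0 * y m.+1 x).
    by apply/funext => x; rewrite mul0r addr0.
  apply: block_comb (block_unit _ _) (block_unit _ _) _.
  by rewrite normr0 addr0; case: c1 => ->; rewrite ?normrN normr1.
elim: K => [|K IH] NP J.
  have [n Jn Nn] := NP 0%N J isT.
  exists n.+2, (fun=> n); split; first by case.
  apply: block_widen Jn (leqnn _) _.
  have -> : (fun x => 1%:R^-1 * \sum_(i < 1) signed (b i) (y n x)) =
      (fun x => (if b 0%N then 1 else -1) * y n x).
    apply/funext => x; rewrite big_ord_recl big_ord0 addr0 invr1 mul1r /signed.
    by case: (b 0%N); rewrite ?mul1r ?mulN1r.
  by apply: unit1; case: (b 0%N); [left|right].
have [i J0 iK|J' [n [nP bP]]] := IH _ J; first by apply: NP; exact: ltnW.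
have [m J'm Nm] := NP K.+1 J' (leqnn _).
exists m.+1, (fun i => if (i <= K)%N then n i else m); split.
  move=> i iK; case: (leqP i K) => [iK'|Ki]; first exact: nP.
  have -> : i = K.+1 by lia.
  split => //; apply: leq_trans J'm; apply: ltnW; exact: block_lt bP.
pose a : R := K.+1%:R / K.+2%:R.
pose c : R := (if b K.+1 then 1 else -1) / K.+2%:R.
have -> : (fun x => K.+2%:R^-1 * \sum_(i < K.+2) signed (b i)
      (y (if (i <= K)%N then n i else m) x)) =
    (fun x => a * (K.+1%:R^-1 * \sum_(i < K.+1) signed (b i) (y (n i) x)) + c * y m x).
  apply/funext => x; rewrite big_ord_recr /= ltnn mulrDr; congr (_ + _).
    rewrite /a mulrA [_ / _]mulrC mulfK ?pnatr_eq0//; congr (_ * _).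
    by apply: eq_bigr => i _; rewrite -ltnS ltn_ord.
  by rewrite /c /signed; case: (b K.+1); rewrite ?mul1r// mulN1r mulrN mulNr.
apply: block_comb bP _ _; first by apply: block_widen J'm (leqnn _) _; exact: block_unit.
rewrite /a /c !normrM !normfV !normr_nat -mulrDl.
have -> : `|if b K.+1 then 1 else -1 : R| = 1 by case: (b _); rewrite ?normrN normr1.
by rewrite natr1 divff// pnatr_eq0.
Qed.

Variables (y : nat -> V -> R) (c : R).
Hypotheses (yb : forall i, bfun p (y i)) (c0 : 0 < c) (yc : limsup_le p y c)
  (ystable : forall w d, block_sequence y w -> d < c -> ~ limsup_le p w d).

(* By stability some x nearly maximizes infinitely many signed averages of the
   [y n], which forces all the terms of these averages to be large. *)
Lemma simultaneous_large (b : nat -> bool) (N : nat -> nat -> Prop) K :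
  (forall i J, (i <= K)%N -> exists2 n, (J <= n)%N & N i n) ->
  exists2 x, p x <= 1 & forall i J, (i <= K)%N ->
    exists2 n, (J <= n)%N & N i n /\ c / 2 <= signed (b i) (y n x).
Proof.
move=> NP.
have [//|j J _|q [_ _ qP]] := @dependent_choice_inv _ (fun=> True)
  (fun _ J J' => (J < J')%N /\ exists n : nat -> nat,
    (forall i, (i <= K)%N -> (J <= n i)%N /\ N i (n i)) /\
    block y J J'
      (fun x => K.+1%:R^-1 * \sum_(i < K.+1) signed (b i) (y (n i) x))) 0%N.
  have [J' [n [nP bP]]] := signed_block y b NP J; exists J' => //.
  by split; [exact: block_lt bP|exists n].
have /choice[n nP] j := (qP j).2.
pose z j x := K.+1%:R^-1 * \sum_(i < K.+1) signed (b i) (y (n j i) x).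
have yz : block_sequence y z.
  by exists q => j; [have [] := qP j|have [] := nP j].
have qi : increasing q by move=> j; have [] := qP j.
(* If the mean of K + 1 terms exceeds c - d and each of them is at most c + d, then each exceeds c -
   (2 K + 1) d, which is more than c / 2. *)
pose d : R := c / (4 * K.+1%:R).
have K0 : 0 < K.+1%:R :> R by rewrite ltr0n.
have d0 : 0 < d by rewrite divr_gt0// mulr_gt0.
have dE : 4 * (K.+1%:R * d) = c by rewrite /d mulrA mulrCA divff ?mulr1// gt_eqF// mulr_gt0.
have : ~ limsup_le p z (c - d) by apply: ystable yz _; rewrite ltrBlDr ltrDl.
move=> /existsNP[x /not_implyP[x1 /existsNP[e /not_implyP[e0 /forallNP xP]]]].
exists x => // i J iK.
have [J0 J0P] := limsup_le_norm sp yb yc x1 d0.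
have /existsNP[j /not_implyP[Jj /negP]] := xP (maxn J J0).
rewrite -ltNge => zj; have {zj} zj : c - d < z j x by lra.
move: Jj; rewrite geq_max => /andP[Jj J0j].
have [qn _] := nP j.
exists (n j i).
  have [qni _] := qn i iK; apply: leq_trans qni.
  exact: leq_trans Jj (increasing_ge j qi).
split; first by have [] := qn i iK.
have le i' : (i' <= K)%N -> signed (b i') (y (n j i') x) <= c + d.
  move=> i'K; have [qni _] := qn i' i'K.
  have := J0P (n j i') (leq_trans J0j (leq_trans (increasing_ge j qi) qni)).
  by rewrite ler_norml /signed => /andP[]; case: (b i'); lra.
have iK' : (i < K.+1)%N by [].
move: zj; rewrite /z mulrC ltr_pdivlMr// (bigD1 (Ordinal iK'))//=.
have : \sum_(i' < K.+1 | i' != Ordinal iK') signed (b i') (y (n j i') x) <=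
    \sum_(i' < K.+1 | i' != Ordinal iK') (c + d).
  by apply: ler_sum => i' _; apply: le; rewrite -ltnS.
rewrite sumr_const cardC1 card_ord -mulr_natr => h1 h2.
have : (c - d) * K.+1%:R < signed (b i) (y (n j i) x) + (c + d) * K%:R by lra.
rewrite -[K.+1%:R]natr1 in dE *; set k := K%:R in dE *.
have : 0 <= k * d by rewrite mulr_ge0// ltW.
nra.
Qed.

(** Vectors are added one at a time, under the invariant that every sign pattern on the list is
    realized by y n for arbitrarily large n. *)
Lemma rademacher_of_stable : exists x, rademacher_system p x (c / 2).
Proof.
pose S (X : seq V) := forall (sigma : nat -> bool) J, exists2 n, (J <= n)%N &
  forall i, (i < size X)%N -> c / 2 <= signed (sigma i) (y n (nth 0 X i)).
have [||u [u0 uS uP]] := @dependent_choice_inv _ S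
    (fun _ X X' => exists2 x, p x <= 1 & X' = rcons X x) [::].
- by move=> sigma J; exists J.
- move=> _ X SX; pose T : finType := (size X).+1.-tuple bool.
  pose bits i : T := nth [tuple true | _ < _] (enum T) i.
  (* One vector serves all patterns of length size X + 1: pattern j prescribes the signs on X
     through its first bits, and its last bit is the sign wanted at the new vector. *)
  have [|x x1 xP] := @simultaneous_large (fun i => nth true (bits i) (size X))
      (fun j n => forall i, (i < size X)%N ->
         c / 2 <= signed (nth true (bits j) i) (y n (nth 0 X i))) #|T|.
    by move=> j J _; exact: SX.
  exists (rcons X x); last by exists x.
  move=> sigma J; pose t : T := [tuple sigma i | i < _].
  have [|n Jn [nX nx]] := xP (index t (enum T)) J.
    by rewrite cardE; exact: index_size.
  have tE : bits (index t (enum T)) = t by rewrite /bits nth_index// mem_enum.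
  have tn i : (i < (size X).+1)%N -> nth true t i = sigma i.
    by move=> iX; have := tnth_mktuple (fun i : 'I__ => sigma i) (Ordinal iX); rewrite (tnth_nth true).
  exists n => // i; rewrite size_rcons ltnS leq_eqVlt => /orP[/eqP ->|iX].
    by move: nx; rewrite tE tn// nth_rcons ltnn eqxx.
  by have := nX i iX; rewrite tE tn ?nth_rcons ?iX//; exact: ltnW.
have us m : size (u m) = m.
  elim: m => [|m IH]; first by rewrite u0.
  by have [x _ ->] := uP m; rewrite size_rcons IH.
have un i m : (i < m)%N -> nth 0 (u m) i = nth 0 (u i.+1) i.
  elim: m => // m IH; rewrite ltnS leq_eqVlt => /orP[/eqP ->//|im].
  by have [x _ ->] := uP m; rewrite nth_rcons us im IH.
exists (fun i => nth 0 (u i.+1) i); split.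
- by rewrite divr_gt0.
- by move=> i; have [x x1 ->] := uP i; rewrite nth_rcons us ltnn eqxx.
move=> sigma m; have [n _ nP] := uS m sigma 0%N; exists (y n) => // i im.
have := nP i; rewrite us un// => /(_ im); rewrite /signed; case: (sigma i) => //.
by rewrite lerNr.
Qed.

End josefson_nissenzweig.

(** Rosenthal's dichotomy is applied to the functionals on the unit ball of V. A pointwise Cauchy
    subsequence gives null differences. In the independent case, a stable block sequence with c > 0
    would produce a copy of l_1; so c = 0 and the blocks themselves are pointwise null. *)
Lemma josefson_nissenzweig (R : realType) (V : lmodType R) (p : V -> R)
    (f : nat -> V -> R) (x : nat -> V) : seminorm p ->
  (forall x c, ~ rademacher_system p x c) ->
  (forall n, bfun p (f n)) -> (forall n, p (x n) <= 1) ->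
  (forall m n, (m < n)%N -> f m (x n) = 0) -> (forall n, f n (x n) = 1) ->
  exists g (u : nat -> V) c, [/\ forall n, bfun p (g n),
    (forall v e, 0 < e -> exists J, forall n, (J <= n)%N -> `|g n v| < e),
    0 < c, forall n, p (u n) <= 1 & forall n, c <= g n (u n)].
Proof.
move=> sp norad fb x1 f0 f1.
have scale (g : nat -> V -> R) : (forall n, bfun p (g n)) ->
    (forall v, p v <= 1 -> forall e, 0 < e -> exists J, forall n, (J <= n)%N -> `|g n v| < e) ->
    forall v e, 0 < e -> exists J, forall n, (J <= n)%N -> `|g n v| < e.
  move=> gb gP v e e0; have pv := seminorm_ge0 sp v.
  have q0 : 0 < p v + 1 by lra.
  have [||J JP] := gP ((p v + 1)^-1 *: v) _ (e / (p v + 1)).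
  - by rewrite sp.2 gtr0_norm ?invr_gt0// ler_pdivrMl//; lra.
  - by rewrite divr_gt0.
  exists J => n /JP; rewrite (bfunZ (gb n)) normrM gtr0_norm ?invr_gt0//.
  by rewrite mulrC ltr_pM2r ?invr_gt0.
have fB : forall n (z : {x | p x <= 1}), `|f n (sval z)| <= 1.
  by move=> n [z z1] /=; apply: le_trans (bfun_norm sp (fb n) _) z1.
have [[h hi hP]|[h [r [s [hi rs hP]]]]] := rosenthal fB.
  (* At x (h n.+1) the first functional is 1 and, by triangularity, the second is 0: the value there
     is 1/2. *)
  pose g n v := 2^-1 * f (h n.+1) v + - 2^-1 * f (h n) v.
  have gb n : bfun p (g n).
    by apply: bfun_comb => //; rewrite normrN gtr0_norm//; lra.
  exists g, (fun n => x (h n.+1)), 2^-1; split => //.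
    apply: scale => // v v1 e e0.
    have [J JP] := hP (exist _ v v1) e e0; exists J => n Jn.
    have := JP n.+1 n (leqW Jn) Jn; rewrite /= /g.
    rewrite mulNr -mulrBr normrM gtr0_norm//.
    have := normr_ge0 (f (h n.+1) v - f (h n) v); lra.
  by move=> n; rewrite /g f1 f0// mulr0 addr0 mulr1.
pose y i := f (h i).
have yb i : bfun p (y i) := fb (h i).
have [z [c [yz c0 zc zst]]] := stable_block sp yb.
have zb := block_sequence_bfun sp yb yz.
move: c0; rewrite le_eqVlt => /orP[/eqP c0|c0]; last first.
  by have [x' x'P] := rademacher_of_stable sp zb c0 zc zst; case: (norad _ _ x'P).
(* The sets [s < y i] and [y i < r] being independent, blocks of y stay bounded below. *)
have sep m n w : block y m n w -> exists sigma : nat -> bool, forall v v',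
    (forall i, (m <= i < n)%N -> if sigma i then s < y i v /\ y i v' < r
      else s < y i v' /\ y i v < r) -> s - r <= w v - w v'.
  elim=> [i|i i' j j' u i'i jj' _ [sigma IH]|l i j a b u u' lu [sigma IH] iu [sigma' IH'] ab].
  - exists (fun=> true) => v v' /(_ i); rewrite leqnn ltnSn => /(_ isT); lra.
  - exists sigma => v v' H; apply: IH => k /andP[ik kj]; apply: H.
    by rewrite (leq_trans i'i ik) (leq_trans kj jj').
  (* A negative coefficient exchanges the roles of v and v', so the pattern is flipped on its
     part. *)
  - exists (fun k => if (k < i)%N then sigma k (+) (a < 0) else sigma' k (+) (b < 0)) => v v' H.
    have li := ltnW (block_lt lu); have ij := ltnW (block_lt iu).
    have H1 k : (l <= k < i)%N -> if sigma k (+) (a < 0) then s < y k v /\ y k v' < r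
        else s < y k v' /\ y k v < r.
      move=> /andP[lk ki]; have := H k; rewrite lk ki (leq_trans ki ij); exact.
    have H2 k : (i <= k < j)%N -> if sigma' k (+) (b < 0) then s < y k v /\ y k v' < r
        else s < y k v' /\ y k v < r.
      move=> /andP[ik kj]; have := H k.
      by rewrite (leq_trans li ik) kj ltnNge ik /=; exact.
    have A : `|a| * (s - r) <= a * (u v - u v').
      have [a0|a0] := ltP a 0.
        have : s - r <= u v' - u v.
          by apply: IH => k /H1; rewrite a0 addbT; case: (sigma k).
        rewrite ltr0_norm//; nra.
      have : s - r <= u v - u v'.
        by apply: IH => k /H1; rewrite ltNge a0 addbF.
      rewrite ger0_norm//; nra.
    have B : `|b| * (s - r) <= b * (u' v - u' v').
      have [b0|b0] := ltP b 0.
        have : s - r <= u' v' - u' v.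
          by apply: IH' => k /H2; rewrite b0 addbT; case: (sigma' k).
        rewrite ltr0_norm//; nra.
      have : s - r <= u' v - u' v'.
        by apply: IH' => k /H2; rewrite ltNge b0 addbF.
      rewrite ger0_norm//; nra.
    have : (`|a| + `|b|) * (s - r) = s - r by rewrite ab mul1r.
    lra.
have /choice[u uP] n : exists u, p u <= 1 /\ (s - r) / 2 <= z n u.
  have [q qi zP] := yz; have [sigma sg] := sep _ _ _ (zP n).
  have [[v v1] /= vP] := hP sigma (q n.+1).
  have [[v' v'1] /= v'P] := hP (fun i => ~~ sigma i) (q n.+1).
  (* Half the difference stays in the unit ball and halves the separation s - r. *)
  exists (2^-1 *: (v - v')); split.
    rewrite sp.2 gtr0_norm//; have := seminormB sp v v'; lra.
  rewrite (bfunZ (zb n)) (bfunB (zb n)) mulrC ler_pM2l//; apply: sg => i /andP[_ iq].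
  by have := vP i iq; have := v'P i iq; case: (sigma i).
exists z, u, ((s - r) / 2); split => //.
- apply: scale => // v v1 e e0; have e2 : 0 < e / 2 by rewrite divr_gt0.
  have [J JP] := limsup_le_norm sp zb zc v1 e2; exists J => n /JP.
  by rewrite -c0; lra.
- by rewrite divr_gt0// subr_gt0.
- by move=> n; have [] := uP n.
- by move=> n; have [] := uP n.
Qed.

(** * Phillips' lemma and Rademacher averages *)

Section almost_disjoint.

(** The codes of the finite prefixes of t, a branch of the binary tree: distinct branches share only
    finitely many, so these sets form an uncountable almost disjoint family. *)
Definition branch (t : nat -> bool) (n : nat) : bool :=
  `[< exists j, n = pickle (mkseq t j) >].

Lemma branch_infinite t J : exists2 n, (J <= n)%N & branch t n.
Proof.
apply: contrapT => H.
have lt j : (pickle (mkseq t j) < J)%N.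
  rewrite ltnNge; apply/negP => h; apply: H; exists (pickle (mkseq t j)) => //.
  by apply/asboolP; exists j.
pose f (i : 'I_J.+1) : 'I_J := Ordinal (lt i).
have finj : injective f.
  move=> i i' [/(pcan_inj pickleK)/(congr1 size)].
  by rewrite !size_mkseq => h; apply: val_inj.
by have := leq_card f finj; rewrite !card_ord ltnn.
Qed.

Lemma branch_almost_disjoint (D : nat) (t : nat -> nat -> bool) : injective t ->
  exists J, forall n i j, (J <= n)%N -> (i < D)%N -> (j < D)%N ->
    branch (t i) n -> branch (t j) n -> i = j.
Proof.
move=> tinj.
have two i j : exists J, forall n, (J <= n)%N -> branch (t i) n -> branch (t j) n -> i = j.
  have [->|ij] := eqVneq i j; first by exists 0%N.
  have /existsNP[k tk] : ~ forall k, t i k = t j k.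
    by move=> h; move/eqP: ij; apply; apply: tinj; apply/funext.
  exists (\max_(l < k.+1) pickle (mkseq (t i) l)).+1 => n kn /asboolP[l nl] /asboolP[l' nl'].
  have e : mkseq (t i) l = mkseq (t j) l' by apply: (pcan_inj pickleK); rewrite -nl -nl'.
  have ll' : l = l' by have := congr1 size e; rewrite !size_mkseq.
  case: (ltnP k l) => kl; last first.
    move: kn; rewrite nl ltnNge => /negP; case.
    have lk : (l < k.+1)%N by [].
    by rewrite (@leq_bigmax _ (fun l : 'I_k.+1 => pickle (mkseq (t i) l)) (Ordinal lk)).
  exfalso; apply: tk.
  by have := congr1 (nth true ^~ k) e; rewrite -ll' !nth_mkseq.
have /choice[J JP] (ij : nat * nat) := two ij.1 ij.2.
exists (\max_(i < D) \max_(j < D) J (nat_of_ord i, nat_of_ord j)) => n i j Jn iD jD.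
apply: (JP (i, j)); apply: leq_trans Jn.
rewrite (leq_trans _ (leq_bigmax (Ordinal iD)))//.
by rewrite (leq_trans _ (leq_bigmax (Ordinal jD))).
Qed.

Lemma uncountable_branches : ~ countable [set: nat -> bool].
Proof.
move=> /countable_injP[f finj].
pose d n := ~~ `[< exists2 t, f t = n & t n >].
have := erefl (d (f d)); rewrite {1}/d; case: asboolP => /=.
  move=> [t ft tt]; have td : t = d by apply: finj; rewrite ?inE.
  by have := congr1 (fun g => g (f d)) td; rewrite /= tt => <-.
by move=> h; case E : (d (f d)) => // _; apply: h; exists d.
Qed.

Variable R : realType.

Definition bounded_seqR (xi : nat -> R) := exists C, forall i, `|xi i| <= C.

Lemma bounded_seqR_comb a xi eta : bounded_seqR xi -> bounded_seqR eta ->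
  bounded_seqR (fun i => a * xi i + eta i).
Proof.
move=> [C CP] [D DP]; exists (`|a| * C + D) => i.
by rewrite (le_trans (ler_normD _ _))// normrM lerD// ler_wpM2l.
Qed.

Lemma bounded_seqR_sum D (xi : nat -> nat -> R) (c : nat -> R) :
  (forall j, bounded_seqR (xi j)) ->
  bounded_seqR (fun n => \sum_(j < D) c j * xi j n).
Proof.
move=> b; elim: D => [|D IH]; first by exists 0 => i; rewrite big_ord0 normr0.
have := bounded_seqR_comb (c D) (b D) IH; congr bounded_seqR.
by apply/funext => n; rewrite big_ord_recr addrC.
Qed.

Lemma bounded_seqR_nat (M : nat -> bool) : bounded_seqR (fun n => (M n)%:R).
Proof. by exists 1 => i; case: (M i); rewrite ?normr1 ?normr0. Qed.

(* Phillips' lemma through Whitley's argument: a functional on l_infty which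
   vanishes on c_0 is nonzero on at most countably many of the indicators of an
   almost disjoint family. *)
Lemma vanishing_indicator (L : nat -> (nat -> R) -> R) :
  (forall k a xi eta, bounded_seqR xi -> bounded_seqR eta ->
     L k (fun i => a * xi i + eta i) = a * L k xi + L k eta) ->
  (forall k, exists C, forall xi, (forall i, `|xi i| <= 1) -> `|L k xi| <= C) ->
  (forall k xi J, (forall i, (J <= i)%N -> xi i = 0) -> L k xi = 0) ->
  exists M : nat -> bool, (forall J, exists2 n, (J <= n)%N & M n) /\
    forall k, L k (fun i => (M i)%:R) = 0.
Proof.
move=> Llin Lbnd L0.
pose chi t n : R := (branch t n)%:R.
pose bad (kj : nat * nat) := [set t | kj.2.+1%:R^-1 <= `|L kj.1 (chi t)|].
have bad_fin kj : finite_set (bad kj).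
  apply: contrapT => /infiniteP/pcard_leP[f].
  have finj : injective f by move=> x y; apply: (@inj _ _ _ f); rewrite inE.
  have fb i : bad kj (f i) by exact: (@funS _ _ _ _ f).
  case: kj f finj fb => k j /= f finj fb.
  have [C CP] := Lbnd k.
  (* A signed sum of D bad indicators, cut to the indices where they are disjoint, has norm at most
     1, while [L k] takes on it a value at least D / (j + 1) > C. *)
  pose D := (Num.truncn (C * j.+1%:R)).+1.
  have CD : C * j.+1%:R < D%:R by exact: truncnS_gt.
  have [J JP] := branch_almost_disjoint D finj.
  pose c i := Num.sg (L k (chi (f i))).
  have Lsum D' : L k (fun n => \sum_(i < D') c i * chi (f i) n) = \sum_(i < D') `|L k (chi (f i))|.
    elim: D' => [|D' IH].
      by rewrite big_ord0; apply: (L0 _ _ 0%N) => i _; rewrite big_ord0.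
    rewrite big_ord_recr /= -IH normrEsg addrC -Llin; last 2 first.
    - exact: bounded_seqR_nat.
    - by apply: (@bounded_seqR_sum D' (fun i => chi (f i)) c) => i; exact: bounded_seqR_nat.
    by congr (L k _); apply/funext => n; rewrite big_ord_recr /= addrC.
  pose eta n := if (n < J)%N then 0 else \sum_(i < D) c i * chi (f i) n.
  have eta1 n : `|eta n| <= 1.
    rewrite /eta; case: ltnP => Jn; first by rewrite normr0 ler01.
    have [[i0 i0n]|H] := pselect (exists i : 'I_D, branch (f i) n); last first.
      rewrite big1 ?normr0 ?ler01// => i _; rewrite /chi.
      by case E : branch; rewrite ?mulr0//; case: H; exists i.
    rewrite (bigD1 i0)//= big1 ?addr0 => [|i ii0].
      rewrite /chi i0n mulr1 /c normr_sg.
      by case: (_ != _); rewrite ?ler01.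
    rewrite /chi; case E : branch; rewrite ?mulr0//.
    by move/eqP: ii0; case; apply: val_inj;
      exact: (JP n _ _ Jn (ltn_ord i) (ltn_ord i0) E i0n).
  have := CP _ eta1.
  have -> : L k eta = \sum_(i < D) `|L k (chi (f i))|.
    rewrite -Lsum; pose xi n := if (n < J)%N then \sum_(i < D) c i * chi (f i) n else 0.
    have -> : (fun n => \sum_(i < D) c i * chi (f i) n) = (fun n => 1 * xi n + eta n).
      by apply/funext => n; rewrite /xi /eta mul1r; case: ifP; rewrite ?addr0 ?add0r.
    rewrite Llin; last 2 first.
    - exists (\sum_(i < J) `|xi i|) => i; case: (ltnP i J) => iJ.
        by rewrite (bigD1 (Ordinal iJ))//= lerDl sumr_ge0.
      by rewrite /xi ltnNge iJ normr0 sumr_ge0.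
    - by exists 1.
    rewrite (L0 k xi J) ?mulr0 ?add0r// => i Ji.
    by rewrite /xi ltnNge Ji.
  have : D%:R * j.+1%:R^-1 <= \sum_(i < D) `|L k (chi (f i))|.
    rewrite mulrC mulr_natr -[D in X in X <= _]card_ord -sumr_const.
    by apply: ler_sum => i _; exact: fb.
  move=> h1; have : 0 <= \sum_(i < D) `|L k (chi (f i))| by rewrite sumr_ge0.
  move=> h2; rewrite ger0_norm// => h3.
  have := le_trans h1 h3; rewrite ler_pdivrMr ?ltr0n//.
  by rewrite leNgt CD.
have /existsNP[t Ht] : ~ forall t, (\bigcup_(kj in setT) bad kj) t.
  move=> H; apply: uncountable_branches.
  have <- : \bigcup_(kj in setT) bad kj = setT by apply/seteqP; split.
  apply: bigcup_countable => // kj _; exact: finite_set_countable.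
exists (branch t); split; first exact: branch_infinite.
move=> k; apply/eqP; rewrite -normr_eq0; apply: contraT => n0.
exfalso; apply: Ht.
have pos : 0 < `|L k (chi t)| by rewrite lt_neqAle eq_sym n0 normr_ge0.
exists (k, Num.truncn (`|L k (chi t)|^-1)) => //=.
rewrite /bad /= -[leRHS]invrK lef_pV2 ?posrE ?invr_gt0// ltW// truncnS_gt//.
Qed.

End almost_disjoint.

(** * Ultralimits and square-summable averages of functionals *)

Section ultralimits.
Variables (R : realType) (U : set_system nat).
Hypotheses (UU : UltraFilter U) (Uoo : \oo `<=` U).

Lemma ultra_infinite (A : set nat) J : U A -> exists2 n, (J <= n)%N & A n.
Proof.
move=> UA; have UJ : U [set n | (J <= n)%N] by apply: Uoo; exists J.
by have [n [Jn An]] := filter_ex (filterI UJ UA); exists n.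
Qed.

Lemma ultralimit (v : nat -> R) (B : R) : (forall n, `|v n| <= B) ->
  exists2 l, `|l| <= B & forall e, 0 < e -> U [set n | `|v n - l| < e].
Proof.
move=> vB; have FF : ProperFilter (v @ U) by exact: fmap_proper_filter.
have [|l [lB lc]] := @segment_compact R (- B) B (v @ U) FF.
  rewrite /fmap /=; apply: filterE => n /=; rewrite in_itv /= -ler_norml.
  exact: vB.
exists l; first by move: lB; rewrite /= in_itv /= -ler_norml.
move=> e e0; have [//|UC] := in_ultra_setVsetC [set n | `|v n - l| < e] UU.
have UB : U (v @^-1` (~` ball l e)).
  apply: filterS UC => n /= h hb; apply: h; move: hb.
  by rewrite -ball_normE /= distrC.
by have [x []] := lc (~` ball l e) (ball l e) UB (nbhsx_ballx l e e0).
Qed.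

End ultralimits.

Lemma exists_ultrafilter : exists U : set_system nat, UltraFilter U /\ \oo `<=` U.
Proof. exact: (ultraFilterLemma (F := \oo)). Qed.

Section rademacher_averages.
Variable R : realType.

Let sgn (b : bool) : R := (-1) ^+ b.

Let sgn_sq b : sgn b * sgn b = 1.
Proof. by rewrite /sgn -signr_addb addbb. Qed.

Section finite_average.
Variable m : nat.
Local Notation T := {ffun 'I_m -> bool}.
Let N : R := #|{: T}|%:R.

Let N0 : 0 < N.
Proof.
rewrite ltr0n; apply/card_gt0P.
by exists [ffun=> true].
Qed.

Let orthogonal (j k : 'I_m) : j != k -> \sum_(s : T) sgn (s j) * sgn (s k) = 0.
Proof.
move=> jk; pose flip (s : T) : T := [ffun i => if i == j then ~~ s i else s i].
have flipK : involutive flip.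
  by move=> s; apply/ffunP => i; rewrite !ffunE; case: eqP => //; rewrite negbK.
suff : \sum_(s : T) sgn (s j) * sgn (s k) = - \sum_(s : T) sgn (s j) * sgn (s k) by lra.
rewrite {1}(reindex_inj (inv_inj flipK)) -sumrN; apply: eq_bigr => s _.
rewrite !ffunE eqxx eq_sym (negPf jk) /sgn; case: (s j) => /=; ring.
Qed.

(** The k-th Rademacher coefficient of g. As [sgn true] is -1, the bit true stands for the negative
    sign below. *)
Definition rademacher_average (g : T -> R) (k : 'I_m) : R :=
  #|{: T}|%:R^-1 * \sum_(s : T) sgn (s k) * g s.

(** Bessel's inequality: expand the squared distance from g to the combination of the orthonormal
    signs with coefficients a. *)
Lemma bessel_average (g : T -> R) (B : R) : (forall s, `|g s| <= B) ->
  \sum_k rademacher_average g k ^+ 2 <= B ^+ 2.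
Proof.
move=> gB; set a := rademacher_average g.
have aE k : \sum_(s : T) sgn (s k) * g s = N * a k.
  by rewrite /a /rademacher_average mulrA divff ?mul1r// gt_eqF.
have : 0 <= \sum_(s : T) (g s - \sum_k a k * sgn (s k)) ^+ 2.
  by apply: sumr_ge0 => s _; exact: sqr_ge0.
have E : \sum_(s : T) (g s - \sum_k a k * sgn (s k)) ^+ 2 =
    \sum_(s : T) g s ^+ 2 - N * \sum_k a k ^+ 2.
  under eq_bigr do rewrite sqrrB.
  rewrite big_split sumrB /=.
  have -> : \sum_(s : T) g s * (\sum_k a k * sgn (s k)) *+ 2 =
      2 * (N * \sum_k a k ^+ 2).
    rewrite sumrMnl mulr_natl; congr (_ *+ 2).
    under eq_bigr do rewrite mulr_sumr.
    rewrite exchange_big mulr_sumr; apply: eq_bigr => k _.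
    rewrite expr2 mulrA -aE mulr_suml; apply: eq_bigr => s _; ring.
  have -> : \sum_(s : T) (\sum_k a k * sgn (s k)) ^+ 2 = N * \sum_k a k ^+ 2.
    under eq_bigr do rewrite expr2 mulr_suml.
    rewrite exchange_big mulr_sumr; apply: eq_bigr => j _ /=.
    under eq_bigr do rewrite mulr_sumr.
    rewrite exchange_big (bigD1 j)//= [X in _ + X]big1 ?addr0 => [|k kj].
      under eq_bigr do rewrite mulrACA sgn_sq mulr1.
      by rewrite sumr_const -mulr_natl expr2.
    under eq_bigr do rewrite mulrACA.
    by rewrite -mulr_sumr orthogonal ?mulr0// eq_sym.
  lra.
rewrite E subr_ge0 mulrC -ler_pdivlMr// => h; apply: (le_trans h).
rewrite ler_pdivrMr//.
have -> : B ^+ 2 * N = \sum_(s : T) B ^+ 2 by rewrite sumr_const mulr_natr.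
apply: ler_sum => s _; rewrite -[leLHS]real_normK ?num_real//.
by rewrite ler_pXn2r ?nnegrE// (le_trans _ (gB s)).
Qed.

Lemma rademacher_average_ge (g : T -> R) (k : 'I_m) (c : R) :
  (forall s : T, if s k then g s <= - c else c <= g s) -> c <= rademacher_average g k.
Proof.
move=> H; rewrite /rademacher_average ler_pdivlMl// mulr_natl -sumr_const.
apply: ler_sum => s _; have := H s; rewrite /sgn; case: (s k) => /=.
  by rewrite expr1 mulN1r; lra.
by rewrite expr0 mul1r.
Qed.
End finite_average.

Variables (V : lmodType R) (p : V -> R).
Hypothesis sp : seminorm p.

(** For fixed m, averaging against signs the functionals that realize all patterns on the first m
    vectors gives m functionals, to which Bessel's inequality applies at each v. The ultralimit in m
    then removes the dependence on m. *)
Lemma rademacher_bessel (x : nat -> V) c : rademacher_system p x c ->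
  exists z : nat -> V -> R, [/\ forall k, bfun p (z k),
    forall m v, \sum_(k < m) z k v ^+ 2 <= p v ^+ 2 &
    forall k, c <= z k (x k)].
Proof.
move=> [c0 x1 H].
have /choice[h hP] (sm : (nat -> bool) * nat) : exists g, bfun p g /\
    forall i, (i < sm.2)%N -> if sm.1 i then c <= g (x i) else g (x i) <= - c.
  by have [g gb gP] := H sm.1 sm.2; exists g.
pose g m (s : {ffun 'I_m -> bool}) : V -> R :=
  h ((fun i => if insub i is Some i' then ~~ s i' else true), m).
have gb m s : bfun p (@g m s) by have [] := hP ((fun i => if insub i is Some i' then ~~ s i' else true), m).
have gP m (s : {ffun 'I_m -> bool}) (i : 'I_m) : if s i then g m s (x i) <= - c else c <= g m s (x i).
  have [_ /(_ i (ltn_ord i)) /=] := hP ((fun i => if insub i is Some i' then ~~ s i' else true), m).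
  by rewrite valK; case: (s i).
pose zm m k v : R := if insub k is Some k' then
  rademacher_average (fun s => g m s v) k' else 0.
have zmE m (k : 'I_m) v : zm m k v = rademacher_average (fun s => g m s v) k.
  by rewrite /zm valK.
have gB m s v : `|g m s v| <= p v by exact: bfun_norm (sp) (gb m s) v.
have bes m v : \sum_(k < m) zm m k v ^+ 2 <= p v ^+ 2.
  under eq_bigr do rewrite zmE.
  exact: bessel_average.
have zmB k v m : `|zm m k v| <= p v.
  have pv := seminorm_ge0 sp v.
  have [km|km] := ltnP k m; last by rewrite /zm insubF ?normr0// ltnNge km.
  have := bes m v; rewrite (bigD1 (Ordinal km))//= => b.
  rewrite -ler_sqr ?nnegrE// real_normK ?num_real//; apply: le_trans b.
  by rewrite lerDl sumr_ge0// => i _; exact: sqr_ge0.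
have zmlin m k a v w : zm m k (a *: v + w) = a * zm m k v + zm m k w.
  rewrite /zm; case: insub => [i|]; last by rewrite mulr0 addr0.
  rewrite /rademacher_average [a * _]mulrCA -mulrDr; congr (_ * _).
  rewrite mulr_sumr -big_split /=.
  by apply: eq_bigr => s _; rewrite (gb m s).1 mulrDr mulrCA.
have [U [UU Uoo]] := exists_ultrafilter.
have /choice[z zP] (kv : nat * V) : exists l, forall e, 0 < e ->
    U [set m | `|zm m kv.1 kv.2 - l| < e].
  by have [l _ lP] := ultralimit UU (zmB kv.1 kv.2); exists l.
have near k v e : 0 < e -> U [set m | `|zm m k v - z (k, v)| < e].
  exact: zP (k, v) e.
have bnd k v : `|z (k, v)| <= p v.
  apply/ler_addgt0Pr => e e0; have [m mP] := filter_ex (near k v e e0).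
  have := zmB k v m; have := ler_normD (z (k, v) - zm m k v) (zm m k v).
  by rewrite subrK distrC; move: mP => /=; lra.
have zb k : bfun p (fun v => z (k, v)).
  split=> [a v w|v]; last by apply: le_trans (ler_norm _) (bnd k v).
  apply/eqP; rewrite -subr_eq0 -normr_le0; apply/ler_addgt0Pr => e e0; rewrite add0r.
  pose d := e / (2 + `|a|).
  have a0 : 0 < 2 + `|a| by have := normr_ge0 a; lra.
  have d0 : 0 < d by rewrite divr_gt0.
  have [m [[/= m1 m2] m3]] := filter_ex (filterI (filterI (near k (a *: v + w) d d0)
    (near k v d d0)) (near k w d d0)).
  have -> : e = (2 + `|a|) * d by rewrite /d mulrC divfK// gt_eqF.
  have -> : z (k, a *: v + w) - (a * z (k, v) + z (k, w)) =
     - (zm m k (a *: v + w) - z (k, a *: v + w)) + a * (zm m k v - z (k, v)) +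
     (zm m k w - z (k, w)) by rewrite zmlin; ring.
  have := ler_normD (- (zm m k (a *: v + w) - z (k, a *: v + w)) + a * (zm m k v - z (k, v)))
     (zm m k w - z (k, w)).
  have := ler_normD (- (zm m k (a *: v + w) - z (k, a *: v + w))) (a * (zm m k v - z (k, v))).
  rewrite normrN normrM; have := normr_ge0 a; move: m1 m2 m3 => /=; nra.
exists (fun k v => z (k, v)); split => //.
- move=> M v; apply/ler_addgt0Pr => e e0.
  have pv := seminorm_ge0 sp v.
  pose d := e / (M%:R * (2 * p v + 1) + 1) .
  have M0 : 0 <= M%:R * (2 * p v + 1) by rewrite mulr_ge0//; lra.
  have d0 : 0 < Num.min 1 d by rewrite lt_min ltr01 divr_gt0//; lra.
  have : U [set m | forall k : 'I_M, `|zm m k v - z (nat_of_ord k, v)| < Num.min 1 d].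
    apply: filter_forall => k; exact: near.
  (* Taking m at least M makes the M coordinates part of the finite Bessel sum for m. *)
  move=> /(ultra_infinite UU Uoo M)[m Mm mP].
  have le1 (k : 'I_M) : z (nat_of_ord k, v) ^+ 2 <= zm m k v ^+ 2 + (2 * p v + 1) * d.
    have := mP k; rewrite lt_min => /andP[h1 h2].
    have h3 := zmB k v m.
    have : z (nat_of_ord k, v) ^+ 2 = zm m k v ^+ 2 - 2 * zm m k v * (zm m k v - z (nat_of_ord k, v)) +
      (zm m k v - z (nat_of_ord k, v)) ^+ 2 by ring.
    set D := zm m k v - _ in h1 h2 *; set Z := zm m k v in h3 *.
    have ZD : - (2 * Z * D) <= 2 * p v * d.
      have : `|Z * D| <= p v * d by rewrite normrM ler_pM// ltW.
      have := ler_norm (- (Z * D)); rewrite normrN; lra.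
    have D2 : D ^+ 2 <= d.
      rewrite -real_normK ?num_real//.
      have := normr_ge0 D; nra.
    lra.
  apply: (@le_trans _ _ (\sum_(k < M) (zm m k v ^+ 2 + (2 * p v + 1) * d))).
    by apply: ler_sum => k _; exact: le1.
  rewrite big_split /= sumr_const card_ord -mulr_natl; apply: lerD.
    apply: le_trans (bes m v); rewrite -!(big_mkord predT (fun k => zm m k v ^+ 2)).
    rewrite (big_cat_nat (leq0n _) Mm)//= lerDl sumr_ge0// => i _; exact: sqr_ge0.
  have dE : d * (M%:R * (2 * p v + 1) + 1) = e by rewrite /d divfK// gt_eqF//; lra.
  have : 0 < d by move: d0; rewrite lt_min => /andP[].
  lra.
- move=> k; apply/ler_addgt0Pr => e e0.
  have [m km /= mP] := ultra_infinite UU Uoo k.+1 (near k (x k) e e0).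
  have : c <= zm m k (x k).
    rewrite -[k]/(nat_of_ord (Ordinal km)) zmE; apply: rademacher_average_ge => s.
    exact: gP.
  move: mP; rewrite ltr_norml => /andP[]; lra.
Qed.

End rademacher_averages.

(** * Polynomials and finite differences *)

Section finite_differences.
Variables (K : numFieldType) (E F : lmodType K).
Implicit Types (f g : E -> F) (h x y : E) (hs : seq E).

Definition fdiff h f x := f (x + h) - f x.

Definition fdiffs hs f := foldr fdiff f hs.

(** Degree in the sense of Fréchet: all d-fold differences vanish. *)
Fixpoint deg_lt d f : Prop :=
  if d is d'.+1 then forall h, deg_lt d' (fdiff h f) else forall x, f x = 0.

Lemma diffC h h' f : fdiff h (fdiff h' f) = fdiff h' (fdiff h f).
Proof.
by apply/funext => x; rewrite /fdiff [x + h' + h]addrAC !opprD !opprK addrACA.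
Qed.

Lemma diffs_diff h hs f : fdiffs hs (fdiff h f) = fdiff h (fdiffs hs f).
Proof. by elim: hs => //= h' hs ->; exact: diffC. Qed.

Lemma diffs_cat hs hs' f : fdiffs (hs ++ hs') f = fdiffs hs (fdiffs hs' f).
Proof. exact: foldr_cat. Qed.

Lemma diffs_sum (I : Type) (s : seq I) (G : I -> E -> F) hs :
  fdiffs hs (fun x => \sum_(i <- s) G i x) = fun x => \sum_(i <- s) fdiffs hs (G i) x.
Proof.
elim: hs => //= h hs ->; apply/funext => x.
by rewrite /fdiff -sumrB.
Qed.

Lemma deg_lt_diffs f hs : deg_lt (size hs) f -> forall x, fdiffs hs f x = 0.
Proof.
elim: hs f => //= h hs IH f fd x.
by rewrite -diffs_diff; apply: IH; exact: fd.
Qed.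

Lemma deg_lt_sum d (I : Type) (s : seq I) (G : I -> E -> F) :
  (forall i, deg_lt d (G i)) -> deg_lt d (fun x => \sum_(i <- s) G i x).
Proof.
elim: d G => [|d IH] G H /=; first by move=> x; rewrite big1// => i _; exact: H.
move=> h; have -> : fdiff h (fun x => \sum_(i <- s) G i x) = fun x => \sum_(i <- s) fdiff h (G i) x.
  by apply/funext => x; rewrite /fdiff -sumrB.
by apply: IH => i; exact: H.
Qed.

Lemma deg_lt0 d : deg_lt d (fun=> 0).
Proof.
elim: d => //= d IH h; have -> // : fdiff h (fun=> 0) = fun=> 0.
by apply/funext => x; rewrite /fdiff subrr.
Qed.

Variables (n : nat) (A : ('I_n -> E) -> F).
Hypothesis Alin : multilinear_map A.
Implicit Types (w : 'I_n -> bool * E).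

(** A slot (true, a) holds x + a and a slot (false, a) holds the constant a. Differences of such
    monomials are sums of such monomials with one variable slot less. *)
Let at_ w x j := if (w j).1 then x + (w j).2 else (w j).2.
Let mono w x := A (at_ w x).
Let vars w := [pred j | (w j).1].
Let shift w h (m : 'I_n) : 'I_n -> bool * E := fun j =>
  if j == m then (false, h)
  else if (j < m)%N && (w j).1 then (true, (w j).2 + h) else w j.

Let vars_shift w h m : (w m).1 -> #|vars w| = #|vars (shift w h m)|.+1.
Proof.
move=> wm; rewrite (cardD1 m) [m \in _]wm add1n; congr _.+1.
apply: eq_card => j; rewrite !inE /shift; case: (eqVneq j m) => //= _.
by case: ifP => // /andP[_ ->].
Qed.

(** Telescoping over the slots: those before m already hold x + h, slot m contributes h by
    linearity, those after m still hold x. This is what [shift] records. *)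
Let diff_mono w h :
  fdiff h (mono w) = fun x => \sum_(m < n) (if (w m).1 then mono (shift w h m) x else 0).
Proof.
apply/funext => x.
pose T m := A (fun j : 'I_n => if (j < m)%N then at_ w (x + h) j else at_ w x j).
have -> : fdiff h (mono w) x = T n - T 0%N.
  rewrite /fdiff /T /mono; congr (A _ - A _).
  by apply/funext => j; rewrite ltn_ord.
have -> : T n - T 0%N = \sum_(m < n) (T m.+1 - T m).
  by rewrite -(big_mkord predT (fun m => T m.+1 - T m)) telescope_sumr.
apply: eq_bigr => m _.
pose v (j : 'I_n) := if (j < m)%N then at_ w (x + h) j else at_ w x j.
have Tm y : A (fun j => if j == m then y else v j) =
    A (fun j : 'I_n => if (j < m)%N then at_ w (x + h) j else if j == m then y else at_ w x j).
  congr A; apply/funext => j; rewrite /v; case: (eqVneq j m) => [->|//].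
  by rewrite ltnn.
have T0 : T m = A (fun j => if j == m then at_ w x m else v j).
  rewrite Tm; congr A; apply/funext => j; case: ifP => // _.
  by case: (eqVneq j m) => [->|].
have T1 : T m.+1 = A (fun j => if j == m then at_ w (x + h) m else v j).
  rewrite Tm; congr A; apply/funext => j; rewrite ltnS leq_eqVlt -val_eqE /=.
  case: (ltngtP j m) => //= jm.
  by have -> : j = m by exact: val_inj.
rewrite T0 T1; case: ifP => wm; last by rewrite /at_ wm subrr.
have -> : at_ w (x + h) m = 1 *: at_ w x m + h.
  by rewrite /at_ wm scale1r addrAC.
rewrite (Alin v m) scale1r addrAC subrr add0r; congr A.
apply/funext => j; rewrite /at_ /shift /v; case: (eqVneq j m) => //= jm.
by case: (ltnP j m) => //= _; rewrite /at_; case wj : (w j).1 => //=; rewrite ?wj// addrA addrAC.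
Qed.

Let mono_deg_lt d w : (#|vars w| < d)%N -> deg_lt d (mono w).
Proof.
elim: d w => // d IH w wd h; rewrite diff_mono; apply: deg_lt_sum => m.
case wm : (w m).1; last exact: deg_lt0.
by apply: IH; move: wd; rewrite (vars_shift h wm).
Qed.

Definition affine f := linear (fun x => f x - f 0).

Let affine_sum (I : Type) (s : seq I) (G : I -> E -> F) :
  (forall i, affine (G i)) -> affine (fun x => \sum_(i <- s) G i x).
Proof.
move=> H a x y; rewrite -!sumrB scaler_sumr -big_split; apply: eq_bigr => i _.
exact: H.
Qed.

Let affine_cst (c : F) : affine (fun=> c).
Proof. by move=> a x y; rewrite subrr scaler0 addr0. Qed.

Let affine_mono w : (#|vars w| <= 1)%N -> affine (mono w).
Proof.
move=> w1; have [m wm|w0] := pickP (vars w); last first.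
  have -> : mono w = fun=> mono w 0; last exact: affine_cst.
  apply/funext => x; congr A; apply/funext => j; rewrite /at_.
  by have := w0 j; rewrite inE => ->.
have wj j : j != m -> (w j).1 = false.
  move=> jm; apply/negbTE/negP => wj.
  have : (#|pred2 j m| <= #|vars w|)%N.
    by apply: subset_leq_card; apply/fintype.subsetP => i; rewrite !inE => /orP[]/eqP->.
  by rewrite card2 jm => /leq_trans/(_ w1).
have mE x : mono w x = A (fun j => if j == m then x + (w m).2 else (w j).2).
  congr A; apply/funext => j; rewrite /at_; case: (eqVneq j m) => [->|/wj ->//].
  by move: wm; rewrite inE => ->.
move=> a x y.
pose L z := A (fun j => if j == m then z else (w j).2).
have LD z z' : L (z + z') = L z + L z'.
  by have := Alin (fun j => (w j).2) m 1 z z'; rewrite !scale1r.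
have L0 : L 0 = 0.
  by apply/eqP; have /eqP := LD 0 0; rewrite addr0 -subr_eq0 opprD addrA subrr sub0r oppr_eq0.
have LZ b z : L (b *: z) = b *: L z.
  by have := Alin (fun j => (w j).2) m b z 0; rewrite -/(L _) -/(L 0) L0 !addr0.
by rewrite !mE -!/(L _) !LD L0 LZ !add0r !addrK.
Qed.

Let affine_diffs hs w : (#|vars w| <= (size hs).+1)%N -> affine (fdiffs hs (mono w)).
Proof.
elim: hs w => [|h hs IH] w wn; first exact: affine_mono.
rewrite /= -diffs_diff diff_mono.
rewrite (diffs_sum _ (fun (m : 'I_n) x => if (w m).1 then mono (shift w h m) x else 0)).
apply: affine_sum => m; case wm : (w m).1.
  by apply: IH; move: wn; rewrite (vars_shift h wm).
have -> : fdiffs hs (fun=> 0) = fun=> 0; last exact: affine_cst.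
by apply/funext => x; apply: deg_lt_diffs; exact: deg_lt0.
Qed.

Let diffs_diag x w y :
  fdiffs (nseq #|vars w| x) (mono w) y =
  (#|vars w|)`!%:R *: A (fun j => if (w j).1 then x else (w j).2).
Proof.
move e : #|vars w| => r; elim: r w e y => [|r IH] w e y.
  rewrite /= fact0 scale1r; congr A; apply/funext => j; rewrite /at_.
  by have /card0_eq/(_ j) := e; rewrite inE => ->.
rewrite /= -diffs_diff diff_mono.
rewrite (diffs_sum _ (fun (m : 'I_n) y => if (w m).1 then mono (shift w x m) y else 0)).
transitivity (\sum_(m < n | (w m).1) r`!%:R *: A (fun j => if (w j).1 then x else (w j).2)).
  rewrite [RHS]big_mkcond /=; apply: eq_bigr => m _; case wm : (w m).1; last first.
    exact/deg_lt_diffs/deg_lt0.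
  rewrite IH; last by have := vars_shift x wm; rewrite e => -[].
  congr (_ *: A _); apply/funext => j; rewrite /shift; case: (eqVneq j m) => [->|jm] /=.
    by rewrite wm.
  by have [/andP[_ ->]|] := boolP ((j < m)%N && (w j).1).
rewrite sumr_const -scaler_nat scalerA -natrM factS; congr (_%:R *: _).
by rewrite -e; congr (_ * _)%N; apply: eq_card.
Qed.

Lemma multilinear_diag_deg_lt : deg_lt n.+1 (fun x => A (fun=> x)).
Proof.
have -> : (fun x => A (fun=> x)) = mono (fun=> (true, 0)).
  by apply/funext => x; congr A; apply/funext => j; rewrite /at_ addr0.
by apply: mono_deg_lt; rewrite ltnS -[leqRHS]card_ord max_card.
Qed.

(** The symmetric multilinear map of a homogeneous polynomial. It involves finitely many values of f
    only, so it passes to pointwise limits. *)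
Definition polarization f (v : 'I_n -> E) : F :=
  n`!%:R^-1 *: fdiffs [seq v i | i <- enum 'I_n] f 0.

(** The n - 1 differences in the other variables leave an affine map, and the remaining difference
    at 0 takes its linear part. *)
Lemma polarization_multilinear : multilinear_map (polarization (fun x => A (fun=> x))).
Proof.
move=> v i a x y.
have [s1 [s2 [es i1 i2]]] : exists s1 s2, [/\ enum 'I_n = s1 ++ i :: s2, i \notin s1 & i \notin s2].
  have := mem_enum 'I_n i; have := enum_uniq 'I_n; move: (enum 'I_n) => s us.
  rewrite inE => is_; case/splitPr: is_ us => s1 s2; rewrite cat_uniq /= => /and3P[_ + /andP[i2 _]].
  by rewrite negb_or => /andP[i1 _]; exists s1, s2.
pose hs := map v s1 ++ map v s2.
pose P x := A (fun=> x).
have E' z : fdiffs [seq (if j == i then z else v j) | j <- enum 'I_n] P 0 = fdiffs hs P z - fdiffs hs P 0.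
  rewrite es map_cat /= eqxx diffs_cat /= /hs diffs_cat.
  have e1 s : i \notin s -> [seq (if j == i then z else v j) | j <- s] = map v s.
    by move=> is_; apply/eq_in_map => j js; case: eqP => // ji; rewrite -ji js in is_.
  by rewrite !e1// diffs_diff /fdiff add0r.
have aff : affine (fdiffs hs P).
  have -> : P = mono (fun=> (true, 0)).
    by apply/funext => z; congr A; apply/funext => j; rewrite /at_ addr0.
  apply: affine_diffs; rewrite /hs size_cat !size_map.
  have := congr1 size es; rewrite size_enum_ord size_cat /= addnS => <-.
  by rewrite -[leqRHS]card_ord max_card.
rewrite /polarization !E' aff scalerDr !scalerA; congr (_ *: _ + _).
exact: mulrC.
Qed.

Lemma polarization_diag x : polarization (fun x => A (fun=> x)) (fun=> x) = A (fun=> x).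
Proof.
have -> : (fun x => A (fun=> x)) = mono (fun=> (true, 0)).
  by apply/funext => z; congr A; apply/funext => j; rewrite /at_ addr0.
have c : #|vars (fun=> (true, 0))| = n by rewrite -[RHS]card_ord; apply: eq_card.
rewrite /polarization.
have -> : [seq x | _ <- enum 'I_n] = nseq n x.
  rewrite -[in RHS](size_enum_ord n); elim: (enum _) => //= a s -> //.
have := @diffs_diag x (fun=> (true, 0)) 0; rewrite c => ->.
by rewrite scalerA mulVf ?scale1r// pnatr_eq0 -lt0n fact_gt0.
Qed.

End finite_differences.

(** * Polynomials along weakly Cauchy sequences *)

Section null_sequences.
Variable R : realType.
Implicit Types (v w : nat -> R).

Definition null_seqR v := forall e, 0 < e -> exists J, forall n, (J <= n)%N -> `|v n| < e.

Lemma null_seqR_le v w : (forall n, `|v n| <= `|w n|) -> null_seqR w -> null_seqR v.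
Proof.
by move=> vw w0 e /w0[J JP]; exists J => n /JP; exact: le_lt_trans.
Qed.

Lemma null_seqRD v w : null_seqR v -> null_seqR w -> null_seqR (fun n => v n + w n).
Proof.
move=> v0 w0 e e0; have e2 : 0 < e / 2 by rewrite divr_gt0.
have [J JP] := v0 _ e2; have [L LP] := w0 _ e2.
exists (maxn J L) => n; rewrite geq_max => /andP[/JP h1 /LP h2].
by have := ler_normD (v n) (w n); lra.
Qed.

Lemma null_seqR_sub v h : increasing h -> null_seqR v -> null_seqR (v \o h).
Proof.
move=> hi v0 e /v0[J JP]; exists J => n Jn; apply: JP.
exact: leq_trans Jn (increasing_ge n hi).
Qed.

Lemma null_seqR0 : null_seqR (fun=> 0).
Proof. by move=> e e0; exists 0%N => n _; rewrite normr0. Qed.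

Lemma cauchy_seqR_diff v h h' : (forall n, (n <= h n)%N) -> (forall n, (n <= h' n)%N) ->
  cauchy_seqR v -> null_seqR (fun n => v (h n) - v (h' n)).
Proof.
move=> hn h'n vc e /vc[J JP]; exists J => n Jn.
by apply: JP; [exact: leq_trans (hn n)|exact: leq_trans (h'n n)].
Qed.

End null_sequences.

Section weak_sequences.
Variables (R : realType) (k : scalar_kind).
Local Notation K := (scalars R k).

Definition rnorm (E : normedModType K) : realified E -> R := @nrm R k E.

Lemma rnorm_seminorm (E : normedModType K) : seminorm (@rnorm E).
Proof. by split=> [x y|a x]; [exact: nrmD|exact: nrmZR]. Qed.

Variables E F : normedModType K.
Implicit Types (x y : E) (f : E -> F) (u v : nat -> E) (h : nat -> nat).

Definition bounded_sequence u := exists B : R, forall n, nrm (u n) <= B.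

Definition weakly_null u := bounded_sequence u /\
  forall g, bfun (@rnorm E) g -> null_seqR (fun n => g (u n)).

Definition weakly_cauchy u := bounded_sequence u /\
  forall g, bfun (@rnorm E) g -> cauchy_seqR (fun n => g (u n)).

Definition weakly_seq_continuous f := forall y u, weakly_null u ->
  null_seqR (fun n => nrm (f (y + u n) - f y)).

Let weakly_nullD u v : weakly_null u -> weakly_null v ->
  weakly_null (fun n => u n + v n).
Proof.
move=> [[B uB] u0] [[C vC] v0]; split.
  by exists (B + C) => n; rewrite (le_trans (nrmD _ _))// lerD.
move=> g gb; have -> : (fun n => g (u n + v n)) = fun n => g (u n) + g (v n).
  by apply/funext => n; rewrite (bfunD gb).
by apply: null_seqRD; [exact: u0|exact: v0].
Qed.

Let weakly_null_sub u h : increasing h -> weakly_null u -> weakly_null (u \o h).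
Proof.
move=> hi [[B uB] u0]; split; first by exists B => n; exact: uB.
by move=> g gb; exact: (null_seqR_sub hi (u0 g gb)).
Qed.

Let weakly_cauchy_diff u h h' : (forall n, (n <= h n)%N) -> (forall n, (n <= h' n)%N) ->
  weakly_cauchy u -> weakly_null (fun n => u (h n) - u (h' n)).
Proof.
move=> hn h'n [[B uB] uc]; split.
  by exists (B + B) => n; rewrite (le_trans (nrmB _ _))// lerD.
move=> g gb.
have -> : (fun n => g (u (h n) - u (h' n))) = fun n => g (u (h n)) - g (u (h' n)).
  by apply/funext => n; rewrite (bfunB gb).
exact: (cauchy_seqR_diff hn h'n (uc g gb)).
Qed.

(** A difference in a weakly null direction subtracts two quantities with the same limit, which is f
    y when no direction has been taken and 0 afterwards. *)
Let diffs_null f (U : seq (nat -> E)) y v : weakly_seq_continuous f ->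
  (forall i, (i < size U)%N -> weakly_null (nth (fun=> 0) U i)) -> weakly_null v ->
  null_seqR (fun n => nrm (fdiffs [seq u n | u <- U] f (y + v n) - (if U is [::] then f y else 0))).
Proof.
move=> fc; elim: U v => [|u U IH] v U0 v0; first exact: fc.
have u0 : weakly_null u := U0 0%N isT.
have {}U0 i : (i < size U)%N -> weakly_null (nth (fun=> 0) U i) := U0 i.+1.
have := null_seqRD (IH _ U0 (weakly_nullD v0 u0)) (IH _ U0 v0).
apply: null_seqR_le => n; set c := if U is [::] then f y else 0.
rewrite ger0_norm ?nrm_ge0// ger0_norm ?addr_ge0 ?nrm_ge0//.
rewrite subr0 /= /fdiff addrA.
set a := fdiffs _ _ (_ + _ + _); set b := fdiffs _ _ _.
by have := nrmB (a - c) (b - c); rewrite opprB addrA subrK.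
Qed.

(** Downward induction on the number of directions, trivial from d on. If the differences stay large
    at v (kappa l) although they are small at v l, then v (kappa l) - v l is one more weakly null
    direction along which they stay large, against the induction hypothesis. *)
Let diffs_cauchy_null f d (U : seq (nat -> E)) v : deg_lt d f -> weakly_seq_continuous f ->
  (0 < size U)%N -> (forall i, (i < size U)%N -> weakly_null (nth (fun=> 0) U i)) ->
  weakly_cauchy v -> null_seqR (fun n => nrm (fdiffs [seq u n | u <- U] f (v n))).
Proof.
move=> fd fc; have [r] := ubnP (d - size U); elim: r U v => // r IH U v.
rewrite ltnS => rU U1 U0 vc.
have [dU|Ud] := leqP d (size U).
  have fU : deg_lt (size U) f.
    have deg_ltS d' f' : deg_lt d' f' -> deg_lt d'.+1 f'.
      elim: d' f' => [|d' IHd] f' /= H h; last by apply: IHd; exact: H.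
      by move=> x; rewrite /fdiff !H subrr.
    rewrite -(subnK dU); elim: (_ - _)%N => // m; exact: deg_ltS.
  move=> e e0; exists 0%N => n _; rewrite deg_lt_diffs ?size_map//.
  by rewrite nrm0 normr0.
apply: contrapT => /existsNP[e /not_implyP[e0 /forallNP He]].
have e2 : 0 < e / 2 by rewrite divr_gt0.
have zero0 : weakly_null (fun=> 0).
  split; first by exists 0 => n; rewrite nrm0.
  move=> g gb; have -> : (fun n : nat => g 0) = fun=> 0; last exact: null_seqR0.
  by apply/funext => n; exact: (bfun0 gb).
(* At the fixed point v l, [diffs_null] makes the differences small once the directions are far
   enough. *)
have [kappa ki kP] : exists2 kappa, increasing kappa & forall l,
    e <= nrm (fdiffs [seq u (kappa l) | u <- U] f (v (kappa l))) /\
    nrm (fdiffs [seq u (kappa l) | u <- U] f (v l)) < e / 2.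
  apply: (@choose_increasing (fun l n =>
    e <= nrm (fdiffs [seq u n | u <- U] f (v n)) /\
    nrm (fdiffs [seq u n | u <- U] f (v l)) < e / 2)) => l J.
  have [L LP] := diffs_null (v l) fc U0 zero0 e2.
  have /existsNP[n /not_implyP[Jn /negP]] := He (maxn J L).
  move: Jn; rewrite geq_max => /andP[Jn Ln]; rewrite -leNgt ger0_norm ?nrm_ge0// => en.
  exists n => //; split => //; have := LP n Ln; rewrite ger0_norm ?nrm_ge0// addr0.
  by case: (U) U1 => // u U' _; rewrite subr0.
pose w l := v (kappa l) - v l.
have w0 : weakly_null w.
  by apply: (weakly_cauchy_diff (h := kappa) (h' := id)) => // n; exact: increasing_ge.
have [|//||J JP] := IH (w :: [seq u \o kappa | u <- U]) v _ _ _ vc _ e2.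
- by rewrite /= size_map; lia.
- move=> [|i] //=; rewrite size_map ltnS => iU.
  by rewrite (nth_map (fun=> 0))//; apply: weakly_null_sub => //; exact: U0.
have := JP J (leqnn J); have [] := kP J.
rewrite ger0_norm ?nrm_ge0//= -map_comp /fdiff /w subrKC.
set a := fdiffs _ _ _; set b := fdiffs _ _ _ => h1 h2 h3.
have := nrmD (a - b) b; rewrite subrK; lra.
Qed.

(** f (v m) - f (v n) is the difference of f at v n in the direction v m - v n, which is weakly null
    along any bad pairs (m, n). *)
Lemma weakly_cauchy_image f d v : deg_lt d f -> weakly_seq_continuous f ->
  weakly_cauchy v -> forall e : R, 0 < e -> exists J, forall m n, (J <= m)%N -> (J <= n)%N ->
    nrm (f (v m) - f (v n)) < e.
Proof.
move=> fd fc vc e e0; apply: contrapT => /forallNP H.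
have /choice[mn mnP] J : exists mn : nat * nat, [/\ (J <= mn.1)%N, (J <= mn.2)%N &
    e <= nrm (f (v mn.1) - f (v mn.2))].
  have /existsNP[m /existsNP[n /not_implyP[Jm /not_implyP[Jn /negP]]]] := H J.
  by rewrite -leNgt => h; exists (m, n).
pose u j := v (mn j).1 - v (mn j).2.
have u0 : weakly_null u.
  by apply: (weakly_cauchy_diff (h := fun j => (mn j).1) (h' := fun j => (mn j).2)) => // j;
    have [] := mnP j.
have wc : weakly_cauchy (fun j => v (mn j).2).
  case: vc => [[B vB] vc]; split; first by exists B.
  move=> g gb e' /(vc g gb)[J JP]; exists J => m n Jm Jn; apply: JP.
    by have [_ h _] := mnP m; exact: leq_trans h.
  by have [_ h _] := mnP n; exact: leq_trans h.
have U0 i : (i < size [:: u])%N -> weakly_null (nth (fun=> 0) [:: u] i) by case: i.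
have [J JP] := diffs_cauchy_null fd fc (U := [:: u]) isT U0 wc e0.
have := JP J (leqnn J); rewrite ger0_norm ?nrm_ge0//= /fdiff /u subrKC.
by have [_ _] := mnP J; lra.
Qed.

End weak_sequences.

(** * Continuity and pointwise limits of polynomials *)

Section polynomial_limits.
Variables (R : realType) (k : scalar_kind).
Local Notation K := (scalars R k).
Variables E F : normedModType K.
Implicit Types (x y h : E) (f P : E -> F).

Lemma homogeneous_deg_lt n P : homogeneous_polynomial n P -> deg_lt n.+1 P.
Proof.
move=> [A [Al PA]]; have -> : P = fun x => A (fun=> x) by apply/funext.
exact: multilinear_diag_deg_lt.
Qed.

Lemma homogeneous_bound n P (C r : R) x : homogeneous_polynomial n P ->
  (forall y, nrm y <= 1 -> nrm (P y) <= C) -> 0 < r -> nrm x <= r ->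
  nrm (P x) <= r ^+ n * C.
Proof.
move=> Ph PC r0 xr.
have -> : x = ofR k r *: (ofR k r^-1 *: x).
  by rewrite scalerA -ofRM divff ?gt_eqF// ofR1 scale1r.
rewrite (homogeneous_polynomialZ _ _ Ph) nrmZ nrmX nrm_ofR gtr0_norm//.
rewrite ler_pM2l ?exprn_gt0//; apply: PC.
by rewrite nrmZR gtr0_norm ?invr_gt0// ler_pdivrMl// mulr1.
Qed.

(** The sum of N successive differences in the direction h is f (x + N h) - f x, at most 2 M. By
    induction all of them are within e / 2 of the first one, which is therefore at most 2 M / N + e
    / 2. The modulus is uniform in f because the induction applies it to differences of f. *)
Let deg_lt_modulus d : forall r M e : R, 0 < e -> exists2 delta : R, 0 < delta &
  forall f, deg_lt d f -> (forall x, nrm x <= r + d%:R -> nrm (f x) <= M) ->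
    forall x h, nrm x <= r -> nrm h < delta -> nrm (f (x + h) - f x) <= e.
Proof.
elim: d => [|d IH] r M e e0.
  by exists 1 => // f f0 _ x h _ _; rewrite !f0 subrr nrm0 ltW.
have e2 : 0 < e / 2 by rewrite divr_gt0.
pose N := (Num.truncn (4 * `|M| / e)).+1.
have NP : 4 * `|M| / e < N%:R by exact: truncnS_gt.
have N0 : 0 < N%:R :> R by rewrite ltr0n.
have [delta d0 dP] := IH r (M + M) (e / 2) e2.
exists (Num.min 1 delta / N%:R); first by rewrite divr_gt0// lt_min ltr01.
move=> f fd fM x h xr; rewrite ltr_pdivlMr// lt_min => /andP[hN1 hNd].
have kh (i : nat) : (i <= N)%N -> nrm (ofR k i%:R *: h) <= nrm h * N%:R.
  move=> iN; rewrite nrmZR ger0_norm// mulrC ler_wpM2l ?nrm_ge0//.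
  by rewrite ler_nat.
have h1 : nrm h <= 1.
  by apply: le_trans (ltW hN1); rewrite ler_peMr ?nrm_ge0// ler1n.
have fhd : deg_lt d (fdiff h f) := fd h.
have fhM y : nrm y <= r + d%:R -> nrm (fdiff h f y) <= M + M.
  move=> yr; rewrite (le_trans (nrmB _ _))// lerD// fM// -natr1; last by lra.
  by rewrite (le_trans (nrmD _ _))//; lra.
have step i : (i <= N)%N -> nrm (fdiff h f (x + ofR k i%:R *: h) - fdiff h f x) <= e / 2.
  by move=> iN; apply: dP => //; exact: le_lt_trans (kh i iN) hNd.
have tel : f (x + ofR k N%:R *: h) - f x = \sum_(i < N) fdiff h f (x + ofR k i%:R *: h).
  pose T (i : nat) := f (x + ofR k i%:R *: h).
  transitivity (T N - T 0%N); first by rewrite /T ofR0 scale0r addr0.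
  rewrite -(telescope_sumr T (leq0n N)) big_mkord; apply: eq_bigr => i _.
  by rewrite /T /fdiff -natr1 ofRD ofR1 scalerDl scale1r addrA.
have r0 : 0 <= r := le_trans (nrm_ge0 x) xr.
have dd : 0 <= d%:R :> R by [].
have b1 : nrm (f (x + ofR k N%:R *: h) - f x) <= M + M.
  rewrite (le_trans (nrmB _ _))// lerD// fM// -natr1; last by lra.
  rewrite (le_trans (nrmD _ _))//; have := kh N (leqnn N); lra.
have b2 : N%:R * nrm (fdiff h f x) <= M + M + N%:R * (e / 2).
  have -> : N%:R * nrm (fdiff h f x) = nrm (\sum_(i < N) fdiff h f x).
    rewrite sumr_const card_ord.
    have -> : fdiff h f x *+ N = ofR k N%:R *: fdiff h f x by rewrite ofR_nat scaler_nat.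
    by rewrite nrmZR ger0_norm.
  have -> : \sum_(i < N) fdiff h f x = (f (x + ofR k N%:R *: h) - f x) -
     \sum_(i < N) (fdiff h f (x + ofR k i%:R *: h) - fdiff h f x).
    by rewrite [X in _ - X]sumrB tel opprB subrKC.
  apply: (le_trans (nrmB _ _)); apply: lerD => //.
  apply: (le_trans (nrm_sum _ _ _)).
  rewrite mulr_natl -[X in _ *+ X]card_ord -sumr_const.
  by apply: ler_sum => i _; apply: step; exact: ltnW.
have M4 : 4 * `|M| < N%:R * e by rewrite -ltr_pdivrMr.
have := ler_norm M; have := normr_ge0 M; rewrite -/(fdiff h f x) => hM0 hM.
have : N%:R * nrm (fdiff h f x) <= N%:R * e by lra.
by rewrite ler_pM2l.
Qed.

Lemma bounded_deg_lt_continuous d f : deg_lt d f ->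
  (forall r : R, exists M : R, forall x, nrm x <= r -> nrm (f x) <= M) -> continuous f.
Proof.
move=> fd fb x; apply/cvgrPdist_lt => e e0.
have e1 : 0 < reK e by rewrite -(@ofR_lt _ k) ofR0 -ge0_ofR// ltW.
have [M MP] := fb (nrm x + d%:R).
have e2 : 0 < reK e / 2 by rewrite divr_gt0.
have [delta d0 dP] := deg_lt_modulus d (nrm x) M e2.
apply/nbhs_normP; exists (ofR k delta); first by rewrite /= -ofR0 ofR_lt.
move=> y /=; rewrite nrmE ofR_lt nrm_distC => xy.
rewrite [e]ge0_ofR ?ltW// nrmE ofR_lt nrm_distC.
by have := dP f fd MP x (y - x) (lexx _) xy; rewrite subrKC; lra.
Qed.

Lemma cvg_diffs (Q : nat -> E -> F) f hs y :
  (forall x, (fun m => Q m x) @ \oo --> f x) ->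
  (fun m => fdiffs hs (Q m) y) @ \oo --> fdiffs hs f y.
Proof. by move=> Qf; elim: hs y => //= h hs IH y; apply: cvgB; exact: IH. Qed.

(** The polarizations converge with the polynomials, which makes the limit homogeneous; the common
    bound on the unit ball makes it bounded, hence continuous. *)
Lemma cont_hompoly_limit n (Q : nat -> contPoly n E F) f (C : R) :
  (forall x, (fun m => Q m x) @ \oo --> f x) ->
  (forall m x, nrm x <= 1 -> nrm (Q m x) <= C) -> f \in @cont_hompoly K n E F.
Proof.
move=> Qf QC; apply/asboolP.
have cpol v : (fun m => @polarization K E F n (Q m) v) @ \oo --> @polarization K E F n f v.
  by apply: cvgZl_tmp; exact: cvg_diffs.
have hf : homogeneous_polynomial n f.
  exists (@polarization K E F n f); split => [v i a x y|x].
    have h z := cpol (fun j => if j == i then z else v j).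
    apply: (cvg_unique (@norm_hausdorff _ F) (h (a *: x + y))).
    have -> : (fun m => @polarization K E F n (Q m) (fun j => if j == i then a *: x + y else v j)) =
        (fun m => a *: @polarization K E F n (Q m) (fun j => if j == i then x else v j) +
                  @polarization K E F n (Q m) (fun j => if j == i then y else v j)).
      apply/funext => m; have [A [Al QA]] := contPoly_hom (Q m).
      have -> : (Q m : E -> F) = fun x => A (fun=> x) by apply/funext.
      exact: (polarization_multilinear Al).
    exact: (cvgD (cvgZl_tmp (k := a) (h x)) (h y)).
  apply: (cvg_unique (@norm_hausdorff _ F) (Qf x)).
  have -> : (fun m => Q m x) = (fun m => @polarization K E F n (Q m) (fun=> x)).
    apply/funext => m; have [A [Al QA]] := contPoly_hom (Q m).
    have -> : (Q m : E -> F) = fun x => A (fun=> x) by apply/funext.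
    by rewrite polarization_diag.
  exact: cpol.
split => //; apply: bounded_deg_lt_continuous (homogeneous_deg_lt hf) _ => r.
exists ((`|r| + 1) ^+ n * C) => x xr.
apply: (homogeneous_bound hf); [|have := normr_ge0 r; lra|have := ler_norm r; lra].
move=> y y1; apply/ler_addgt0Pr => e e0.
have /cvg_nrm_nat/(_ e e0)[J /(_ J (leqnn J)) JP] := Qf y.
have := QC J y y1; have := nrmD (f y - Q J y) (Q J y); rewrite subrK nrm_distC; lra.
Qed.

End polynomial_limits.

(** * Functionals and the weak topology *)

Section weak_neighborhoods.
Variables (R : realType) (k : scalar_kind).
Local Notation K := (scalars R k).
Variable E : normedModType K.
Implicit Types (x y u : E) (g : realified E -> R).
Local Notation bf := (bfun (@rnorm R k E)).

Lemma nrm_split (z : K^o) : nrm z <= `|reK z| + `|reK (iK R k * z)|.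
Proof.
rewrite {1}(reK_split z); apply: le_trans (nrmB _ _) _.
rewrite nrm_ofR lerD2l.
have := nrmZ (iK R k) (ofR k (reK (iK R k * z)) : K^o); rewrite nrm_ofR => ->.
by rewrite ler_piMl// nrm_iK.
Qed.

Lemma continuous_linear_bound (V W : normedModType K) (L : {linear V -> W}) :
  continuous L -> exists2 C : R, 0 < C & forall x : V, nrm (L x) <= C * nrm x.
Proof.
move=> /(_ 0) /cvgrPdist_lt /(_ 1 ltr01) /nbhs_normP[e /= e0 eP].
have r0 : 0 < reK e by rewrite -(@ofR_lt _ k) ofR0 -ge0_ofR// ltW.
exists (2 / reK e); first by rewrite divr_gt0.
move=> x; have [->|x0] := eqVneq x 0; first by rewrite linear0 !nrm0 mulr0.
have nx : 0 < nrm x.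
  by rewrite lt_neqAle nrm_ge0 andbT eq_sym; apply: contraNneq x0 => /nrm_eq0 ->.
pose t := reK e / (2 * nrm x).
have t0 : 0 < t by rewrite divr_gt0// mulr_gt0.
have tx : t * nrm x = reK e / 2.
  by rewrite /t; field; rewrite gt_eqF.
have eP' z : nrm z < reK e -> nrm (L z) < 1.
  move=> ze; have := eP z; rewrite /= sub0r normrN linear0 sub0r normrN => H.
  by rewrite -(@ofR_lt _ k) ofR1 -nrmE; apply: H; rewrite nrmE [e]ge0_ofR ?ltW// ofR_lt.
have := eP' (ofR k t *: x); rewrite linearZ /= !nrmZR gtr0_norm// tx => /(_ _)/wrap[|h].
  lra.
have -> : 2 / reK e * nrm x = t^-1.
  by rewrite /t; field; rewrite !gt_eqF.
by apply: ltW; rewrite -[ltRHS]mulr1 ltr_pdivlMl.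
Qed.

Lemma dual_bounded (phi : dual E) : exists2 C : R, 0 < C &
  forall x, nrm (sval phi x) <= C * nrm x.
Proof. by case: phi => phi phic; exact: continuous_linear_bound. Qed.

(** The usual complexification phi x = g x - i g (i x); over the reals, where [iK] is 0, it is g. *)
Lemma dual_of_bfun g : bf g -> exists phi : dual E,
  (forall x, reK (sval phi x) = g x) /\
  (forall x, nrm (sval phi x) <= `|g x| + `|g (iK R k *: (x : E))|).
Proof.
move=> gb; pose i := iK R k.
pose z (x : E) : K^o := ofR k (g x) - i * ofR k (g (i *: x)).
have gD (x y : E) : g (x + y) = g x + g y := bfunD gb x y.
have gZ a (x : E) : g (ofR k a *: x) = a * g x := bfunZ gb a x.
have gN (x : E) : g (- x) = - g x := bfunN gb x.
have zlin : linear z.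
  move=> c x y; rewrite /z scalerDr !gD !ofRD mulrDr opprD addrACA; congr (_ + _).
  set a := reK c; set b := reK (i * c).
  have cE : c = ofR k a - i * ofR k b := reK_split c.
  have cx (w : E) : g (c *: w) = a * g w - b * g (i *: w).
    have -> : c *: w = ofR k a *: w - ofR k b *: (i *: w).
      by rewrite [in LHS]cE scalerBl mulrC -scalerA.
    by rewrite gD gN !gZ.
  (* One identity for both kinds of scalars, with X, Y, Z the values of g at w, i w and i i w. *)
  have key (j A B X Y Z : K) : (j = 0 /\ Y = 0) \/ (j * j = -1 /\ Z = - X) ->
      (A * X - B * Y) - j * (A * Y - B * Z) = (A - j * B) * (X - j * Y).
    case=> [[-> ->]|[jj ->]]; first by ring.
    transitivity (A * X - j * (A * Y) - j * (B * X) + (j * j) * (B * Y)); last by ring.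
    by rewrite jj; ring.
  have -> : i *: (c *: x) = c *: (i *: x) by rewrite !scalerA mulrC.
  rewrite !cx !(ofRD, ofRN, ofRM) key ?cE//.
  have [[_ i0]|i2] := iK_sq R k; [left|right]; split => //.
    by rewrite /i i0 scale0r (bfun0 gb) ofR0.
  by rewrite scalerA i2 scaleN1r gN ofRN.
pose L : {linear E -> K^o} := HB.pack z (GRing.isLinear.Build K E K^o *:%R z zlin).
have zn x : nrm (z x) <= `|g x| + `|g (i *: x)|.
  apply: le_trans (nrmB _ _) _; rewrite nrm_ofR lerD2l.
  have := nrmZ i (ofR k (g (i *: x)) : K^o); rewrite nrm_ofR => ->.
  by rewrite ler_piMl// nrm_iK.
have zb x : nrm (z x) <= 2 * nrm x.
  apply: le_trans (zn x) _; have := bfun_norm (@rnorm_seminorm R k E) gb x.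
  have := bfun_norm (@rnorm_seminorm R k E) gb (i *: x).
  rewrite /rnorm nrmZ; have := nrm_iK R k; have := nrm_ge0 x; rewrite -/i.
  have := nrm_ge0 (i : K^o); nra.
have Lc : continuous L.
  move=> x; apply/cvgrPdist_lt => e e0.
  have r0 : 0 < reK e by rewrite -(@ofR_lt _ k) ofR0 -ge0_ofR// ltW.
  apply/nbhs_normP; exists (ofR k (reK e / 2)).
    by rewrite /= -(@ofR0 R k) ofR_lt divr_gt0.
  move=> y /=; have -> : z x - z y = z (x - y) by exact: (esym (linearB L x y)).
  rewrite [e]ge0_ofR ?ltW// !nrmE !ofR_lt ofRK => h.
  by apply: le_lt_trans (zb _) _; lra.
exists (exist _ L Lc); split => //= x.
have reiK a : reK (i * ofR k a) = 0.
  rewrite mulrC reKM /i /reK /iK; case: (k) => /=; by rewrite mulr0.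
by rewrite /z reKD reKN reiK subr0 ofRK.
Qed.

Definition weak_basic (y : E) : set_system E := [set A |
  exists m (G : nat -> realified E -> R) (e : R), [/\ 0 < e, (forall i, bf (G i)) &
    forall u, (forall i, (i < m)%N -> `|G i (u - y)| < e) -> A u]].

Lemma weak_basic_filter y : Filter (weak_basic y).
Proof.
split.
- exists 0%N, (fun _ _ => 0), 1; split => // _.
  exact: bfun_cst0 (@rnorm_seminorm R k E).
- move=> A B [m [G [e [e0 Gb GA]]]] [m' [G' [e' [e'0 G'b G'B]]]].
  exists (m + m')%N, (fun i => if (i < m)%N then G i else G' (i - m)%N), (Num.min e e').
  split; first by rewrite lt_min e0.
    by move=> i; case: ifP.
  move=> u H; split.
    apply: GA => i im; have := H i (ltn_addr _ im); rewrite im lt_min.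
    by case/andP.
  apply: G'B => i im; have := H (m + i)%N; rewrite ltn_add2l im => /(_ isT).
  by rewrite ltnNge leq_addr /= addKn lt_min => /andP[].
- move=> A B AB [m [G [e [e0 Gb GA]]]]; exists m, G, e; split => // u /GA.
  exact: AB.
Qed.

(** Convergence in a supremum topology is tested on one functional phi at a time, and phi is
    controlled by the real parts of phi and of i phi, divided by its bound M to lie in the dual
    ball. *)
Lemma weak_basic_cvg (y : E) : nbhs (y : weak E) `<=` weak_basic y.
Proof.
have FF := weak_basic_filter y.
apply/(@cvg_sup _ _ _ (weak_basic y) y FF) => phi A.
rewrite nbhsE => -[B [[C oC <-] Cy] BA].
have /nbhs_normP[e /= e0 eC] : nbhs (sval phi y) C by exact: open_nbhs_nbhs.
have [M M0 MP] := dual_bounded phi.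
have r0 : 0 < reK e by rewrite -(@ofR_lt _ k) ofR0 -ge0_ofR// ltW.
have reKZ a (x : E) : reK (sval phi (ofR k a *: x)) = a * reK (sval phi x).
  by rewrite linearZ; exact: reKM.
pose g1 (x : realified E) := M^-1 * reK (sval phi x).
pose g2 (x : realified E) := M^-1 * reK (sval phi (iK R k *: (x : E))).
have g1b : bf g1.
  split=> [a x x'|x].
    have -> : g1 (a *: x + x') = M^-1 * reK (sval phi (ofR k a *: (x : E) + x')) by [].
    by rewrite linearD reKD reKZ mulrDr mulrCA.
  rewrite /g1 ler_pdivrMl//; apply: le_trans (ler_norm _) _.
  exact: le_trans (reK_norm _) (MP _).
have g2b : bf g2.
  split=> [a x x'|x].
    have -> : g2 (a *: x + x') = M^-1 * reK (sval phi (ofR k a *: (iK R k *: (x : E)) + iK R k *: (x' : E))).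
      congr (_ * reK (sval phi _)); rewrite scalerA mulrC -scalerA -scalerDr.
      by [].
    by rewrite linearD reKD reKZ mulrDr mulrCA.
  rewrite /g2 ler_pdivrMl//; apply: le_trans (ler_norm _) _.
  apply: le_trans (reK_norm _) _; apply: le_trans (MP _) _.
  rewrite ler_pM2l// nrmZ ler_piMl ?nrm_ge0//; exact: nrm_iK.
exists 2%N, (fun i => if i is 0%N then g1 else g2), (reK e / (2 * M)); split.
- by rewrite divr_gt0// mulr_gt0.
- by case.
move=> u H; apply: BA; apply: eC => /=.
rewrite distrC -linearB /= [e]ge0_ofR ?ltW// nrmE ofR_lt.
apply: le_lt_trans (nrm_split _) _.
have -> : iK R k * sval phi (u - y) = sval phi (iK R k *: (u - y)) by rewrite linearZ.
have := H 0%N isT; have := H 1%N isT; rewrite /g1 /g2 !normrM.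
have -> : `|M^-1| = M^-1 by rewrite gtr0_norm ?invr_gt0.
rewrite !ltr_pdivrMl//.
have -> : M * (reK e / (2 * M)) = reK e / 2 by field; rewrite gt_eqF.
lra.
Qed.

Lemma weakly_continuous_near (F : normedModType K) (f : E -> F) (y : E) (r eta : R) :
  weakly_continuous_on_bounded f -> nrm y <= r -> 0 < eta ->
  exists m (G : nat -> realified E -> R) (e : R), [/\ 0 < e, (forall i, bf (G i)) &
    forall u, nrm u <= r -> (forall i, (i < m)%N -> `|G i (u - y)| < e) ->
      nrm (f u - f y) < eta].
Proof.
move=> fw yr eta0.
have Bb : bounded_set [set u : E | nrm u <= r].
  have PF := @globally_properfilter _ [set u : E | nrm u <= r] y yr.
  by apply/(ex_bound idfun); exists (ofR k r) => u /=; rewrite nrm_le.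
have /subspace_continuousP/(_ y yr) := fw _ Bb.
move=> /cvgrPdist_lt/(_ (ofR k eta)); rewrite -{1}(@ofR0 R k) ofR_lt => /(_ eta0).
move=> /weak_basic_cvg[m [G [e [e0 Gb GP]]]]; exists m, G, e; split => // u ur /GP.
by move=> /(_ ur); rewrite nrmE ofR_lt nrm_distC.
Qed.

Lemma dual_weakly_continuous (phi : dual E) :
  continuous (sval phi : weak E -> K^o).
Proof.
move=> y A yA.
have yA' := @initial_continuous E K^o (sval phi : E -> K^o) y A yA.
have FF : Filter (nbhs (y : weak E)) := nbhs_filter (y : weak E).
by have /(@cvg_sup _ _ _ (nbhs (y : weak E)) y FF)/(_ phi) := @cvg_id _ (nbhs (y : weak E)); apply.
Qed.

Variable F : normedModType K.

Lemma dual_monomial (phi : dual E) n (w : F) : exists P : contPoly n E F,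
  weak_contPoly n E F P /\ forall x, P x = (sval phi x : K) ^+ n *: w.
Proof.
have cc (T : topologicalType) (z : T -> K^o) : continuous z ->
    continuous (fun t : T => (z t : K) ^+ n *: w).
  move=> zc t; apply: cvgZr_tmp; elim: n => [|m IH].
    by under eq_fun do rewrite expr0; exact: cvg_cst.
  by under eq_fun do rewrite exprS; rewrite exprS; apply: cvgM => //; exact: zc.
have Pin : (fun x => (sval phi x : K) ^+ n *: w) \in @cont_hompoly K n E F.
  apply/asboolP; split; last by apply: (cc E); exact: svalP phi.
  exists (fun v => (\prod_i (sval phi (v i) : K)) *: w); split; last first.
    by move=> x; rewrite prodr_const card_ord.
  move=> v i a x y.
  have pE z : \prod_j (sval phi (if j == i then z else v j) : K) =
      sval phi z * \prod_(j < n | j != i) (sval phi (v j) : K).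
    rewrite (bigD1 i)//= eqxx; congr (_ * _); apply: eq_bigr => j ji.
    by rewrite (negPf ji).
  by rewrite !pE linearD linearZ /= mulrDl scalerDl -[_ *: _ * _]mulrA scalerA.
exists (ContPoly Pin); split => // B _.
apply: continuous_subspaceT; exact: (cc (weak E) _ (@dual_weakly_continuous phi)).
Qed.

End weak_neighborhoods.

(** * Projections and pointwise summable polynomials *)

Definition cauchy_nrm (R : realType) (k : scalar_kind) (F : normedModType (scalars R k))
    (v : nat -> F) := forall e : R, 0 < e ->
  exists J, forall m l, (J <= m)%N -> (J <= l)%N -> nrm (v m - v l) < e.

Section summable_polynomials.
Variables (R : realType) (k : scalar_kind).
Local Notation K := (scalars R k).
Variables (E : normedModType K) (F : completeNormedModType K) (n : nat).
Local Notation X := (contPoly n E F).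
Implicit Types (x : E) (P Q : X) (xi : nat -> R).

Lemma contPoly_sumE (I : Type) (s : seq I) (c : I -> K) (P : I -> X) x :
  (\sum_(i <- s) c i *: P i : X) x = \sum_(i <- s) c i *: P i x.
Proof.
elim: s => [|i s IH]; first by rewrite !big_nil.
by rewrite !big_cons -IH.
Qed.

Let unit_ball_nonempty : [set x : E | `|x| <= 1] !=set0.
Proof. by exists 0; rewrite /= normr0. Qed.

Lemma nrm_contPoly P x : nrm x <= 1 -> nrm (P x) <= nrm P.
Proof.
rewrite -(@ofR_le _ k) -(@ofR_le _ k) -!nrmE ofR1 => x1.
exact: (supnorm_ge (A := [set x : E | `|x| <= 1]) unit_ball_nonempty (contPoly_bounded P)).
Qed.

Lemma nrm_contPoly_le P (C : R) : (forall x, nrm x <= 1 -> nrm (P x) <= C) -> nrm P <= C.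
Proof.
move=> PC; rewrite -(@ofR_le _ k) -nrmE.
apply: (supnorm_le (A := [set x : E | `|x| <= 1]) unit_ball_nonempty (contPoly_bounded P)).
by move=> x /= x1; rewrite nrmE ofR_le; apply: PC; rewrite -(@ofR_le _ k) -nrmE ofR1.
Qed.

Lemma nrm_contPoly_bound P x : nrm (P x) <= (nrm x + 1) ^+ n * nrm P.
Proof.
apply: (homogeneous_bound (contPoly_hom P) (@nrm_contPoly P)).
  by have := nrm_ge0 x; lra.
by rewrite lerDl.
Qed.

Definition pointwise_summable (P : nat -> X) (C : R) :=
  (forall xi m x, (forall i, `|xi i| <= 1) -> nrm x <= 1 ->
     nrm (\sum_(i < m) ofR k (xi i) *: P i x) <= C) /\
  (forall xi x, bounded_seqR xi ->
     cauchy_nrm (fun m => \sum_(i < m) ofR k (xi i) *: P i x)).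

Definition bounded_projection (p : {linear X -> X}) :=
  [/\ exists M : R, forall Q, nrm (p Q) <= M * nrm Q,
      forall Q, p (p Q) = p Q &
      range p = @weak_contPoly K n E F].

Variables (P : nat -> X) (C : R) (p : {linear X -> X}).
Hypotheses (Psum : pointwise_summable P C) (Pw : forall i, weak_contPoly n E F (P i))
  (pp : bounded_projection p).

Let psum xi m : X := \sum_(i < m) ofR k (xi i) *: P i.

(** Boundedness is placed after the existential, so that choice yields an operator defined on all
    sequences. *)
Let sum_exists xi : exists Q : X, bounded_seqR xi ->
  forall x, (fun m => psum xi m x) @ \oo --> Q x.
Proof.
have [bxi|] := pselect (bounded_seqR xi); last by exists 0.
have /choice[f fP] x : exists y : F, (fun m => psum xi m x) @ \oo --> y.
  apply: complete_nrm => e e0; have [J JP] := Psum.2 xi x bxi e e0.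
  by exists J => m l Jm Jl; rewrite !contPoly_sumE; exact: JP.
have [B BP] := bxi.
suff Qin : f \in @cont_hompoly K n E F by exists (ContPoly Qin).
apply: (@cont_hompoly_limit _ _ _ _ _ (psum xi) f ((`|B| + 1) * C)) => // m x x1.
have B0 : 0 < `|B| + 1 by have := normr_ge0 B; lra.
have h i : `|xi i / (`|B| + 1)| <= 1.
  rewrite normrM (gtr0_norm (_ : 0 < (`|B| + 1)^-1)) ?invr_gt0// ler_pdivrMr// mul1r.
  by have := BP i; have := ler_norm B; lra.
have := Psum.1 (fun i => xi i / (`|B| + 1)) m x h x1.
have -> : \sum_(i < m) ofR k (xi i / (`|B| + 1)) *: P i x = ofR k (`|B| + 1)^-1 *: psum xi m x.
  rewrite contPoly_sumE scaler_sumr; apply: eq_bigr => i _.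
  by rewrite scalerA -ofRM mulrC.
have Bi : `|(`|B| + 1)^-1| = (`|B| + 1)^-1 by rewrite gtr0_norm ?invr_gt0.
by rewrite nrmZR Bi ler_pdivrMl.
Qed.

(** Let S send a bounded sequence to the sum it weights. The functionals f t ((p (S xi) - S xi) (y
    t)) vanish on finitely supported xi, since p fixes every P i. There are countably many of them,
    so one infinite M works for all. *)
Lemma projection_agrees (T : countType) (f : T -> realified F -> R) (y : T -> E) :
  (forall t, bfun (@rnorm R k F) (f t)) ->
  exists (M : nat -> bool) (G : X) (g : E -> F),
    [/\ forall J, exists2 i, (J <= i)%N & M i, weak_contPoly n E F G,
        forall x, (fun m => \sum_(i < m) ofR k (M i)%:R *: P i x) @ \oo --> g x &
        forall t, f t (G (y t)) = f t (g (y t))].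
Proof.
move=> fb; have [[M0 pM] p2 prange] := pp.
have pP i : p (P i) = P i.
  have [Q _ <-] : range p (P i) by rewrite prange; exact: Pw.
  exact: p2.
have [S SP] := choice sum_exists.
have Suniq xi Q : bounded_seqR xi -> (forall x, (fun m => psum xi m x) @ \oo --> Q x) -> S xi = Q.
  move=> bxi QP; apply/val_inj/funext => x.
  exact: (cvg_unique (@norm_hausdorff _ F) (SP xi bxi x) (QP x)).
have SD a xi eta : bounded_seqR xi -> bounded_seqR eta ->
    S (fun i => a * xi i + eta i) = ofR k a *: S xi + S eta.
  move=> bxi beta; apply: Suniq; first exact: bounded_seqR_comb.
  move=> x; have -> : (fun m => psum (fun i => a * xi i + eta i) m x) =
      (fun m => ofR k a *: psum xi m x + psum eta m x).
    apply/funext => m; rewrite !contPoly_sumE scaler_sumr -big_split.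
    by apply: eq_bigr => i _; rewrite scalerA /= ofRD ofRM scalerDl.
  exact: (cvgD (cvgZl_tmp (k := ofR k a) (SP xi bxi x)) (SP eta beta x)).
have S1 xi : (forall i, `|xi i| <= 1) -> nrm (S xi) <= C.
  move=> xi1; have bxi : bounded_seqR xi by exists 1.
  apply: nrm_contPoly_le => x x1; apply/ler_addgt0Pr => e e0.
  have /cvg_nrm_nat/(_ e e0)[J /(_ J (leqnn J)) JP] := SP xi bxi x.
  have := Psum.1 xi J x xi1 x1; rewrite -contPoly_sumE -/(psum xi J) => h.
  have := nrmD (S xi x - psum xi J x) (psum xi J x); rewrite subrK nrm_distC; lra.
have Sfin xi J : (forall i, (J <= i)%N -> xi i = 0) -> p (S xi) = S xi.
  move=> xi0; have -> : S xi = psum xi J.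
    apply: Suniq.
      exists (\sum_(i < J) `|xi i|) => i; case: (ltnP i J) => iJ.
        by rewrite (bigD1 (Ordinal iJ))//= lerDl sumr_ge0.
      by rewrite xi0// normr0 sumr_ge0.
    move=> x; apply/cvg_nrm_nat => e e0; exists J => m Jm.
    suff -> : psum xi m = psum xi J by rewrite subrr nrm0.
    rewrite /psum -!(big_mkord predT (fun i => ofR k (xi i) *: P i)).
    rewrite (big_cat_nat (leq0n J) Jm)//= [X in _ + X](_ : _ = 0) ?addr0//.
    rewrite big_nat_cond big1//.
    by move=> i /andP[/andP[Ji _] _]; rewrite xi0// ofR0 scale0r.
  rewrite linear_sum; apply: eq_bigr => i _.
  by rewrite linearZ /= pP.
pose L t xi := f t (p (S xi) (y t)) - f t (S xi (y t)).
pose Ln i xi := if unpickle i is Some t then L t xi else 0.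
have [|||M [Minf ML]] := @vanishing_indicator R Ln.
- move=> i a xi eta bxi beta; rewrite /Ln; case: unpickle => [t|]; last by rewrite mulr0 addr0.
  rewrite /L SD// linearD linearZ /=.
  have fD a' (u v : F) : f t (ofR k a' *: u + v) = a' * f t u + f t v := (fb t).1 a' u v.
  rewrite (fD a (p (S xi) (y t)) (p (S eta) (y t))) (fD a (S xi (y t)) (S eta (y t))).
  ring.
- move=> i; rewrite /Ln; case: unpickle => [t|]; last first.
    by exists 0 => xi _; rewrite normr0.
  pose b := (nrm (y t) + 1) ^+ n.
  have b0 : 0 <= b by rewrite exprn_ge0// addr_ge0// nrm_ge0.
  exists (b * (`|M0| * C) + b * C) => xi xi1.
  apply: le_trans (ler_normB _ _) _; apply: lerD.
    apply: le_trans (bfun_norm (@rnorm_seminorm R k F) (fb t) _) _.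
    apply: le_trans (nrm_contPoly_bound _ _) _; rewrite ler_wpM2l//.
    apply: le_trans (pM _) _.
    have := S1 xi xi1; have := nrm_ge0 (S xi); have := ler_norm M0; have := normr_ge0 M0; nra.
  apply: le_trans (bfun_norm (@rnorm_seminorm R k F) (fb t) _) _.
  apply: le_trans (nrm_contPoly_bound _ _) _; rewrite ler_wpM2l//; exact: S1.
- move=> i xi J xi0; rewrite /Ln; case: unpickle => // t.
  by rewrite /L (Sfin xi J xi0) subrr.
pose chi i : R := (M i)%:R.
have bchi : bounded_seqR chi by exact: bounded_seqR_nat.
exists M, (p (S chi)), (S chi); split => //.
- by rewrite -prange; exists (S chi).
- move=> x; have := SP chi bchi x.
  by under eq_fun do rewrite contPoly_sumE.
move=> t; apply/eqP; rewrite -subr_eq0; apply/eqP.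
by have := ML (pickle t); rewrite /Ln pickleK.
Qed.

End summable_polynomials.

(** * Real series and almost diagonal matrices *)

Section real_series.
Variable R : realType.
Implicit Types (v : nat -> R).

Lemma bounded_sum_cauchy v (B : R) : (forall i, 0 <= v i) ->
  (forall m, \sum_(i < m) v i <= B) -> forall e, 0 < e ->
  exists J, forall l m, (J <= l)%N -> (l <= m)%N -> \sum_(l <= i < m) v i < e.
Proof.
move=> v0 vB e e0; pose t m := \sum_(0 <= i < m) v i.
have tB m : t m <= B by rewrite /t big_mkord.
have ts : has_sup (range t).
  by split; [exists (t 0%N), 0%N | exists B => _ [m _ <-]].
have [_ [J _ <-] tJ] := sup_adherent e0 ts.
exists J => l m Jl lm.
have tl : t J <= t l by rewrite /t (big_cat_nat (leq0n J) Jl)//= lerDl sumr_ge0.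
have tm : t m = t l + \sum_(l <= i < m) v i by rewrite /t (big_cat_nat (leq0n l) lm).
have : t m <= sup (range t) by apply: ub_le_sup; [exists B => _ [i _ <-]|exists m].
lra.
Qed.

Lemma square_summable_null v (B : R) : (forall m, \sum_(i < m) v i ^+ 2 <= B) ->
  null_seqR v.
Proof.
move=> vB e e0.
have [J JP] := bounded_sum_cauchy (fun i => sqr_ge0 (v i)) vB (exprn_gt0 2 e0).
exists J => n Jn; have := JP n n.+1 Jn (leqnSn n).
rewrite big_nat1 -[v n ^+ 2]real_normK ?num_real//.
by rewrite ltr_sqr ?nnegrE// ltW.
Qed.

Lemma sum_subsequence_le v h m : (forall i, 0 <= v i) -> increasing h ->
  \sum_(i < m) v (h i) <= \sum_(j < h m) v j.
Proof.
move=> v0 hi; elim: m => [|m IH]; first by rewrite big_ord0 sumr_ge0.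
rewrite big_ord_recr /= -[leRHS](big_mkord predT v).
rewrite (big_cat_nat (leq0n (h m).+1) (hi m))//= big_mkord big_ord_recr /=.
by rewrite -addrA lerD// lerDl sumr_ge0.
Qed.

Lemma sum_geometric_le m : \sum_(i < m) (2 ^+ i.+1)^-1 <= 1 :> R.
Proof.
suff -> : \sum_(i < m) (2 ^+ i.+1)^-1 = 1 - (2 ^+ m)^-1 :> R.
  by rewrite gerBl invr_ge0 exprn_ge0.
elim: m => [|m IH]; first by rewrite big_ord0 expr0 invr1 subrr.
by rewrite big_ord_recr /= IH exprS invfM; field; rewrite expf_neq0.
Qed.

(** Columns are null, but rows need not be: the ultralimit S i of row i is square-summable in i,
    hence null. So only indices with small S are kept; every later index can then be taken small in
    the earlier rows. *)
Lemma almost_diagonal (s : nat -> nat -> R) (B : R) (eps : nat -> R) :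
  (forall i j, 0 <= s i j) -> (forall m j, \sum_(i < m) s i j ^+ 2 <= B) ->
  (forall i, 0 < eps i) ->
  exists2 h, increasing h & forall i j, i != j -> s (h i) (h j) <= eps i.
Proof.
move=> s0 sB eps0; have [U [UU Uoo]] := exists_ultrafilter.
have sB1 i j : `|s i j| <= B + 1.
  have B0 : 0 <= B by have := sB 0%N 0%N; rewrite big_ord0.
  have : s i j ^+ 2 <= B.
    apply: le_trans (sB i.+1 j); rewrite big_ord_recr /= lerDr sumr_ge0// => l _.
    exact: sqr_ge0.
  rewrite ger0_norm//; have := s0 i j; nra.
have /choice[S SP] i : exists l, forall e, 0 < e -> U [set j | `|s i j - l| < e].
  by have [l _ lP] := ultralimit UU (sB1 i); exists l.
(* A single column approximates the first m values of S within 1 / (m + 1), whence the bound 2 B +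
   2. *)
have S_null : null_seqR S.
  apply: (@square_summable_null _ (2 * B + 2)) => m.
  have [e e0 eE] : exists2 e : R, 0 < e & e = m.+1%:R^-1 by exists m.+1%:R^-1.
  have : U [set j | forall i : 'I_m, `|s i j - S i| < e].
    by apply: filter_forall => i; exact: SP.
  move=> /(ultra_infinite UU Uoo 0)[j _ jP].
  apply: (@le_trans _ _ (\sum_(i < m) (2 * s i j ^+ 2 + 2 * e ^+ 2))).
    apply: ler_sum => i _; have := jP i; rewrite ltr_norml => /andP[h1 h2].
    have : S i = s i j - (s i j - S i) by ring.
    move: (s i j - S i) h1 h2 => d h1 h2 ->.
    have d2 : d ^+ 2 <= e ^+ 2.
      have : 0 <= (e - d) * (e + d) by rewrite mulr_ge0//; lra.
      by rewrite !expr2; lra.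
    have := sqr_ge0 (s i j + d); rewrite sqrrD sqrrB; lra.
  rewrite big_split /= -mulr_sumr sumr_const card_ord -mulr_natl lerD//.
    by rewrite ler_pM2l//; exact: sB.
  have : m%:R * e <= 1 by rewrite eE ler_pdivrMr// mul1r ler_nat.
  have : e <= 1 by rewrite eE invf_le1// ler1n.
  have : 0 <= m%:R :> R by [].
  nra.
(* The strict inequality leaves room for the rows already chosen to meet the bound [eps] at
   infinitely many later columns. *)
pose Q (L : seq nat) := forall i, (i < size L)%N -> S (nth 0%N L i) < eps i.
pose r (_ : nat) (L L' : seq nat) := exists N, [/\ L' = rcons L N,
  forall i, (i < size L)%N -> (nth 0%N L i < N)%N,
  forall i, (i < size L)%N -> s (nth 0%N L i) N <= eps i &
  forall i, (i < size L)%N -> s N (nth 0%N L i) <= eps (size L)].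
have [//|i0 L QL|u [u0 uQ ur]] := @dependent_choice_inv _ Q r [::].
  have [J1 J1P] := S_null _ (eps0 (size L)).
  have [J2 J2P] : exists J, forall i, (i < size L)%N ->
      forall n, (J <= n)%N -> s n (nth 0%N L i) <= eps (size L).
    apply: (@seq_bound_nat _ (fun J l => forall n, (J <= n)%N -> s n l <= eps (size L))
      (size L) (nth 0%N L)).
      by move=> J i m Jm H n mn; apply: H; exact: leq_trans mn.
    move=> i _; have [J JP] := @square_summable_null (fun l => s l (nth 0%N L i)) B
      (fun m => sB m (nth 0%N L i)) _ (eps0 (size L)).
    by exists J => n /JP; rewrite ger0_norm// => /ltW.
  pose J3 := (\max_(l <- L) l.+1)%N.
  have : U [set j | forall i : 'I_(size L), s (nth 0%N L i) j <= eps i].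
    apply: filter_forall => i.
    have e0 : 0 < eps i - S (nth 0%N L i) by rewrite subr_gt0; exact: QL.
    apply: filterS (SP (nth 0%N L i) _ e0) => j /=; rewrite ltr_norml => /andP[_]; lra.
  move=> /(ultra_infinite UU Uoo (maxn J1 (maxn J2 J3)))[N].
  rewrite !geq_max => /andP[N1 /andP[N2 N3]] NP.
  exists (rcons L N).
    move=> i; rewrite size_rcons ltnS leq_eqVlt nth_rcons => /orP[/eqP ->|iL].
      rewrite ltnn eqxx; have := J1P N N1; exact: le_lt_trans (ler_norm _).
    by rewrite iL; exact: QL.
  exists N; split => //.
  - move=> i iL; apply: leq_trans N3; apply: (@leq_bigmax_seq _ _ _ succn) => //.
    exact: mem_nth.
  - by move=> i iL; exact: NP (Ordinal iL).
  - by move=> i iL; exact: J2P.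
have us m : size (u m) = m.
  elim: m => [|m IH]; first by rewrite u0.
  by have [N [-> _ _ _]] := ur m; rewrite size_rcons IH.
pose h i := nth 0%N (u i.+1) i.
have un i m : (i < m)%N -> nth 0%N (u m) i = h i.
  elim: m => // m IH; rewrite ltnS leq_eqVlt => /orP[/eqP ->//|im].
  by have [N [-> _ _ _]] := ur m; rewrite nth_rcons us im IH.
have step m : [/\ forall i, (i < m)%N -> (h i < h m)%N,
    forall i, (i < m)%N -> s (h i) (h m) <= eps i &
    forall i, (i < m)%N -> s (h m) (h i) <= eps m].
  have [N [uE N1 N2 N3]] := ur m.
  have -> : h m = N by rewrite /h uE nth_rcons us ltnn eqxx.
  split=> i im; rewrite -(un i m im).
  - by apply: N1; rewrite us.
  - by apply: N2; rewrite us.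
  - by rewrite -[in eps m](us m); apply: N3; rewrite us.
exists h => [i|i j ij]; first by have [H _ _] := step i.+1; exact: H.
case: (ltngtP i j) ij => // lt _.
  by have [_ H _] := step j; exact: H.
by have [_ _ H] := step i; exact: H.
Qed.

End real_series.

Section absolutely_summable.
Variables (R : realType) (k : scalar_kind).
Local Notation K := (scalars R k).
Variables (E : normedModType K) (F : completeNormedModType K) (n : nat).

Lemma absolutely_summable (P : nat -> contPoly n E F) (b : E -> R) (C : R) :
  (forall m x, \sum_(i < m) nrm (P i x) <= b x) -> (forall x, nrm x <= 1 -> b x <= C) ->
  pointwise_summable P C.
Proof.
move=> Pb bC; split=> [xi m x xi1 x1|xi x [B xiB] e e0].
  apply: le_trans (nrm_sum _ _ _) _; apply: le_trans (bC x x1); apply: le_trans (Pb m x).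
  by apply: ler_sum => i _; rewrite nrmZR ler_piMl ?nrm_ge0.
have B0 : 0 < `|B| + 1 by have := normr_ge0 B; lra.
have [J JP] := bounded_sum_cauchy (fun i => nrm_ge0 (P i x)) (fun m => Pb m x) (divr_gt0 e0 B0).
pose S m := \sum_(0 <= i < m) ofR k (xi i) *: P i x.
have SP l m : (J <= l)%N -> (l <= m)%N -> nrm (S m - S l) < e.
  move=> Jl lm; rewrite /S (big_cat_nat (leq0n l) lm)//= addrAC subrr add0r.
  have := JP l m Jl lm; rewrite ltr_pdivlMr//; apply: le_lt_trans.
  apply: le_trans (nrm_sum _ _ _) _; rewrite mulr_suml; apply: ler_sum => i _.
  rewrite nrmZR mulrC ler_wpM2l ?nrm_ge0//.
  by have := xiB i; have := ler_norm B; lra.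
exists J => m l Jm Jl.
rewrite -!(big_mkord predT (fun i => ofR k (xi i) *: P i x)) -!/(S _).
by case/orP: (leq_total l m) => lm; [|rewrite nrm_distC]; exact: SP.
Qed.

End absolutely_summable.

Lemma nrmM (R : realType) (k : scalar_kind) (a b : scalars R k) :
  nrm (a * b : (scalars R k)^o) = nrm (a : (scalars R k)^o) * nrm (b : (scalars R k)^o).
Proof. exact: (nrmZ a (b : (scalars R k)^o)). Qed.

Lemma nrm1 (R : realType) (k : scalar_kind) : nrm (1 : (scalars R k)^o) = 1.
Proof. by rewrite -(@ofR1 R k) nrm_ofR normr1. Qed.

Lemma nrm_exprB (R : realType) (k : scalar_kind) (a b : (scalars R k)^o) (r d : R) n :
  nrm a <= r -> nrm b <= r -> nrm (a - b) <= d ->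
  nrm (a ^+ n - b ^+ n : (scalars R k)^o) <= n%:R * r ^+ n.-1 * d.
Proof.
move=> ar br abd; have r0 : 0 <= r := le_trans (nrm_ge0 a) ar.
have d0 : 0 <= d := le_trans (nrm_ge0 _) abd.
elim: n => [|n IH]; first by rewrite !expr0 subrr nrm0 !mul0r.
have -> : (a ^+ n.+1 - b ^+ n.+1 : (scalars R k)^o) =
    (a : (scalars R k)) *: (a ^+ n - b ^+ n) + (b ^+ n : scalars R k) *: (a - b).
  rewrite -![_ *: _]/(_ * _) !exprS; ring.
apply: le_trans (nrmD _ _) _; rewrite !nrmZ nrmX /=.
have h1 : nrm a * nrm (a ^+ n - b ^+ n : (scalars R k)^o) <= n%:R * r ^+ n * d.
  apply: le_trans (_ : r * (n%:R * r ^+ n.-1 * d) <= _).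
    by apply: ler_pM => //; exact: nrm_ge0.
  case: n {IH} => [|n]; first by rewrite !mul0r mulr0.
  by rewrite /= exprS; lra.
have h2 : nrm b ^+ n * nrm (a - b) <= r ^+ n * d.
  apply: ler_pM => //; [by rewrite exprn_ge0// nrm_ge0|exact: nrm_ge0|].
  by rewrite lerXn2r// nnegrE// nrm_ge0.
by rewrite -natr1 !mulrDl mul1r; exact: lerD.
Qed.

Lemma ofRX (R : realType) (k : scalar_kind) (a : R) n : ofR k (a ^+ n) = ofR k a ^+ n.
Proof. by elim: n => [|n IH]; rewrite ?expr0 ?ofR1// !exprS ofRM IH. Qed.

Lemma sum_delta (R : realType) (c : R) i m : (i < m)%N ->
  \sum_(q < m) (nat_of_ord q == i)%:R * c = c.
Proof.
move=> im; rewrite (bigD1 (Ordinal im))//= eqxx mul1r big1 ?addr0// => q.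
by rewrite -val_eqE /= => /negPf ->; rewrite mul0r.
Qed.

(** * The case of a copy of l_1 *)

Section l1_case.
Variables (R : realType) (k : scalar_kind).
Local Notation K := (scalars R k).
Variables (E : normedModType K) (F : completeNormedModType K) (n : nat).

(* With phi_k biorthogonal to a rescaled subsequence y of x up to small errors, the
   polynomial sum_(k in M) phi_k ^ n is not weakly continuous: 0 is a weak
   cluster point of the vectors y_i + y_j - 2 y_l, at which it takes a value
   close to 2 + (-2)^n. *)
Lemma l1_uncomplemented (w : F) (x : nat -> realified E) (c : R)
    (p : {linear contPoly n E F -> contPoly n E F}) :
  (1 < n)%N -> w != 0 -> rademacher_system (@rnorm R k E) x c ->
  ~ bounded_projection p.
Proof.
move=> n1 w0 xrad pp.
have sE := @rnorm_seminorm R k E.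
have [c0 x1 _] := xrad.
have [z [zb zbes zc]] := rademacher_bessel sE xrad.
have /choice[phi phiP] i := dual_of_bfun (zb i).
pose s i j := `|z i (x j)| + `|z i (iK R k *: (x j : E))|.
have sumz m (v : E) : \sum_(i < m) (`|z i v| + `|z i (iK R k *: v)|) ^+ 2 <= 4 * nrm v ^+ 2.
  apply: (@le_trans _ _ (\sum_(i < m) (2 * z i v ^+ 2 + 2 * z i (iK R k *: v) ^+ 2))).
    apply: ler_sum => i _; set a := z i v; set b := z i _.
    have := sqr_ge0 (`|a| - `|b|); rewrite sqrrB sqrrD !real_normK ?num_real//; lra.
  rewrite big_split /= -!mulr_sumr.
  have := zbes m v; have := zbes m (iK R k *: v).
  have : rnorm (iK R k *: v) ^+ 2 <= rnorm v ^+ 2.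
    rewrite ler_sqr ?nnegrE ?nrm_ge0// /rnorm nrmZ ler_piMl ?nrm_ge0//.
    exact: nrm_iK.
  rewrite /rnorm; lra.
(* An error of 3 eta in a number of modulus at most 2 then changes its n-th power by at most 3/32,
   which is below 1/8. *)
pose eta : R := (32 * (n%:R * 3 ^+ n.-1 + 1))^-1.
have N0 : 0 <= n%:R * 3 ^+ n.-1 :> R by rewrite mulr_ge0// exprn_ge0.
have eta0 : 0 < eta by rewrite invr_gt0 mulr_gt0// ltr_wpDl.
have etaE : 32 * (n%:R * 3 ^+ n.-1 + 1) * eta = 1.
  by rewrite divff// gt_eqF// mulr_gt0// ltr_wpDl.
(* The factor c offsets the division of x (h j) by [a j], of modulus at least c; the powers of 2
   make the errors summable. *)
pose eps i : R := c * eta / 2 ^+ i.+1.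
have eps0 i : 0 < eps i by rewrite divr_gt0 ?exprn_gt0// mulr_gt0.
have [||h hi hP] := @almost_diagonal R s 4 eps _ _ eps0.
- by move=> i j; rewrite addr_ge0.
- move=> m j; apply: le_trans (sumz m (x j)) _.
  have := x1 j; rewrite /rnorm; have := nrm_ge0 (x j : E); nra.
pose a i : K := sval (phi (h i)) (x (h i)).
have ac i : c <= nrm (a i : K^o).
  apply: le_trans (zc (h i)) _; rewrite -(phiP (h i)).1.
  by apply: le_trans (ler_norm _) _; exact: reK_norm.
have a0 i : a i != 0.
  apply/eqP => ai; have := ac i; rewrite ai nrm0; lra.
pose y i : E := (a i)^-1 *: (x (h i) : E).
have ainv i : nrm ((a i)^-1 : K^o) <= c^-1.
  have : nrm ((a i)^-1 : K^o) * nrm (a i : K^o) = 1.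
    by rewrite -nrmM mulVf// nrm1.
  have := ac i; have := nrm_ge0 ((a i)^-1 : K^o) => h1 h2 h3.
  rewrite -[leRHS]mulr1 ler_pdivlMl//; nra.
have yb i : nrm (y i) <= c^-1.
  rewrite nrmZ; have := x1 (h i); rewrite /rnorm; have := ainv i.
  have := nrm_ge0 (x (h i) : E); have := nrm_ge0 ((a i)^-1 : K^o); nra.
pose f i := phi (h i).
have fyy i : sval (f i) (y i) = 1 by rewrite /y linearZ; exact: mulVf (a0 i).
have fyN i j : i != j -> nrm (sval (f i) (y j) : K^o) <= eta / 2 ^+ i.+1.
  move=> ij; rewrite /y linearZ /= nrmZ.
  have sle : nrm (sval (f i) (x (h j)) : K^o) <= c * (eta / 2 ^+ i.+1).
    by rewrite mulrA; apply: le_trans (hP i j ij); exact: (phiP (h i)).2.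
  apply: le_trans (_ : c^-1 * (c * (eta / 2 ^+ i.+1)) <= _).
    by apply: ler_pM => //; exact: nrm_ge0.
  by rewrite mulKf ?gt_eqF.
have /choice[P PP] i := dual_monomial (f i) n w.
have fN i (v : E) : nrm (sval (f i) v) <= 2 * nrm v.
  apply: le_trans ((phiP (h i)).2 v) _.
  have := bfun_norm sE (zb (h i)) v; have := bfun_norm sE (zb (h i)) (iK R k *: v).
  rewrite /rnorm nrmZ; have := nrm_iK R k; have := nrm_ge0 v.
  have := nrm_ge0 (iK R k : K^o); nra.
(* All but two factors of the n-th power are bounded by 2 |v|, and the remaining squares are summed
   by Bessel; the 4 accounts for real and imaginary parts. *)
have Psum : pointwise_summable P (2 ^+ (n - 2) * 4 * nrm w).
  apply: (@absolutely_summable _ _ _ _ _ _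
    (fun v => (2 * nrm v) ^+ (n - 2) * (4 * nrm v ^+ 2) * nrm w)); last first.
    move=> v v1; have v0 := nrm_ge0 v.
    rewrite -[leRHS]mulrA -[leLHS]mulrA; apply: ler_pM.
    - by rewrite exprn_ge0// mulr_ge0.
    - by rewrite mulr_ge0 ?nrm_ge0// mulr_ge0// exprn_ge0.
    - by rewrite lerXn2r// ?nnegrE ?mulr_ge0//; lra.
    - rewrite ler_wpM2r ?nrm_ge0//; nra.
  move=> m v; have v0 := nrm_ge0 v.
  have t0 i : 0 <= nrm (sval (f i) v : K^o) by exact: nrm_ge0.
  have bes : \sum_(i < m) nrm (sval (f i) v : K^o) ^+ 2 <= 4 * nrm v ^+ 2.
    apply: le_trans (sumz (h m) v).
    apply: le_trans (sum_subsequence_le (v := fun i => (`|z i v| + `|z i (iK R k *: v)|) ^+ 2) m _ hi).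
      apply: ler_sum => i _; rewrite ler_sqr ?nnegrE ?addr_ge0//.
      exact: (phiP (h i)).2.
    by move=> i; exact: sqr_ge0.
  rewrite (eq_bigr (fun i : 'I_m => nrm (sval (f i) v : K^o) ^+ n * nrm w)); last first.
    by move=> i _; rewrite (PP i).2 nrmZ nrmX.
  rewrite -mulr_suml ler_wpM2r ?nrm_ge0//.
  apply: le_trans (_ : (2 * nrm v) ^+ (n - 2) * \sum_(i < m) nrm (sval (f i) v : K^o) ^+ 2 <= _).
    rewrite mulr_sumr; apply: ler_sum => i _.
    rewrite -[in leLHS](subnK n1) exprD ler_wpM2r ?exprn_ge0//.
    by rewrite lerXn2r ?nnegrE ?mulr_ge0.
  by rewrite ler_wpM2l// exprn_ge0// mulr_ge0.
have [f0 f0b f0w] := hahn_banach (w : realified F) (@rnorm_seminorm R k F).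
(* All triples are tested, because M is not yet known. *)
pose u (t : nat * nat * nat) := y t.1.1 + y t.1.2 - (y t.2 + y t.2).
have [M [G [g [Minf Gw gP Gg]]]] := @projection_agrees _ _ _ _ _ P _ p Psum
  (fun i => (PP i).1) pp (nat * nat * nat)%type (fun=> f0) u (fun=> f0b).
have [mu mui muM] : exists2 mu, increasing mu & forall i, M (mu i).
  by apply: (@choose_increasing (fun _ n => M n)) => _ J; exact: Minf.
have wn : 0 < nrm w.
  by rewrite lt_neqAle nrm_ge0 andbT eq_sym; apply: contraNneq w0 => /nrm_eq0 ->.
have ci0 : 0 <= c^-1 by rewrite invr_ge0 ltW.
have G0 : G 0 = 0.
  have := homogeneous_polynomialZ 0 0 (contPoly_hom G).
  by rewrite scale0r expr0n -leqn0 leqNgt ltnW//= scale0r.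
have [|m0 [Gf [e [e0 Gfb GfP]]]] :=
    @weakly_continuous_near _ _ _ _ G 0 (4 * c^-1) (nrm w / 2) Gw _ (divr_gt0 wn (ltr0Sn _ 1)).
  by rewrite nrm0 mulr_ge0.
have [U [UU Uoo]] := exists_ultrafilter.
have Gb a' i : `|Gf a' (y (mu i))| <= c^-1.
  exact: le_trans (bfun_norm sE (Gfb a') _) (yb _).
have e4 : 0 < e / 4 by rewrite divr_gt0.
have /choice[lim limP] a' : exists l, U [set i | `|Gf a' (y (mu i)) - l| < e / 4].
  by have [l _ lP] := ultralimit UU (Gb a'); exists l; exact: lP.
(* At three such indices the limits cancel in y_i + y_j - 2 y_l, leaving four errors below e / 4. *)
have UA : U [set i | forall a' : 'I_m0, `|Gf a' (y (mu i)) - lim a'| < e / 4].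
  by apply: filter_forall => a'; exact: limP.
have [i0 _ i0P] := ultra_infinite UU Uoo 0 UA.
have [i1 i01 i1P] := ultra_infinite UU Uoo i0.+1 UA.
have [i2 i12 i2P] := ultra_infinite UU Uoo i1.+1 UA.
pose i := mu i0; pose j := mu i1; pose l := mu i2.
have ij : (i < j)%N by exact: increasing_lt.
have jl : (j < l)%N by exact: increasing_lt.
have il : (i < l)%N := ltn_trans ij jl.
pose v := u (i, j, l).
have vE : v = y i + y j - (y l + y l) by [].
have v4 : nrm v <= 4 * c^-1.
  have := nrmB (y i + y j) (y l + y l); have := nrmD (y i) (y j); have := nrmD (y l) (y l).
  have := yb i; have := yb j; have := yb l; rewrite vE; lra.
have Gv : nrm (G v) < nrm w / 2.
  rewrite -[G v]subr0 -G0; apply: GfP => // a' a'm.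
  have -> : Gf a' (v - 0) = (Gf a' (y i) - lim a') + (Gf a' (y j) - lim a') -
      ((Gf a' (y l) - lim a') + (Gf a' (y l) - lim a')).
    rewrite subr0 vE (bfunB (Gfb a') (y i + y j) (y l + y l)).
    rewrite (bfunD (Gfb a') (y i) (y j)) (bfunD (Gfb a') (y l) (y l)); ring.
  have := i0P (Ordinal a'm); have := i1P (Ordinal a'm); have := i2P (Ordinal a'm).
  rewrite /= -/i -/j -/l => h1 h2 h3.
  apply: le_lt_trans (ler_normB _ _) _.
  have := ler_normD (Gf a' (y i) - lim a') (Gf a' (y j) - lim a').
  have := ler_normD (Gf a' (y l) - lim a') (Gf a' (y l) - lim a'); lra.
pose d : R := 1 + 1 + (-2) ^+ n.
have d2 : 2 <= `|d|.
  have : `|(-2) ^+ n| <= `|d| + 2.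
    have -> : (-2) ^+ n = d - 2 by rewrite /d; ring.
    by apply: le_trans (ler_normB _ _) _; rewrite (ger0_norm (_ : 0 <= 2)).
  rewrite normrX normrN (ger0_norm (_ : 0 <= 2))//.
  have : 2 ^+ 2 <= 2 ^+ n :> R by rewrite ler_eXn2l// ltr1n.
  lra.
have etaN : n%:R * 3 ^+ n.-1 * eta <= 32^-1 by lra.
have eta32 : eta <= 32^-1.
  have : 0 <= n%:R * 3 ^+ n.-1 * eta by rewrite mulr_ge0// ltW.
  lra.
pose va q q' : K := sval (f q) (y q').
have vaE q : sval (f q) v = va q i + va q j - (va q l + va q l) :> K.
  by rewrite vE linearB !linearD.
have va1 q : va q q = 1 := fyy q.
(* [D q] is the ideal coefficient of w in the q-th term and [bd q] its error; the errors add up to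
   at most 3/8 + 1/8 = 1/2. *)
pose D q : R := (q == i)%:R * 1 + (q == j)%:R * 1 + (q == l)%:R * (-2) ^+ n.
pose bd q : R := (q == i)%:R * 8^-1 + (q == j)%:R * 8^-1 + (q == l)%:R * 8^-1 + 8^-1 * (2 ^+ q.+1)^-1.
have pw q : 0 < ((2 : R) ^+ q.+1)^-1 <= 1.
  by rewrite invr_gt0 exprn_gt0//= invf_le1 ?exprn_gt0// exprn_ege1// ler1n.
have vaN q q' : q != q' -> nrm (va q q' : K^o) <= eta.
  move=> qq; apply: le_trans (fyN _ _ qq) _; have /andP[p1 p2] := pw q.
  by rewrite ler_piMr// ltW.
have tri (a1 a2 a3 : K^o) (r : R) : nrm a1 <= r -> nrm a2 <= r -> nrm a3 <= r ->
    nrm (a1 + (a2 + a3)) <= 3 * r.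
  by have := nrmD a1 (a2 + a3); have := nrmD a2 a3; lra.
have close (t b : K) : nrm (b : K^o) <= 2 -> nrm (t - b : K^o) <= 3 * eta ->
    nrm (t ^+ n - b ^+ n : K^o) <= 8^-1.
  move=> b2 tb; have t3 : nrm (t : K^o) <= 3.
    have := nrmD (t - b : K^o) b; rewrite subrK; lra.
  have b3 : nrm (b : K^o) <= 3 by lra.
  have := nrm_exprB n t3 b3 tb; lra.
have Mi : M i by exact: muM.
have Mj : M j by exact: muM.
have Ml : M l by exact: muM.
have [nij nil njl] : [/\ (i == j) = false, (i == l) = false & (j == l) = false].
  by rewrite (ltn_eqF ij) (ltn_eqF il) (ltn_eqF jl).
have [nji nli nlj] : [/\ (j == i) = false, (l == i) = false & (l == j) = false].
  by split; rewrite eq_sym.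
have ring1 (a1 a2 a3 : K) : a1 + a2 - (a3 + a3) - a1 = a2 + (- a3 + - a3) by ring.
have ring2 (a1 a2 : K) : a1 + a2 - (1 + 1) - - 2 = a1 + (a2 + 0) by ring.
have est q : nrm (ofR k (M q)%:R * sval (f q) v ^+ n - ofR k (D q) : K^o) <= bd q.
  have /andP[p1 p2] := pw q; rewrite vaE.
  have [->|qi] := eqVneq q i.
    have -> : bd i = 8^-1 + 8^-1 * (2 ^+ i.+1)^-1.
      by rewrite /bd eqxx nij nil !mul0r mul1r !addr0.
    have -> : D i = 1 by rewrite /D eqxx nij nil !mul0r mul1r !addr0.
    rewrite Mi ofR1 mul1r -[X in _ - X](expr1n _ n) va1.
    apply: le_trans (close _ _ _ _) _; first by rewrite nrm1; lra.
      rewrite (ring1 1).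
      by apply: tri; rewrite ?nrmN; apply: vaN; rewrite ?nij ?nil.
    by have /andP[] := pw i; lra.
  have [->|qj] := eqVneq q j.
    have -> : bd j = 8^-1 + 8^-1 * (2 ^+ j.+1)^-1.
      by rewrite /bd eqxx nji njl !mul0r mul1r add0r !addr0.
    have -> : D j = 1 by rewrite /D eqxx nji njl !mul0r mul1r add0r !addr0.
    rewrite Mj ofR1 mul1r -[X in _ - X](expr1n _ n) va1.
    apply: le_trans (close _ _ _ _) _; first by rewrite nrm1; lra.
      rewrite [va j i + 1]addrC (ring1 1).
      by apply: tri; rewrite ?nrmN; apply: vaN; rewrite ?nji ?njl.
    by have /andP[] := pw j; lra.
  have [->|ql] := eqVneq q l.
    have -> : bd l = 8^-1 + 8^-1 * (2 ^+ l.+1)^-1.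
      by rewrite /bd eqxx nli nlj !mul0r mul1r !add0r.
    have -> : D l = (-2) ^+ n by rewrite /D eqxx nli nlj !mul0r mul1r !add0r.
    rewrite Ml ofR1 mul1r ofRX ofRN ofR_nat va1.
    apply: le_trans (close _ _ _ _) _.
      by rewrite nrmN -ofR_nat nrm_ofR ger0_norm.
      rewrite ring2.
      by apply: tri; rewrite ?nrm0 ?(ltW eta0)//; apply: vaN; rewrite ?nli ?nlj.
    by have /andP[] := pw l; lra.
  have -> : bd q = 8^-1 * (2 ^+ q.+1)^-1.
    by rewrite /bd (negPf qi) (negPf qj) (negPf ql) !mul0r !add0r.
  have -> : D q = 0 by rewrite /D (negPf qi) (negPf qj) (negPf ql) !mul0r !addr0.
  rewrite ofR0 subr0 nrmM nrm_ofR nrmX.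
  set tt := nrm _; have tt4 : tt <= 4 * (eta / 2 ^+ q.+1).
    have := nrmD (va q i : K^o) (va q j + (- va q l - va q l)).
    have := nrmD (va q j : K^o) (- va q l - va q l); have := nrmB (- va q l : K^o) (va q l).
    rewrite nrmN /tt opprD !addrA.
    have := fyN q i qi; have := fyN q j qj; have := fyN q l ql.
    rewrite -/(va q i) -/(va q j) -/(va q l); lra.
  have ttl : tt <= 8^-1 * (2 ^+ q.+1)^-1.
    apply: le_trans tt4 _; rewrite mulrA ler_wpM2r// ?(ltW p1)//; lra.
  have tt0 : 0 <= tt by exact: nrm_ge0.
  have tt1 : tt <= 1 by lra.
  apply: le_trans ttl; apply: le_trans (_ : tt ^+ n <= _).
    rewrite ler_piMl ?exprn_ge0// ger0_norm; by case: (M q).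
  by rewrite -[n]prednK ?exprS ?ler_piMr ?exprn_ile1// ltnW.
have gv : nrm (g v - ofR k d *: w) <= nrm w / 2.
  apply/ler_addgt0Pr => e' e'0.
  have /cvg_nrm_nat/(_ e' e'0)[J JP] := gP v.
  pose m := maxn J l.+1.
  have lm : (l < m)%N by rewrite leq_max ltnSn orbT.
  have jm : (j < m)%N := ltn_trans jl lm.
  have im : (i < m)%N := ltn_trans il lm.
  have := JP m (leq_maxl _ _); set S := \sum_(i < m) _ => hS.
  have SE : S - ofR k d *: w =
      \sum_(q < m) (ofR k (M q)%:R * sval (f q) v ^+ n - ofR k (D q)) *: w.
    have -> : d = \sum_(q < m) D q by rewrite !big_split /= !sum_delta.
    rewrite (big_morph (ofR k) (@ofRD R k) (ofR0 _ _)) scaler_suml -sumrB.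
    by apply: eq_bigr => q _; rewrite scalerBl (PP q).2 scalerA.
  have Sd : nrm (S - ofR k d *: w) <= nrm w / 2.
    rewrite SE; apply: le_trans (nrm_sum _ _ _) _.
    apply: le_trans (_ : \sum_(q < m) bd q * nrm w <= _).
      by apply: ler_sum => q _; rewrite nrmZ ler_wpM2r ?nrm_ge0//; exact: est.
    rewrite -mulr_suml mulrC ler_wpM2l ?nrm_ge0// !big_split /= !sum_delta// -mulr_sumr.
    have := @sum_geometric_le R m; lra.
  have := nrmD (g v - S) (S - ofR k d *: w); rewrite addrA subrK.
  move: hS; rewrite nrm_distC; lra.
have f0g := Gg (i, j, l).
have f0n (q : F) : `|f0 q| <= nrm q := bfun_norm (@rnorm_seminorm R k F) f0b q.
have f0D (q q' : F) : f0 (q - q') = f0 q - f0 q' := bfunB f0b q q'.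
have f0Z r (q : F) : f0 (ofR k r *: q) = r * f0 q := bfunZ f0b r q.
have h1 := f0n (G v); have h2 := f0n (g v - ofR k d *: w).
rewrite f0D f0Z f0w -f0g -/v in h2.
have := ler_normB (f0 (G v)) (f0 (G v) - d * rnorm w).
rewrite opprB addrC subrK normrM (ger0_norm (nrm_ge0 w)) => h3.
have : 2 * nrm w <= `|d| * nrm w by rewrite ler_wpM2r// nrm_ge0.
rewrite /rnorm in h2 h3; lra.
Qed.
End l1_case.

(** * Subsequences of summable polynomials and the case without l_1 *)

Lemma push_subsequence (R : realType) (h : nat -> nat) (xi : nat -> R) (B : R) :
  0 <= B -> increasing h -> (forall i, `|xi i| <= B) -> exists eta : nat -> R,
  (forall i, `|eta i| <= B) /\
  forall (V : zmodType) (s : R -> V -> V) (v : nat -> V) m, (forall w, s 0 w = 0) ->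
    \sum_(i < h m) s (eta i) (v i) = \sum_(i < m) s (xi i) (v (h i)) + \sum_(i < h 0%N) s (eta i) (v i).
Proof.
move=> B0 hi xiB.
have hinj i j : h i = h j -> i = j.
  move=> hij; case: (ltngtP i j) => // /(increasing_lt hi); rewrite hij ltnn//.
have /choice[g gP] i : exists o : option nat, if o is Some j then h j = i else forall j, h j <> i.
  have [[j hj]|H] := pselect (exists j, h j = i); first by exists (Some j).
  by exists None => j hj; apply: H; exists j.
exists (fun i => if g i is Some j then xi j else 0); split.
  by move=> i; case: (g i) => // ; rewrite normr0.
move=> V s v m s0; elim: m => [|m IH]; first by rewrite [X in _ = X + _]big_ord0 add0r.
have E l : \sum_(i < l) s (if g i is Some j then xi j else 0) (v i) =
    \sum_(0 <= i < l) s (if g i is Some j then xi j else 0) (v i) by rewrite big_mkord.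
rewrite E (big_cat_nat (leq0n (h m)) (ltnW (hi m)))//= -E IH big_ord_recr /= addrAC.
congr (_ + _ + _); rewrite big_ltn// big_nat_cond big1 ?addr0 => [|i /andP[/andP[mi im] _]].
  by have := gP (h m); case: (g (h m)) => [j /hinj ->//|/(_ m)].
have := gP i; case: (g i) => // j hj.
have mj : (m < j)%N by rewrite ltnNge; apply/negP => /(increasing_le hi); lia.
have jm : (j < m.+1)%N by rewrite ltnNge; apply/negP => /(increasing_le hi); lia.
by lia.
Qed.

Section pairs.
Variable R : realType.

(** To be read with A i l l' the distance between the values of P i at x l and x l', and B i l the
    size of P i at x l. The index a j is chosen before b j. The j earlier terms share one eta, the
    later ones have geometric bounds. *)
Lemma separated_pairs (A : nat -> nat -> nat -> R) (B : nat -> nat -> R) (eta : R) :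
  0 < eta ->
  (forall i e, 0 < e -> exists J, forall l l', (J <= l)%N -> (J <= l')%N -> A i l l' < e) ->
  (forall l e, 0 < e -> exists J, forall i, (J <= i)%N -> B i l < e) ->
  exists a b : nat -> nat, [/\ forall j, (j <= a j)%N /\ (j <= b j)%N, increasing b,
    forall i j, (i < j)%N -> A (b i) (b j) (a j) <= eta / j.+1%:R,
    forall j, B (b j) (a j) <= eta &
    forall i j, (j < i)%N -> B (b i) (b j) <= eta / 2 ^+ i.+1 /\ B (b i) (a j) <= eta / 2 ^+ i.+1].
Proof.
move=> eta0 AP BP.
pose r (_ : nat) (L L' : seq (nat * nat)) := exists p, [/\ L' = rcons L p,
  (size L <= p.1)%N /\ (size L <= p.2)%N,
  B p.2 p.1 <= eta &
  forall i, (i < size L)%N -> let q := nth (0, 0)%N L i in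
    [/\ (q.2 < p.2)%N, A q.2 p.2 p.1 <= eta / (size L).+1%:R,
     B p.2 q.2 <= eta / 2 ^+ (size L).+1 & B p.2 q.1 <= eta / 2 ^+ (size L).+1]].
have [//|i0 L _|u [u0 _ ur]] := @dependent_choice_inv _ (fun=> True) r [::].
  pose nt := nth (0, 0)%N L.
  have e1 : 0 < eta / (size L).+1%:R by rewrite divr_gt0.
  have e2 : 0 < eta / 2 ^+ (size L).+1 by rewrite divr_gt0// exprn_gt0.
  have [J1 J1P] : exists J, forall i, (i < size L)%N -> forall l l', (J <= l)%N -> (J <= l')%N ->
      A (nt i).2 l l' < eta / (size L).+1%:R.
    apply: (@seq_bound_nat _ (fun J q => forall l l', (J <= l)%N -> (J <= l')%N ->
      A q.2 l l' < eta / (size L).+1%:R) (size L) nt).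
      by move=> J i m Jm H l l' ml ml'; apply: H; [exact: leq_trans ml|exact: leq_trans ml'].
    by move=> i _; exact: AP.
  have BL (c : nat * nat -> nat) : exists J, forall i, (i < size L)%N -> forall m, (J <= m)%N ->
      B m (c (nt i)) < eta / 2 ^+ (size L).+1.
    apply: (@seq_bound_nat _ (fun J q => forall m, (J <= m)%N -> B m (c q) < eta / 2 ^+ (size L).+1)
      (size L) nt).
      by move=> J i m Jm H n mn; apply: H; exact: leq_trans mn.
    by move=> i _; exact: BP.
  have [J2 J2P] := BL (fun q => q.1); have [J3 J3P] := BL (fun q => q.2).
  pose a := maxn J1 (size L); have [J4 J4P] := BP a eta eta0.
  pose J5 := (\max_(q <- L) q.2.+1)%N.
  pose b := maxn (maxn (maxn J1 (size L)) (maxn J2 J3)) (maxn J4 J5).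
  have [b1 bL b2] : [/\ (J1 <= b)%N, (size L <= b)%N & (J2 <= b)%N].
    by rewrite /b !leq_max !leqnn /= ?orbT.
  have [b3 b4 b5] : [/\ (J3 <= b)%N, (J4 <= b)%N & (J5 <= b)%N].
    by rewrite /b !leq_max !leqnn /= ?orbT.
  have [a1 aL] : (J1 <= a)%N /\ (size L <= a)%N by rewrite /a !leq_max !leqnn orbT.
  exists (rcons L (a, b)) => //; exists (a, b); split => //.
    by apply: ltW; exact: J4P.
  move=> i iL q; split.
  - apply: leq_trans b5; apply: (@leq_bigmax_seq _ _ _ (fun q => q.2.+1)) => //.
    exact: mem_nth.
  - by apply: ltW; exact: J1P.
  - by apply: ltW; exact: J3P.
  - by apply: ltW; exact: J2P.
have us m : size (u m) = m.
  elim: m => [|m IH]; first by rewrite u0.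
  by have [p [-> _ _ _]] := ur m; rewrite size_rcons IH.
pose h i := nth (0, 0)%N (u i.+1) i.
have un i m : (i < m)%N -> nth (0, 0)%N (u m) i = h i.
  elim: m => // m IH; rewrite ltnS leq_eqVlt => /orP[/eqP ->//|im].
  by have [p [-> _ _ _]] := ur m; rewrite nth_rcons us im IH.
have step m : [/\ (m <= (h m).1)%N /\ (m <= (h m).2)%N, B (h m).2 (h m).1 <= eta &
    forall i, (i < m)%N -> [/\ ((h i).2 < (h m).2)%N, A (h i).2 (h m).2 (h m).1 <= eta / m.+1%:R,
     B (h m).2 (h i).2 <= eta / 2 ^+ m.+1 & B (h m).2 (h i).1 <= eta / 2 ^+ m.+1]].
  have [p [uE]] := ur m; rewrite us => p1 p2 p3.
  have -> : h m = p by rewrite /h uE nth_rcons us ltnn eqxx.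
  by split => // i im; have := p3 i im; rewrite un.
exists (fun j => (h j).1), (fun j => (h j).2); split.
- by move=> j; have [] := step j.
- by move=> j; have [_ _ /(_ j (ltnSn j))[]] := step j.+1.
- by move=> i j ij; have [_ _ /(_ i ij)[]] := step j.
- by move=> j; have [] := step j.
- by move=> i j ji; have [_ _ /(_ j ji)[]] := step i.
Qed.

End pairs.

Section main_lemma.
Variables (R : realType) (k : scalar_kind).
Local Notation K := (scalars R k).
Variables (E : normedModType K) (F : completeNormedModType K) (n : nat).
Local Notation X := (contPoly n E F).

Lemma pointwise_summable_subsequence (P : nat -> X) C h : increasing h ->
  pointwise_summable P C -> exists C', pointwise_summable (P \o h) C'.
Proof.
move=> hi [PC Pc].
have s0 (v : F) : ofR k 0 *: v = 0 by rewrite ofR0 scale0r.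
(* The sum below [h 0] costs a second C here, and cancels in the Cauchy condition. *)
exists (C + C); split=> [xi m x xi1 x1|xi x [B xiB]].
  have [eta [eta1 etaE]] := push_subsequence ler01 hi xi1.
  have := etaE _ (fun a v => ofR k a *: v) (fun i => P i x) m s0.
  move=> /(congr1 (fun v => v - \sum_(i < h 0%N) ofR k (eta i) *: P i x)).
  rewrite addrK /= => <-; apply: le_trans (nrmB _ _) _.
  by apply: lerD; apply: PC.
have [|eta [etaB etaE]] := @push_subsequence R h xi `|B| (normr_ge0 _) hi.
  by move=> i; apply: le_trans (xiB i) (ler_norm _).
move=> e e0; have [|J JP] := Pc eta x _ e e0; first by exists `|B|.
exists J => m l Jm Jl.
have E' m' := etaE _ (fun a v => ofR k a *: v) (fun i => P i x) m' s0.
have := JP (h m) (h l) (leq_trans Jm (increasing_ge m hi)) (leq_trans Jl (increasing_ge l hi)).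
by rewrite (E' m) (E' l) /= [in - (_ + _)]addrC opprD addrA addrK.
Qed.

Lemma weak_contPoly_seq (G : X) : weak_contPoly n E F G -> weakly_seq_continuous G.
Proof.
move=> Gw y u [[B uB] u0] e e0.
have B0 : 0 <= B := le_trans (nrm_ge0 _) (uB 0%N).
have yB : nrm y <= nrm y + B by lra.
have [m [Gf [d [d0 Gfb GfP]]]] := weakly_continuous_near Gw yB e0.
have [J JP] : exists J, forall i, (i < m)%N -> forall l, (J <= l)%N -> `|Gf i (u l)| < d.
  apply: (@seq_bound_nat _ (fun J (g : realified E -> R) => forall l, (J <= l)%N -> `|g (u l)| < d) m Gf).
    by move=> J i l Jl H l' ll'; apply: H; exact: leq_trans ll'.
  by move=> i _; exact: u0 (Gfb i) d d0.
exists J => l Jl; rewrite ger0_norm ?nrm_ge0//; apply: GfP.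
  by apply: le_trans (nrmD _ _) _; rewrite lerD2l.
by move=> i im; rewrite addrAC subrr add0r; exact: JP.
Qed.

(* For a weakly Cauchy subsequence of x, indices a_j < b_j are chosen such that
   sum_(i in M) P_(b_i) differs by about P_(b_j) x_(b_j) between x_(a_j) and
   x_(b_j) when j is in M. *)
Lemma summable_uncomplemented (P : nat -> X) (C delta : R) (x : nat -> E)
    (p : {linear X -> X}) :
  (forall (y : nat -> realified E) c, ~ rademacher_system (@rnorm R k E) y c) ->
  pointwise_summable P C -> (forall i, weak_contPoly n E F (P i)) -> 0 < delta ->
  (forall i, nrm (x i) <= 1) -> (forall i, delta <= nrm (P i (x i))) ->
  ~ bounded_projection p.
Proof.
move=> norad Psum Pw d0 x1 xd pp.
have sE := @rnorm_seminorm R k E.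
have [h hi hc] := weakly_cauchy_subsequence sE norad x1.
have [C' Psum'] := pointwise_summable_subsequence hi Psum.
have [Q [v [Qsum Qw v1 vd vc]]] : exists (Q : nat -> X) (v : nat -> E),
    [/\ pointwise_summable Q C', forall i, weak_contPoly n E F (Q i), forall i, nrm (v i) <= 1,
      forall i, delta <= nrm (Q i (v i)) &
      forall g, bfun (@rnorm R k E) g -> cauchy_seqR (fun i => g (v i))].
  exists (P \o h), (x \o h); split.
  - exact: Psum'.
  - by move=> i; exact: Pw.
  - by move=> i; exact: x1.
  - by move=> i; exact: xd.
  - exact: hc.
move: Q v Qsum Qw v1 vd vc => {P x Psum Psum' Pw x1 xd C h hi hc} P x Psum Pw x1 xd xc.
have xwc : weakly_cauchy x by split => //; exists 1.
have Gc (G : X) : weak_contPoly n E F G -> forall e : R, 0 < e -> exists J, forall m l,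
    (J <= m)%N -> (J <= l)%N -> nrm (G (x m) - G (x l)) < e.
  move=> Gw; apply: (weakly_cauchy_image (homogeneous_deg_lt (contPoly_hom G))) => //.
  exact: weak_contPoly_seq.
(* The errors will total 4 eta = delta / 2: eta for i < j, eta for i = j and 2 eta for i > j. *)
have [eta eta0 etaE] : exists2 eta, 0 < eta & eta = delta / 8 by exists (delta / 8) => //; rewrite divr_gt0.
have [||a [b [ab bi A1 B1 B2]]] := @separated_pairs R
    (fun i l l' => nrm (P i (x l) - P i (x l'))) (fun i l => nrm (P i (x l))) eta eta0.
- by move=> i; exact: Gc.
(* The series of the P i at x l is Cauchy, so its terms tend to 0. *)
- move=> l e e0; have [|J JP] := Psum.2 (fun=> 1) (x l) _ e e0.
    by exists 1 => i; rewrite normr1.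
  exists J => i Ji; have := JP i.+1 i (leqW Ji) Ji.
  by rewrite big_ord_recr /= addrAC subrr add0r ofR1 scale1r.
have [C'' Psum'] := pointwise_summable_subsequence bi Psum.
(* Norming functionals are prepared for every j, since the j in M to be used is known only later. *)
have /choice[f fP] j : exists g, bfun (@rnorm R k F) g /\ g (P (b j) (x (b j))) = nrm (P (b j) (x (b j))).
  by have [g gb gw] := hahn_banach (P (b j) (x (b j)) : realified F) (@rnorm_seminorm R k F); exists g.
pose y (t : nat * bool) := if t.2 then x (b t.1) else x (a t.1).
have [M [G [g [Minf Gw gP Gg]]]] := @projection_agrees _ _ _ _ _ (P \o b) _ p Psum'
  (fun i => Pw (b i)) pp (nat * bool)%type (fun t => f t.1) y (fun t => (fP t.1).1).
have [J JP] := Gc G Gw (delta / 2) (divr_gt0 d0 (ltr0Sn _ 1)).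
have [j Jj Mj] := Minf J.
have [ja jb] := ab j.
pose bd i : R := (if (i < j)%N then eta / j.+1%:R else 0) + ((i == j)%:R * eta + 2 * eta * (2 ^+ i.+1)^-1).
have bd0 i : [/\ 0 <= eta / j.+1%:R, 0 <= (i == j)%:R * eta & 0 <= 2 * eta * (2 ^+ i.+1)^-1].
  by rewrite !mulr_ge0 ?invr_ge0 ?exprn_ge0// ltW.
have est i : nrm (ofR k (M i)%:R *: (P (b i) (x (b j)) - P (b i) (x (a j))) -
    ofR k (i == j)%:R *: P (b j) (x (b j))) <= bd i.
  have [h1 h2 h3] := bd0 i; rewrite /bd; case: (ltngtP i j) => [ij|ji|->].
  - rewrite ofR0 scale0r subr0 nrmZR.
    apply: le_trans (_ : nrm (P (b i) (x (b j)) - P (b i) (x (a j))) <= _).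
      by rewrite ler_piMl ?nrm_ge0// ger0_norm//; case: (M i).
    by have /= H := A1 i j ij; rewrite mul0r add0r; apply: le_trans H _; rewrite lerDl.
  - rewrite ofR0 scale0r subr0 nrmZR.
    apply: le_trans (_ : nrm (P (b i) (x (b j)) - P (b i) (x (a j))) <= _).
      by rewrite ler_piMl ?nrm_ge0// ger0_norm//; case: (M i).
    have /= [b1 b2] := B2 i j ji; apply: le_trans (nrmB _ _) _.
    rewrite mul0r !add0r; lra.
  - rewrite Mj ofR1 !scale1r mul1r addrAC subrr add0r nrmN.
    by apply: le_trans (B1 j) _; rewrite add0r lerDl; have [] := bd0 j.
have sumbd m : (j < m)%N -> \sum_(i < m) bd i <= 4 * eta.
  move=> jm; rewrite !big_split /= sum_delta// -mulr_sumr.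
  have s1 : \sum_(i < m) (if (i < j)%N then eta / j.+1%:R else 0) <= eta.
    rewrite -(big_mkord predT (fun i => if (i < j)%N then eta / j.+1%:R else 0)).
    rewrite (big_cat_nat (leq0n j) (ltnW jm))//= [X in _ + X]big_nat_cond.
    rewrite [X in _ + X]big1 ?addr0 => [|i /andP[/andP[ji _] _]]; last by rewrite ltnNge ji.
    apply: le_trans (_ : \sum_(0 <= i < j) eta / j.+1%:R <= _).
      rewrite big_nat_cond [leRHS]big_nat_cond.
      by apply: ler_sum => i /andP[/andP[_ ->]].
    rewrite sumr_const_nat subn0 -[leLHS]mulr_natr mulrAC ler_pdivrMr// ler_wpM2l ?(ltW eta0)// ler_nat.
    exact: leqnSn.
  have := @sum_geometric_le R m; nra.
have gv : nrm (g (x (b j)) - g (x (a j)) - P (b j) (x (b j))) <= delta / 2.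
  apply/ler_addgt0Pr => e' e'0; have e2 : 0 < e' / 2 by rewrite divr_gt0.
  have /cvg_nrm_nat/(_ _ e2)[J1 J1P] := gP (x (b j)).
  have /cvg_nrm_nat/(_ _ e2)[J2 J2P] := gP (x (a j)).
  pose m := maxn (maxn J1 J2) j.+1.
  have jm : (j < m)%N by rewrite leq_max ltnSn orbT.
  have := J1P m _; have := J2P m _; rewrite !leq_max !leqnn ?orbT => /(_ isT) + /(_ isT).
  set S2 := \sum_(i < m) _; set S1 := \sum_(i < m) _ => h2 h1.
  have SE : S1 - S2 - P (b j) (x (b j)) = \sum_(i < m) (ofR k (M i)%:R *: (P (b i) (x (b j)) - P (b i) (x (a j))) -
      ofR k (i == j :> nat)%:R *: P (b j) (x (b j))).
    rewrite sumrB; congr (_ - _).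
      by rewrite -sumrB; apply: eq_bigr => i _; rewrite scalerBr.
    rewrite (bigD1 (Ordinal jm))//= eqxx ofR1 scale1r big1 ?addr0// => i.
    by rewrite -val_eqE /= => /negPf ->; rewrite ofR0 scale0r.
  have Sd : nrm (S1 - S2 - P (b j) (x (b j))) <= 4 * eta.
    rewrite SE; apply: le_trans (nrm_sum _ _ _) _; apply: le_trans (sumbd m jm).
    by apply: ler_sum => i _; exact: est.
  have := nrmD (g (x (b j)) - g (x (a j)) - (S1 - S2)) (S1 - S2 - P (b j) (x (b j))).
  rewrite addrA subrK opprD opprK [_ + (- S1 + S2)]addrACA.
  have := nrmD (g (x (b j)) - S1) (- g (x (a j)) + S2).
  rewrite [- _ + S2]addrC [nrm (g (x (b j)) - S1)]nrm_distC.
  move: Sd; rewrite etaE; lra.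
have fn (q : F) : `|f j q| <= nrm q := bfun_norm (@rnorm_seminorm R k F) (fP j).1 q.
have fD (q q' : F) : f j (q - q') = f j q - f j q' := bfunB (fP j).1 q q'.
have := JP (b j) (a j) (leq_trans Jj jb) (leq_trans Jj ja).
have := fn (G (x (b j)) - G (x (a j))); have := fn (g (x (b j)) - g (x (a j)) - P (b j) (x (b j))).
have := Gg (j, true); have := Gg (j, false); rewrite /y /= !fD (fP j).2 => -> ->.
have := xd (b j).
have := ler_normB (f j (g (x (b j))) - f j (g (x (a j)))) (f j (g (x (b j))) - f j (g (x (a j))) - nrm (P (b j) (x (b j)))).
rewrite opprB addrC subrK (ger0_norm (nrm_ge0 (P (b j) (x (b j))))); lra.
Qed.

End main_lemma.

(** * Pointwise null functionals and copies of c_0 *)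

Section biorthogonal.
Variables (R : realType) (k : scalar_kind).
Local Notation K := (scalars R k).
Variable E : normedModType K.
Local Notation bf := (bfun (@rnorm R k E)).

(** Finitely many kernels meet in a subspace of finite codimension, so an infinite-dimensional E has
    a nonzero vector in all of them. *)
Lemma finite_codimension_kernels (phi : nat -> dual E) n : exists m (e : 'I_m -> E), forall x,
  exists c : 'I_m -> K, forall i, (i < n)%N -> sval (phi i) (x - \sum_j c j *: e j) = 0.
Proof.
elim: n => [|n [m [e eP]]].
  by exists 0%N, (fun=> 0) => x; exists (fun=> 0).
have [[y [y0 yn]]|H] := pselect (exists y, (forall i, (i < n)%N -> sval (phi i) y = 0) /\ sval (phi n) y != 0).
  exists m.+1, (fun j => oapp e y (unlift ord0 j)) => x; have [c cP] := eP x.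
  pose z := x - \sum_j c j *: e j; pose a : K := sval (phi n) z / sval (phi n) y.
  exists (fun j => oapp c a (unlift ord0 j)) => i; rewrite ltnS leq_eqVlt => iP.
  rewrite big_ord_recl unlift_none /= opprD addrCA.
  under eq_bigr do rewrite liftK /=.
  rewrite -/z addrC linearB linearZ /=; case/orP: iP => [/eqP ->|ip].
    by rewrite /a [_ *: _]divfK// subrr.
  by rewrite (cP i ip) y0// scaler0 subr0.
exists m, e => x; have [c cP] := eP x; exists c => i; rewrite ltnS leq_eqVlt.
case/orP=> [/eqP ->|]; last exact: cP.
by apply: contrapT => /eqP h; apply: H; exists (x - \sum_j c j *: e j).
Qed.

Lemma biorthogonal_sequence : ~ finite_dimensional E ->
  exists (f : nat -> realified E -> R) (x : nat -> E), [/\ forall i, bf (f i),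
    forall i, nrm (x i) <= 1, forall i j, (i < j)%N -> f i (x j) = 0 & forall i, f i (x i) = 1].
Proof.
move=> infdim; have sE := @rnorm_seminorm R k E.
have /choice[step stepP] (s : nat * (nat -> dual E)) : exists t : (realified E -> R) * (dual E * E),
    [/\ bf t.1, (forall x, reK (sval t.2.1 x) = t.1 x), nrm t.2.2 = 1,
        (forall i, (i < s.1)%N -> sval (s.2 i) t.2.2 = 0) & t.1 t.2.2 = 1].
  have [y [yn y0]] : exists y : E, (forall i, (i < s.1)%N -> sval (s.2 i) y = 0) /\ y != 0.
    have [m [e eP]] := finite_codimension_kernels s.2 s.1.
    apply: contrapT => H; apply: infdim; exists m, e => x; have [c cP] := eP x.
    exists c; apply/eqP; rewrite -subr_eq0; apply/negPn/negP => h; apply: H.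
    by exists (x - \sum_j c j *: e j).
  have ny : 0 < nrm y.
    by rewrite lt_neqAle nrm_ge0 andbT eq_sym; apply: contraNneq y0 => /nrm_eq0 ->.
  pose z : E := ofR k (nrm y)^-1 *: y.
  have nz : nrm z = 1 by rewrite nrmZR gtr0_norm ?invr_gt0// mulVf// gt_eqF.
  have [g gb gz] := hahn_banach (z : realified E) sE.
  have [phi [phiP _]] := dual_of_bfun gb.
  exists (g, (phi, z)); split => //=; last by rewrite gz.
  by move=> i /yn h; rewrite linearZ /= h scaler0.
have [phi0 _] := dual_of_bfun (bfun_cst0 sE).
(* [L n] holds the functionals of the stages below n; stage n picks a unit vector in their kernels
   and a functional norming it. *)
pose fix L n := if n is m.+1 then fun i => if i == m then (step (m, L m)).2.1 else L m i
                else fun=> phi0.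
have LE i n : (i < n)%N -> L n i = (step (i, L i)).2.1.
  by elim: n => // n IH; rewrite ltnS leq_eqVlt /=; case: eqVneq => [->|_ /IH].
exists (fun i => (step (i, L i)).1), (fun i => (step (i, L i)).2.2).
split=> [i|i|i j ij|i]; try by have [? ? ? ? ?] := stepP (i, L i).
  by have [_ _ -> _ _] := stepP (i, L i).
have [_ phiE _ _ _] := stepP (i, L i); rewrite -phiE -(LE i j ij).
by have [_ _ _ /(_ i ij) /= -> _] := stepP (j, L j); rewrite reK0.
Qed.

Lemma null_functionals : ~ finite_dimensional E ->
  (forall (y : nat -> realified E) c, ~ rademacher_system (@rnorm R k E) y c) ->
  exists (phi : nat -> dual E) (u : nat -> E) (c : R), [/\ 0 < c, (forall i, nrm (u i) <= 1),
    (forall i, c <= nrm (sval (phi i) (u i))),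
    (forall i v, nrm (sval (phi i) v) <= 2 * nrm v) &
    forall v (e : R), 0 < e -> exists J, forall i, (J <= i)%N -> nrm (sval (phi i) v) < e].
Proof.
move=> infdim norad; have sE := @rnorm_seminorm R k E.
have [f [x [fb x1 f0 f1]]] := biorthogonal_sequence infdim.
have [g [u [c [gb g0 c0 u1 cu]]]] := josefson_nissenzweig sE norad fb x1 f0 f1.
have /choice[phi phiP] i := dual_of_bfun (gb i).
exists phi, u, c; split => //.
- move=> i; apply: le_trans (cu i) _; have [<- _] := phiP i.
  by apply: le_trans (ler_norm _) _; exact: reK_norm.
- move=> i v; have [_ h] := phiP i; apply: le_trans (h v) _.
  have /= := bfun_norm sE (gb i) v; have /= := bfun_norm sE (gb i) (iK R k *: v).
  rewrite /rnorm nrmZ; have := nrm_iK R k; have := nrm_ge0 v.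
  have := nrm_ge0 (iK R k : K^o); nra.
move=> v e e0; have e2 : 0 < e / 2 by rewrite divr_gt0.
have [J JP] := g0 v _ e2; have [J' J'P] := g0 (iK R k *: v) _ e2.
exists (maxn J J') => i; rewrite geq_max => /andP[/JP h /J'P h'].
have [_ H] := phiP i; apply: le_lt_trans (H v) _; lra.
Qed.

End biorthogonal.

(** * Copies of c_0 and the conclusion *)

Section c0_copy.
Variables (R : realType) (k : scalar_kind).
Local Notation K := (scalars R k).

Let truncated_null (a : nat -> K) m : (fun i => if (i < m)%N then a i else 0) \in @null_seq K.
Proof.
apply/asboolP/cvg_nrm_nat => e e0; exists m => i mi.
by rewrite ltnNge mi subrr nrm0.
Qed.

Let truncated a m : c0 K := C0 (truncated_null a m).

Let unit_vector i := truncated (fun j => (j == i)%:R) i.+1.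

Let c0_nonempty : [set: nat] !=set0. Proof. by exists 0%N. Qed.

Let truncated_nrm a m : (forall i, nrm (a i : K^o) <= 1) -> nrm (truncated a m) <= 1.
Proof.
move=> a1; rewrite -(@ofR_le _ k) -nrmE.
apply: (supnorm_le (A := [set: nat]) c0_nonempty).
  by have [M uM] := c0_bounded (truncated a m); exists M.
move=> i _ /=; rewrite nrmE ofR_le; case: ifP => // _; by rewrite nrm0.
Qed.

Let unit_vector_nrm i : 1 <= nrm (unit_vector i).
Proof.
rewrite -(@ofR_le _ k) -nrmE ofR1.
have -> : 1 = `|(unit_vector i : nat -> K^o) i| by rewrite /= ltnSn eqxx normr1.
apply: (supnorm_ge (A := [set: nat]) c0_nonempty) => //.
by have [M uM] := c0_bounded (unit_vector i); exists M.
Qed.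

Let truncatedE a m : truncated a m = \sum_(i < m) a i *: unit_vector i.
Proof.
elim: m => [|m IH]; first by rewrite big_ord0; apply/val_inj/funext.
rewrite big_ord_recr /= -IH; apply/val_inj/funext => i.
have -> : val (truncated a m + a m *: unit_vector m) i =
  val (truncated a m) i + a m * val (unit_vector m) i by [].
rewrite /= ltnS leq_eqVlt; case: eqVneq => [->|im] /=.
  by rewrite ltnn mulr1 add0r.
by rewrite if_same mulr0 addr0.
Qed.

(** The images of the unit vectors. They are bounded below because the inverse is continuous at 0
    and unit vectors have norm at least 1. *)
Lemma c0_copy_sequence (X : normedModType K) (A : set X) : contains_copy A (c0 K) ->
  exists (P : nat -> X) (C delta : R), [/\ 0 < delta, forall i, A (P i),
    forall i, delta <= nrm (P i) &
    forall (a : nat -> K) m, (forall i, nrm (a i : K^o) <= 1) -> nrm (\sum_(i < m) a i *: P i) <= C].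
Proof.
move=> [T [S [TA _ Tc TK Sc]]].
have [C C0 CP] := continuous_linear_bound Tc.
have T0 : range T 0 by exists 0 => //; rewrite linear0.
have S0 : S 0 = 0 by rewrite -(linear0 T) TK.
have /subspace_continuousP/(_ 0 T0) := Sc.
move=> /cvgrPdist_lt/(_ 1 ltr01) /nbhs_normP[e /= e0 eP].
exists (fun i => T (unit_vector i)), C, (reK e); split.
- by rewrite -(@ofR_lt _ k) ofR0 -ge0_ofR// ltW.
- by move=> i; apply: TA; exists (unit_vector i).
- move=> i; rewrite leNgt; apply/negP => h.
  have : `|0 - T (unit_vector i)| < e -> range T (T (unit_vector i)) ->
    `|S 0 - S (T (unit_vector i))| < 1 := eP (T (unit_vector i)).
  rewrite S0 sub0r normrN TK sub0r normrN nrmE.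
  rewrite [e]ge0_ofR ?ltW// ofR_lt => /(_ h)/(_ (imageT _ _)).
  by rewrite nrmE -(@ofR1 R k) ofR_lt ltNge unit_vector_nrm.
move=> a m a1; have -> : \sum_(i < m) a i *: T (unit_vector i) = T (truncated a m).
  by rewrite truncatedE linear_sum; apply: eq_bigr => i _; rewrite linearZ.
apply: le_trans (CP _) _; rewrite -[leRHS]mulr1 ler_pM2l//; exact: truncated_nrm.
Qed.

End c0_copy.

Section unconditional_blocks.
Variables (R : realType) (k : scalar_kind).
Local Notation K := (scalars R k).
Variable F : normedModType K.

Definition weakly_unconditionally_cauchy (v : nat -> F) (C : R) :=
  forall (a : nat -> K) m, (forall i, nrm (a i : K^o) <= 1) -> nrm (\sum_(i < m) a i *: v i) <= C.

Lemma weakly_unconditionally_cauchyZ v C (a : nat -> K) m (B : R) :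
  weakly_unconditionally_cauchy v C -> 0 < B -> (forall i, nrm (a i : K^o) <= B) ->
  nrm (\sum_(i < m) a i *: v i) <= B * C.
Proof.
move=> vC B0 aB.
have := vC (fun i => ofR k B^-1 * a i) m.
have -> : \sum_(i < m) (ofR k B^-1 * a i) *: v i = ofR k B^-1 *: \sum_(i < m) a i *: v i.
  by rewrite scaler_sumr; apply: eq_bigr => i _; rewrite scalerA.
rewrite nrmZR gtr0_norm ?invr_gt0// ler_pdivrMl//; apply => i.
have -> : nrm (ofR k B^-1 * a i : K^o) = `|B^-1| * nrm (a i : K^o) by exact: (nrmZR B^-1 (a i : K^o)).
by rewrite gtr0_norm ?invr_gt0// ler_pdivrMl// mulr1.
Qed.

(** Partial sums that are not Cauchy have infinitely many disjoint blocks of norm at least e.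
    Combinations of blocks are combinations of the v i with bounded coefficients. *)
Lemma weakly_unconditionally_cauchy_blocks v C : weakly_unconditionally_cauchy v C ->
  ~ (forall xi, bounded_seqR xi -> cauchy_nrm (fun m => \sum_(i < m) ofR k (xi i) *: v i)) ->
  exists (y : nat -> F) (C' e : R), [/\ 0 < e, forall i, e <= nrm (y i) &
    weakly_unconditionally_cauchy y C'].
Proof.
move=> vC /existsNP[xi /not_implyP[[B xiB] /existsNP[e /not_implyP[e0 H]]]].
pose S m := \sum_(i < m) ofR k (xi i) *: v i.
have /choice[pq pqP] J : exists ml : nat * nat, [/\ (J <= ml.1)%N, (ml.1 < ml.2)%N & e <= nrm (S ml.2 - S ml.1)].
  apply: contrapT => h; apply: H; exists J => m l Jm Jl; rewrite ltNge; apply/negP => eml.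
  case: (ltngtP m l) => ml; apply: h.
  - by exists (m, l) => /=; split => //; rewrite nrm_distC.
  - by exists (l, m).
  - by move: eml; rewrite ml subrr nrm0 leNgt e0.
pose fix J i := if i is j.+1 then (pq (J j)).2 else 0%N.
pose p i := (pq (J i)).1.
have Jp i : (J i <= p i)%N by have [] := pqP (J i).
have pJ i : (p i < J i.+1)%N by have [] := pqP (J i).
pose y i := S (J i.+1) - S (p i).
have yE i : y i = \sum_(p i <= j < J i.+1) ofR k (xi j) *: v j.
  rewrite /y /S -!(big_mkord predT (fun j => ofR k (xi j) *: v j)).
  by rewrite (big_cat_nat (leq0n (p i)) (ltnW (pJ i)))//= addrAC subrr add0r.
have B1 : 0 < `|B| + 1 by have := normr_ge0 B; lra.
exists y, ((`|B| + 1) * C), e; split => //; first by move=> i; have [] := pqP (J i).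
move=> a m a1.
have [d dB ->] : exists2 d : nat -> K, forall i, nrm (d i : K^o) <= `|B| + 1 &
    \sum_(i < m) a i *: y i = \sum_(i < J m) d i *: v i.
  elim: m => [|m [d dB dE]]; first by exists (fun=> 0) => [i|]; rewrite ?big_ord0 ?nrm0 ?ltW.
  (* Zeros fill the gap between the end of one block and the start of the next. *)
  pose d' i := if (i < J m)%N then d i else if (i < p m)%N then 0 else a m * ofR k (xi i).
  exists d'.
    move=> i; rewrite /d'; case: ifP => // _; case: ifP => [_|_]; first by rewrite nrm0 ltW.
    have -> : nrm (a m * ofR k (xi i) : K^o) = nrm (a m : K^o) * nrm (ofR k (xi i) : K^o).
      exact: (nrmZ (a m) (ofR k (xi i) : K^o)).
    rewrite nrm_ofR; have := xiB i; have := a1 m; have := nrm_ge0 (a m : K^o).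
    have := normr_ge0 (xi i); have := ler_norm B; nra.
  rewrite big_ord_recr /= dE yE -(big_mkord predT (fun i => d i *: v i)) -(big_mkord predT (fun i => d' i *: v i)) /d'.
  rewrite [RHS](big_cat_nat (leq0n (J m)) (ltnW (leq_ltn_trans (Jp m) (pJ m))))//=.
  congr (_ + _); first by apply: eq_big_nat => i /andP[_ ->].
  rewrite [RHS](big_cat_nat (Jp m) (ltnW (pJ m)))//= [X in _ = X + _]big_nat_cond.
  rewrite [X in _ = X + _]big1 ?add0r => [|i /andP[/andP[Ji ip] _]]; last first.
    by rewrite ltnNge Ji ip scale0r.
  rewrite scaler_sumr; apply: eq_big_nat => i /andP[pi _].
  by rewrite ltnNge (leq_trans (Jp m) pi) /= ltnNge pi scalerA.
exact: weakly_unconditionally_cauchyZ.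
Qed.

End unconditional_blocks.

Section c0_uncomplemented.
Variables (R : realType) (k : scalar_kind).
Local Notation K := (scalars R k).
Variables (E : normedModType K) (F : completeNormedModType K) (n : nat).
Local Notation X := (contPoly n E F).

(** At each point the coefficients phi_i^n tend to 0, and a weakly unconditionally Cauchy series
    with null coefficients converges, even though the y i are bounded below. *)
Lemma monomials_uncomplemented (y : nat -> F) (C e : R) (p : {linear X -> X}) : (0 < n)%N ->
  ~ finite_dimensional E ->
  (forall (z : nat -> realified E) c, ~ rademacher_system (@rnorm R k E) z c) ->
  weakly_unconditionally_cauchy y C -> 0 < e -> (forall i, e <= nrm (y i)) ->
  ~ bounded_projection p.
Proof.
move=> n0 infdim norad yC e0 ye.
have [phi [u [c [c0 u1 cu phi2 phi0]]]] := null_functionals infdim norad.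
have /choice[P PP] i := dual_monomial (phi i) n (y i).
have nX (z : K) : nrm (z ^+ n : K^o) = nrm (z : K^o) ^+ n by exact: nrmX.
have PE (xi : nat -> R) z m : \sum_(i < m) ofR k (xi i) *: P i z =
    \sum_(i < m) (ofR k (xi i) * (sval (phi i) z : K) ^+ n) *: y i.
  by apply: eq_bigr => i _; have [_ ->] := PP i; rewrite scalerA.
have coefE a (z : K) : nrm (ofR k a * z ^+ n : K^o) = `|a| * nrm (z : K^o) ^+ n.
  by rewrite -nX; exact: (nrmZR a (z ^+ n : K^o)).
have cn0 : 0 < c ^+ n * e by rewrite mulr_gt0 ?exprn_gt0.
apply: (@summable_uncomplemented _ _ _ _ _ P (2 ^+ n * C) (c ^+ n * e) u) => //.
- split=> [xi m z xi1 z1|xi z [B xiB]].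
    rewrite PE; apply: (weakly_unconditionally_cauchyZ
      (a := fun i => ofR k (xi i) * (sval (phi i) z : K) ^+ n) _ yC).
      by rewrite exprn_gt0.
    move=> i; rewrite coefE; apply: (@le_trans _ _ (nrm (sval (phi i) z) ^+ n)).
      by rewrite ler_piMl ?exprn_ge0 ?nrm_ge0.
    rewrite lerXn2r ?nnegrE ?nrm_ge0//; have := phi2 i z; lra.
  move=> d d0.
  have D0 : 0 < (`|B| + 1) * (`|C| + 1).
    by rewrite mulr_gt0// ltr_pwDr.
  (* The minimum with 1 makes n-th powers of values below t again at most t; the quotient makes the
     tails at most d / 2. *)
  pose t := Num.min 1 (d / (2 * ((`|B| + 1) * (`|C| + 1)))).
  have t0 : 0 < t by rewrite lt_min ltr01 divr_gt0// mulr_gt0.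
  have [J JP] := phi0 z t t0; exists J.
  have main m l : (J <= l)%N -> (l <= m)%N ->
      nrm (\sum_(i < m) ofR k (xi i) *: P i z - \sum_(i < l) ofR k (xi i) *: P i z) < d.
    move=> Jl lm; rewrite !PE.
    pose b i : K := if (i < l)%N then 0 else ofR k (xi i) * (sval (phi i) z : K) ^+ n.
    have -> : \sum_(i < m) (ofR k (xi i) * (sval (phi i) z : K) ^+ n) *: y i -
        \sum_(i < l) (ofR k (xi i) * (sval (phi i) z : K) ^+ n) *: y i = \sum_(i < m) b i *: y i.
      rewrite -!(big_mkord predT (fun i => (ofR k (xi i) * (sval (phi i) z : K) ^+ n) *: y i)).
      rewrite -(big_mkord predT (fun i => b i *: y i)).
      rewrite (big_cat_nat (leq0n l) lm)//= [RHS](big_cat_nat (leq0n l) lm)//=.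
      rewrite addrAC subrr add0r big_nat_cond [X in _ = X + _]big_nat_cond.
      rewrite [X in _ = X + _]big1 ?add0r => [|i /andP[/andP[_ il] _]]; last first.
        by rewrite /b il scale0r.
      rewrite [RHS]big_nat_cond; apply: eq_bigr => i /andP[/andP[li _] _].
      by rewrite /b ltnNge li.
    have B1 : 0 < `|B| + 1 by rewrite ltr_pwDr.
    apply: (@le_lt_trans _ _ (((`|B| + 1) * t) * C)).
      apply: (weakly_unconditionally_cauchyZ _ yC); first by rewrite mulr_gt0.
      move=> i; rewrite /b; case: ltnP => li; first by rewrite nrm0 ltW// mulr_gt0.
      rewrite coefE; apply: ler_pM => //; first by rewrite exprn_ge0 ?nrm_ge0.
        by apply: le_trans (xiB i) _; have := ler_norm B; lra.
      have st := JP i (leq_trans Jl li); have t1 : t <= 1 by rewrite ge_min lexx.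
      case: (n) n0 => // n' _; rewrite exprS; have := nrm_ge0 (sval (phi i) z).
      have : nrm (sval (phi i) z) ^+ n' <= 1 by rewrite exprn_ile1 ?nrm_ge0//; lra.
      have : 0 <= nrm (sval (phi i) z) ^+ n' by rewrite exprn_ge0 ?nrm_ge0.
      nra.
    apply: (@le_lt_trans _ _ (((`|B| + 1) * t) * (`|C| + 1))).
      rewrite ler_wpM2l ?mulr_ge0 ?ltW//; have := ler_norm C; lra.
    have tD : t <= d / (2 * ((`|B| + 1) * (`|C| + 1))) by rewrite ge_min lexx orbT.
    rewrite mulrAC mulrC; apply: (@le_lt_trans _ _ (d / 2)); last by lra.
    rewrite -ler_pdivlMr//; apply: le_trans tD _.
    by rewrite invfM mulrA.
  move=> m l Jm Jl; have [lm|/ltnW ml] := leqP l m; first exact: main.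
  by rewrite nrm_distC; exact: main.
- by move=> i; have [] := PP i.
move=> i; have [_ ->] := PP i; rewrite nrmZ nX; apply: ler_pM => //.
- by rewrite exprn_ge0// ltW.
- exact: ltW.
by rewrite lerXn2r ?nnegrE ?nrm_ge0 ?(ltW c0) ?cu.
Qed.

(** The scalar M is replaced by its real part, after taking real parts in M |Q| - |p Q| >= 0. *)
Lemma bounded_projection_of (p : {linear X -> X}) :
  (exists M : K, forall Q, `|p Q| <= M * `|Q|) -> (forall Q, p (p Q) = p Q) ->
  range p = weak_contPoly n E F -> bounded_projection p.
Proof.
move=> [M pM] pp prange; split => //; exists (reK M) => Q.
have h : 0 <= M * `|Q| - `|p Q| by rewrite subr_ge0.
have : 0 <= reK (M * `|Q| - `|p Q|) by rewrite -(@ofR_le _ k) ofR0 -ge0_ofR.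
by rewrite reKD reKN !nrmE ofRK mulrC reKM subr_ge0 mulrC.
Qed.

Lemma c0_copy_uncomplemented (P : nat -> X) (C delta : R) (p : {linear X -> X}) :
  (1 < n)%N -> ~ finite_dimensional E -> (forall i, weak_contPoly n E F (P i)) ->
  weakly_unconditionally_cauchy P C -> 0 < delta -> (forall i, delta <= nrm (P i)) ->
  ~ bounded_projection p.
Proof.
move=> n1 infdim Pw PC d0 Pd pp; have d2 : 0 < delta / 2 by rewrite divr_gt0.
(* The supremum defining the norm need not be attained, hence delta / 2. *)
have /choice[x xP] i : exists x : E, nrm x <= 1 /\ delta / 2 <= nrm (P i x).
  apply: contrapT => H; have := Pd i; apply/negP; rewrite -ltNge.
  apply: (@le_lt_trans _ _ (delta / 2)); last by lra.
  apply: nrm_contPoly_le => x x1; rewrite leNgt; apply/negP => h.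
  by apply: H; exists x; split => //; exact: ltW.
have [[z [c zc]]|norad] := pselect (exists (z : nat -> realified E) c, rademacher_system (@rnorm R k E) z c).
  apply: (l1_uncomplemented (w := P 0%N (x 0%N)) n1 _ zc pp).
  by apply/eqP => P0; have [_] := xP 0%N; rewrite P0 nrm0; lra.
have {}norad (z : nat -> realified E) c : ~ rademacher_system (@rnorm R k E) z c.
  by move=> zc; apply: norad; exists z, c.
have Px z : weakly_unconditionally_cauchy (fun i => P i z) ((nrm z + 1) ^+ n * C).
  move=> a m a1; rewrite -contPoly_sumE; apply: le_trans (nrm_contPoly_bound _ _) _.
  by rewrite ler_wpM2l ?exprn_ge0 ?addr_ge0 ?nrm_ge0//; exact: PC.
have [Pc|] := pselect (forall z xi, bounded_seqR xi ->
    cauchy_nrm (fun m => \sum_(i < m) ofR k (xi i) *: P i z)); last first.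
  move=> /existsNP[z] /(weakly_unconditionally_cauchy_blocks (Px z))[y [C' [e [e0 ye yC]]]].
  exact: (monomials_uncomplemented (ltnW n1) infdim norad yC e0 ye pp).
apply: (@summable_uncomplemented _ _ _ _ _ P C (delta / 2) x p) => //.
- split=> [xi m z xi1 z1|xi z]; last exact: Pc.
  rewrite -(contPoly_sumE _ (fun i : 'I_m => ofR k (xi i)) (fun i => P i)).
  apply: le_trans (nrm_contPoly _ z1) _; apply: (PC (fun i => ofR k (xi i))) => i.
  by rewrite nrm_ofR.
- by move=> i; have [] := xP i.
- by move=> i; have [] := xP i.
Qed.

End c0_uncomplemented.

Theorem proposition3p11 (R : realType) (k : scalar_kind)
    (E F : completeNormedModType (scalars R k)) (n : nat) :
  (1 < n)%N ->
  ~ finite_dimensional E ->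
  contains_copy (weak_contPoly n E F) (c0 (scalars R k)) ->
  ~ complemented (weak_contPoly n E F).
Proof.
move=> n1 infdim /c0_copy_sequence[P [C [delta [d0 Pw Pd PC]]]] [p [pM pp prange]].
exact: (c0_copy_uncomplemented n1 infdim Pw PC d0 Pd (bounded_projection_of pM pp prange)).
Qed.
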